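(* Assume that $U$ is closed-valued with Borel graph and that $f,g$ satisfy the regularity conditions stated in the context. Let $u^0\in\mathfrak U$, with trajectory $x^0=x^{u^0}$, be uniformly overtaking optimal. Then for each unbounded sequence $\tau=(\tau_n)_{n\in\mathbb N}$ of times in $\mathbb T$ there exists a $\tau$-vanishing Lagrange multiplier $(\lambda^0,\psi^0)\in\Lambda$.
   Context: Setting. $\mathbb T=[0,\infty)$, $\mathbb X=\mathbb R^m$, $\mathbb U$ is a finite-dimensional Euclidean space. $U$ assigns to each $t\in\mathbb T$ a subset $U(t)\subset\mathbb U$; $\mathfrak U$ is the set of Borel measurable locally bounded $u:\mathbb T\to\mathbb U$ with $u(t)\in U(t)$. Let $f:\mathbb T\times\mathbb X\times\mathbb U\to\mathbb X$, $g:\mathbb T\times\mathbb X\times\mathbb U\to\mathbb R$, $x_{**}\in\mathbb X$. For $u\in\mathfrak U$, $x^u$ solves $\dot x=f(t,x,u(t))$, $x(0)=x_{**}$, and $J^u(T)=\int_0^T g(t,x^u(t),u(t))\,dt$. Regularity conditions on $f,g$: each of $a=f,\ g,\ \partial f/\partial x,\ \partial g/\partial x$ is defined on $\mathbb T\times\mathbb X\times\mathbb U$, is Carath\'eodory (Borel in $t$ for all $(x,u)$, continuous in $(x,u)$ for a.e. $t$), and for each compact $K\subset\mathbb X\times\mathbb U$ there are locally integrable $L^a_K,M^a_K:\mathbb T\to\mathbb T$ with $\|a(t,x,u)-a(t,y,u)\|\le L^a_K(t)\|x-y\|$ and $\|a(t,x,u)\|\le M^a_K(t)$ for all $(x,u),(y,u)\in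 K$, $t\in\mathbb T$. Moreover $f$ has sublinear growth in $x$: for each compact $C\subset\mathbb U$ there is a locally integrable $l_C$ with $\|f(t,x,u)\|\le l_C(t)(1+\|x\|)$ for $u\in C$. $u^0\in\mathfrak U$ is uniformly overtaking optimal if $\limsup_{t\to\infty}\sup_{u\in\mathfrak U}(J^u(t)-J^{u^0}(t))=0$. Multipliers. Shadow prices $\psi$ are row vectors. $\mathcal H(x,t,u,\lambda,\psi)=\psi f(t,x,u)+\lambda g(t,x,u)$ for $\lambda\ge0$. A Lagrange multiplier associated with $(x^0,u^0)$ is a nontrivial pair $(\lambda,\psi)\in[0,1]\times C(\mathbb T,\mathbb X)$ with, for a.e. $t$, $\dot\psi(t)=-\frac{\partial\mathcal H}{\partial x}(x^0(t),t,u^0(t),\lambda,\psi(t))$ and $\sup_{p\in U(t)}\mathcal H(x^0(t),t,p,\lambda,\psi(t))=\mathcal H(x^0(t),t,u^0(t),\lambda,\psi(t))$. $\Lambda$ is the set of such multipliers with either $\lambda=1$, or $\lambda=0$ and $\|\psi(0)\|=1$. Consider the system (S) for $(\psi,x,\lambda)$, $\lambda\ge0$: $\dot\psi=-\frac{\partial\mathcal H}{\partial x}(x(t),t,u^0(t),\lambda,\psi(t))$, $\dot x=f(t,x(t),u^0(t))$, $\dot\lambda=0$. A Lagrange multiplier $(\lambda^0,\psi^0)$ associated with $(x^0,u^0)$ is $\tau$-vanishing if there are a subsequence $\tau'$ of $\tau$ (with $\tau'_n\uparrow\infty$) and solutions $(\psi_n,x_n,\lambda_n)$ of (S) converging pointwise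 to $(\psi^0,x^0,\lambda^0)$ with $\psi_n(\tau'_n)=0$ for every $n$. *)

(* Defs.v *)
From HB Require Import structures.
From mathcomp Require Import all_boot all_order all_algebra.
From mathcomp Require Import all_classical all_reals all_analysis.

Set Implicit Arguments.
Unset Strict Implicit.
Unset Printing Implicit Defensive.

Import Order.TTheory GRing.Theory Num.Theory.
Import numFieldTopology.Exports numFieldNormedType.Exports.

Local Open Scope classical_set_scope.
Local Open Scope ring_scope.

(* The time set is [0, +oo).  Functions of time are total functions on [R] of
   which only the values at [t >= 0] are ever used (values at [t < 0] can only
   influence the two-sided derivative at the single point 0, which is
   negligible).  States are column vectors ['cV[R]_m], shadow prices are row
   vectors ['rV[R]_m], controls live in ['rV[R]_k].

   The norm [`|_|] on matrices is the library's sup norm.  It is used only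
   where the choice of the norm is immaterial (bounds and Lipschitz conditions
   with an existentially quantified constant, absolute continuity,
   boundedness); the Euclidean norm [enorm] is used for the normalisation of
   multipliers. *)

(* Measurability and integrability "in the sense of Lebesgue" refer to the
   completed measure: t |-> g t (x t) (u t) need not be Borel when g is
   continuous in (x, u) only for almost every t. *)
Notation leb := completed_lebesgue_measure.

Definition enorm (R : realType) (n : nat) (v : 'rV[R]_n) : R :=
  Num.sqrt (\sum_i v 0 i ^+ 2).

Definition borel_on_time (R : realType) (V : ptopologicalType) (h : R -> V) :=
  @measurable_fun _ _ (measurableTypeR R) (g_sigma_algebraType (@open V))
    `[0, +oo[ h.

Definition locally_integrable_time (R : realType) (h : R -> R) :=
  forall T : R, 0 <= T -> leb.-integrable `[0, T] (fun t => (h t)%:E).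

Definition absolutely_continuous_on (R : realType) (V : normedModType R)
    (a b : R) (h : R -> V) :=
  forall e : R, 0 < e -> exists2 d : R, 0 < d &
    forall (n : nat) (l r : 'I_n -> R),
      (forall i, a <= l i /\ l i <= r i /\ r i <= b) ->
      (forall i j, i != j -> r i <= l j \/ r j <= l i) ->
      \sum_i (r i - l i) < d -> \sum_i `|h (r i) - h (l i)| < e.

(* solution, in the sense of Caratheodory, of y' = F t y on [0, +oo) *)
Definition ode_solution (R : realType) (V : normedModType R)
    (F : R -> V -> V) (y : R -> V) :=
  (forall T : R, 0 <= T -> absolutely_continuous_on 0 T y) /\
  {ae leb, forall t : R, 0 <= t -> is_derive t 1 y (F t (y t))}.

Definition jac (R : realType) (m p : nat) (h : 'cV[R]_m -> 'cV[R]_p)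
    (x : 'cV[R]_m) : 'M[R]_(p, m) :=
  \matrix_(i, j) ('D_(delta_mx j 0) h x) i 0.

Definition grad (R : realType) (m : nat) (h : 'cV[R]_m -> R)
    (x : 'cV[R]_m) : 'rV[R]_m :=
  \row_j 'D_(delta_mx j 0) h x.

Definition caratheodory_fun (R : realType) (m k : nat) (W : normedModType R)
    (a : R -> 'cV[R]_m -> 'rV[R]_k -> W) :=
  (forall x u, borel_on_time (fun t => a t x u)) /\
  {ae leb, forall t : R, 0 <= t ->
    continuous (fun p : 'cV[R]_m * 'rV[R]_k => a t p.1 p.2)}.

Definition locally_lipschitz_bounded (R : realType) (m k : nat)
    (W : normedModType R) (a : R -> 'cV[R]_m -> 'rV[R]_k -> W) :=
  forall K : set ('cV[R]_m * 'rV[R]_k), compact K ->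
  exists L M : R -> R,
    [/\ forall t : R, 0 <= t -> 0 <= L t /\ 0 <= M t,
        locally_integrable_time L, locally_integrable_time M,
        forall (t : R) x y u, 0 <= t -> K (x, u) -> K (y, u) ->
          `|a t x u - a t y u| <= L t * `|x - y|
      & forall (t : R) x u, 0 <= t -> K (x, u) -> `|a t x u| <= M t].

Definition regular_fun (R : realType) (m k : nat) (W : normedModType R)
    (a : R -> 'cV[R]_m -> 'rV[R]_k -> W) :=
  caratheodory_fun a /\ locally_lipschitz_bounded a.

Definition sublinear_growth (R : realType) (m k : nat)
    (f : R -> 'cV[R]_m -> 'rV[R]_k -> 'cV[R]_m) :=
  forall C : set 'rV[R]_k, compact C ->
  exists l : R -> R, locally_integrable_time l /\
    forall (t : R) x u, 0 <= t -> C u -> `|f t x u| <= l t * (1 + `|x|).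

Record regularity (R : realType) (m k : nat)
    (f : R -> 'cV[R]_m -> 'rV[R]_k -> 'cV[R]_m)
    (g : R -> 'cV[R]_m -> 'rV[R]_k -> R) : Prop := Regularity {
  differentiable_dyn : forall (t : R) x u, 0 <= t ->
    differentiable (fun y => f t y u) x;
  differentiable_cost : forall (t : R) x u, 0 <= t ->
    differentiable (fun y => g t y u) x;
  regular_dyn : regular_fun f;
  regular_cost : regular_fun g;
  regular_jac_dyn : regular_fun (fun t x u => jac (fun y => f t y u) x);
  regular_grad_cost : regular_fun (fun t x u => grad (fun y => g t y u) x);
  growth_dyn : sublinear_growth f }.

Definition closed_valued (R : realType) (k : nat) (U : R -> set 'rV[R]_k) :=
  forall t : R, 0 <= t -> closed (U t).

Definition borel_graph (R : realType) (k : nat) (U : R -> set 'rV[R]_k) :=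
  <<s @open (R * 'rV[R]_k)%type >> [set p | 0 <= p.1 /\ U p.1 p.2].

Definition admissible (R : realType) (k : nat) (U : R -> set 'rV[R]_k) :
    set (R -> 'rV[R]_k) :=
  [set u | [/\ borel_on_time u,
               forall T : R, bounded_set (u @` `[0, T])
             & forall t : R, 0 <= t -> U t (u t)]].

(* The trajectory x^u.  Under [regularity], for admissible [u], a solution
   exists and is unique on [0, +oo), so the choice made by [xget] is
   immaterial there. *)
Definition trajectory (R : realType) (m k : nat)
    (f : R -> 'cV[R]_m -> 'rV[R]_k -> 'cV[R]_m) (xi : 'cV[R]_m)
    (u : R -> 'rV[R]_k) : R -> 'cV[R]_m :=
  xget (fun=> 0)
    [set x : R -> 'cV[R]_m | ode_solution (fun t y => f t y (u t)) x /\ x 0 = xi].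

Definition payoff (R : realType) (m k : nat)
    (f : R -> 'cV[R]_m -> 'rV[R]_k -> 'cV[R]_m)
    (g : R -> 'cV[R]_m -> 'rV[R]_k -> R) (xi : 'cV[R]_m)
    (u : R -> 'rV[R]_k) (T : R) : R :=
  \int[leb]_(t in `[0, T]) g t (trajectory f xi u t) (u t).

Definition uniformly_overtaking_optimal (R : realType) (m k : nat)
    (f : R -> 'cV[R]_m -> 'rV[R]_k -> 'cV[R]_m)
    (g : R -> 'cV[R]_m -> 'rV[R]_k -> R) (U : R -> set 'rV[R]_k)
    (xi : 'cV[R]_m) (u0 : R -> 'rV[R]_k) :=
  limf_esup
    (fun T : R => ereal_sup
       [set (payoff f g xi u T - payoff f g xi u0 T)%:E | u in admissible U])
    (pinfty_nbhs R) = 0%E.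

Section multipliers.
Context (R : realType) (m k : nat).
Variables (f : R -> 'cV[R]_m -> 'rV[R]_k -> 'cV[R]_m)
          (g : R -> 'cV[R]_m -> 'rV[R]_k -> R).

Definition hamiltonian (x : 'cV[R]_m) (t : R) (u : 'rV[R]_k) (lam : R)
    (psi : 'rV[R]_m) : R :=
  (psi *m f t x u) 0 0 + lam * g t x u.

Definition hamiltonian_x (x : 'cV[R]_m) (t : R) (u : 'rV[R]_k) (lam : R)
    (psi : 'rV[R]_m) : 'rV[R]_m :=
  grad (fun y => hamiltonian y t u lam psi) x.

Record lagrange_multiplier (U : R -> set 'rV[R]_k) (x0 : R -> 'cV[R]_m)
    (u0 : R -> 'rV[R]_k) (lam : R) (psi : R -> 'rV[R]_m) : Prop :=
  LagrangeMultiplier {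
  multiplier_range : 0 <= lam <= 1;
  multiplier_continuous : {within `[0, +oo[, continuous psi};
  multiplier_nontrivial : ~ (lam = 0 /\ forall t : R, 0 <= t -> psi t = 0);
  multiplier_adjoint :
    ode_solution (fun t p => - hamiltonian_x (x0 t) t (u0 t) lam p) psi;
  multiplier_max : {ae leb, forall t : R, 0 <= t ->
    ereal_sup [set (hamiltonian (x0 t) t p lam (psi t))%:E | p in U t] =
    (hamiltonian (x0 t) t (u0 t) lam (psi t))%:E} }.

Definition normalized_multiplier (U : R -> set 'rV[R]_k)
    (x0 : R -> 'cV[R]_m) (u0 : R -> 'rV[R]_k) (lam : R)
    (psi : R -> 'rV[R]_m) :=
  lagrange_multiplier U x0 u0 lam psi /\
  (lam = 1 \/ (lam = 0 /\ enorm (psi 0) = 1)).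

(* No initial condition is imposed on [x]. *)
Record system_solution (u0 : R -> 'rV[R]_k) (psi : R -> 'rV[R]_m)
    (x : R -> 'cV[R]_m) (lam : R -> R) : Prop := SystemSolution {
  system_nonneg : forall t : R, 0 <= t -> 0 <= lam t;
  system_psi :
    ode_solution (fun t p => - hamiltonian_x (x t) t (u0 t) (lam t) p) psi;
  system_x : ode_solution (fun t y => f t y (u0 t)) x;
  system_lam : ode_solution (fun _ _ => 0) lam }.

Definition vanishing (tau : nat -> R) (x0 : R -> 'cV[R]_m)
    (u0 : R -> 'rV[R]_k) (lam0 : R) (psi0 : R -> 'rV[R]_m) :=
  exists (s : nat -> nat) (psi : nat -> R -> 'rV[R]_m)
         (x : nat -> R -> 'cV[R]_m) (lam : nat -> R -> R),
    [/\ increasing_seq s /\ increasing_seq (tau \o s),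
        tau (s n) @[n --> \oo] --> +oo,
        forall n, system_solution u0 (psi n) (x n) (lam n),
        forall t : R, 0 <= t ->
          [/\ psi n t @[n --> \oo] --> psi0 t,
              x n t @[n --> \oo] --> x0 t
            & lam n t @[n --> \oo] --> lam0]
      & forall n, psi n (tau (s n)) = 0].

End multipliers.

(* Main.v *)
From HB Require Import structures.
Require Import Defs.
From mathcomp Require Import all_boot all_order all_algebra.
From mathcomp Require Import all_classical all_reals all_analysis.
From mathcomp Require Import measurable_realfun ring lra.
Import Order.TTheory GRing.Theory Num.Theory.
Import numFieldTopology.Exports numFieldNormedType.Exports.

Set Implicit Arguments.
Unset Strict Implicit.
Unset Printing Implicit Defensive.

Local Open Scope classical_set_scope.
Local Open Scope ring_scope.

(** Solve the adjoint equation backwards from psi(tau_n) = 0 along a trajectory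
    of u0 starting close to x0(0), and normalize (lambda, psi(0)) to the unit
    sphere.  A limit point of these data as n -> oo, propagated along x0, is a
    vanishing multiplier, except that the maximum condition may fail.

    Suppose it fails at every limit point.  Each limit point then comes with a
    Borel set P of positive measure and a measurable selection v of U such that
    replacing u0 by v on P raises the Hamiltonian by some c > 0, along all nearby
    multipliers too; by compactness finitely many pairs (P, v) serve all large n.
    Fix n and modify u0 on successive needles of tiny measure d.  As long as the
    set A where the control u differs from u0 has small measure, the trajectory
    of u coincides after A with a trajectory of u0 starting close to x0(0), so
    its normalized adjoint variable is close to one of the finitely many limit
    points, and the next needle, cut in the corresponding P \ A, gains
    c d / 4, the error being quadratic in d for the given n.  The gains add up
    to a positive constant that does not depend on n, contradicting the uniform
    overtaking optimality.

    The selection v comes from the compact sets, with projection of positive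
    measure, that Choquet's capacitability theorem finds in the Borel set of the
    pairs (t, p) that increase the Hamiltonian: minimizing the coordinates of p
    one after the other makes such a set the graph of a function. *)

(** * The completed Lebesgue measure *)

(** The order in which the constants are chosen is the crux. The quadratic error of one needle
    carries a constant that grows with the horizon [T], since it involves the adjoint variable and
    the weights on all of [0, T]. A single needle would have to shrink with [T], and its gain with
    it. Hence the total measure of the needles is fixed beforehand, only their number depends on
    [T], and the Hamiltonian gap must survive with constants that do not see [T]. This is possible
    because all needles lie in a fixed [0, N]. After N the two trajectories coincide, and so do the
    two adjoint variables vanishing at [T]; they differ on [0, N] only, where Gronwall's constants
    depend on N alone. The payoff is computed with lambda = 1, whereas compactness needs bounded
    data. The scaling factor max(1, |psi(0)|) between the two may be unbounded in [T], but it is at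
    least 1, so undoing the scaling can only enlarge the gap. *)

Section leb_basics.
Context (R : realType).
Notation mu := (@lebesgue_measure R).
Notation lebT := (caratheodory_type (wlength (@idfun R))^*%mu).
Notation borelT := (measurableTypeR R).

Lemma leb_measurable (A : set R) :
  @measurable _ borelT A -> @measurable _ lebT A.
Proof. by move=> mA; exact: sub_caratheodory. Qed.

Lemma leb_measurable_split (A : set R) : @measurable _ lebT A ->
  exists B N : set R, [/\ @measurable _ borelT B, @measurable _ borelT N,
    mu N = 0%E, B `<=` A & A `<=` B `|` N].
Proof.
move=> mA.
have := congr1 (fun S => S A) (@completed_caratheodory_measurable R).
rewrite g_sigma_completed_algebra_genE => AE.
have [B mB [N [N' [mN' N'0 NN']]] BNA] :
  measurable_realfun.completed_algebra_gen mu A by rewrite AE.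
exists B, N'; split => //; rewrite -BNA; first exact: subsetUl.
exact: setUS.
Qed.

Lemma leb_negligibleE (A : set R) : leb.-negligible A <-> mu.-negligible A.
Proof.
split=> [[B [mB B0 AB]]|[B [mB B0 AB]]]; last first.
  by exists B; split => //; exact: leb_measurable.
have [C [N [mC mN N0 CB BCN]]] := leb_measurable_split mB.
exists (C `|` N); split; [exact: measurableU| |exact: subset_trans AB BCN].
apply/eqP; rewrite -measure_le0.
apply: (@le_trans _ _ (mu C + mu N)%E); first exact: measureU2.
by rewrite [X in (_ + X)%E]N0 adde0 -B0; apply: le_outer_measure.
Qed.

Lemma leb_negligible_cover (N : set R) : leb.-negligible N ->
  exists A : set R, [/\ measurable A, lebesgue_measure A = 0%E & N `<=` A].
Proof. by move=> /leb_negligibleE[A [mA A0 NA]]; exists A; split. Qed.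

(** [A] is arbitrary, so [leb A] is an outer measure here, and Caratheodory's criterion makes [A]
    measurable. [max_violation] applies this to projections, whose measurability is not
    established. *)
Lemma leb_null (A : set R) : leb A = 0%E -> leb.-negligible A.
Proof.
move=> A0; exists A; split => //.
apply: le_caratheodory_measurable => X.
rewrite [X in (X + _)%E](_ : _ = 0%E).
  by rewrite add0e; apply: le_outer_measure; exact: subIsetl.
apply/eqP; rewrite eq_le outer_measure_ge0 andbT -A0.
by apply: le_outer_measure; exact: subIsetr.
Qed.

Lemma leb_measurable_fun d (T : measurableType d) (D : set R) (f : R -> T) :
  @measurable _ borelT D ->
  @measurable_fun _ _ borelT _ D f -> @measurable_fun _ _ lebT _ D f.
Proof. by move=> mD mf _ B mB; apply: leb_measurable; exact: mf. Qed.

Lemma leb_measurable_fun_ae d (T : measurableType d) (D N : set R)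
    (f : R -> T) :
  @measurable _ borelT D -> leb.-negligible N -> @measurable _ borelT N ->
  @measurable_fun _ _ borelT _ (D `\` N) f -> @measurable_fun _ _ lebT _ D f.
Proof.
move=> mD N0 mN mf _ B mB.
rewrite -(setUIDK (D `&` f @^-1` B) N); apply: measurableU.
  apply: completed_lebesgue_measure_is_complete.
  by apply: negligibleS N0; exact: subIsetr.
apply: leb_measurable; rewrite setDE setIAC -setDE.
by apply: mf => //; exact: measurableD.
Qed.

End leb_basics.

Lemma derive_linear_approx (R : realType) (V : normedModType R) (h : R -> V)
    (x : R) (d : V) (e : R) : is_derive x 1 h d -> 0 < e ->
  exists2 r : R, 0 < r & forall y, `|y - x| < r ->
    `|h y - h x - (y - x) *: d| <= e * `|y - x|.
Proof.
move=> [dh <-] e0.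
have : k^-1 *: (h (k *: (1 : R) + x) - h x) @[k --> 0^'] --> 'D_1 h x by exact: dh.
move=> /cvgrPdist_le /(_ _ e0) [r /= r0 hr]; exists r => // y yxr.
have [->|yx] := eqVneq y x; first by rewrite !subrr scale0r subr0 !normr0 mulr0.
have yx0 : y - x != 0 by rewrite subr_eq0.
have := hr (y - x); rewrite /ball_/= sub0r normrN => /(_ yxr yx0).
rewrite [_ *: 1]mulr1 subrK distrC => H.
rewrite -(ler_pM2l (_ : 0 < `|y - x|^-1)) ?invr_gt0 ?normr_gt0//.
rewrite -normfV -normrZ scalerBr scalerA mulVf// scale1r.
by rewrite normfV mulrCA mulVf ?normr_eq0// mulr1.
Qed.

(** * Monotonicity of absolutely continuous functions *)

Section monotone.
Context (R : realType).
Notation mu := (@lebesgue_measure R).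
Variables (h : R -> R) (a b : R).
Hypothesis ab : a <= b.
Hypothesis hAC : absolutely_continuous_on a b h.

(** Bounds the increment of [h] over [a, x] after cutting it into intervals of two kinds: those with
    slope at most [e], and those inside [U]. Only the latter are recorded in [s], rightmost
    first. *)
Let chain (U : set R) (e x : R) (s : seq (R * R)) :=
  [/\ all (fun p => [&& a <= p.1, p.1 <= p.2 & p.2 <= x]) s,
      pairwise (fun p q => q.2 <= p.1) s,
      ((\sum_(p <- s) (p.2 - p.1))%:E <= mu (U `&` `]a, x]))%E
    & h x - h a <= e * (x - a) + \sum_(p <- s) (h p.2 - h p.1)].

Let chain_step (U : set R) (e u v : R) s : 0 < e -> measurable U -> a <= u -> u <= v ->
  (h v - h u <= e * (v - u) \/ `[u, v] `<=` U) -> chain U e u s ->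
  exists s', chain U e v s'.
Proof.
move=> e0 mU au uv [huv|uvU] [sb sp sm sh].
  exists s; split => //.
  - apply: sub_all sb => p /and3P[-> -> pu] /=; exact: le_trans pu uv.
  - apply: (le_trans sm); apply: le_measure; rewrite ?inE; [exact: measurableI..|].
    by apply: setIS; apply: subset_itvl; rewrite bnd_simp.
  - have -> : h v - h a = (h v - h u) + (h u - h a) by ring.
    apply: le_trans (lerD huv sh) _.
    by rewrite le_eqVlt; apply/orP; left; apply/eqP; ring.
exists ((u, v) :: s); split => /=.
- rewrite au uv lexx/=.
  apply: sub_all sb => p /and3P[-> -> pu] /=; exact: le_trans pu uv.
- rewrite sp andbT; apply/allP => p ps.
  by move/allP : sb => /(_ _ ps) /and3P[].
- rewrite big_cons /= EFinD.
  apply: (@le_trans _ _ (mu (`]u, v] `|` (U `&` `]a, u]))%classic)%E).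
    rewrite measureU//=; last 2 first.
    + exact: measurableI.
    + apply/seteqP; split => // t /= [] /[!in_itv]/= /andP[ut _] [_ /andP[_]].
      by rewrite leNgt ut.
    rewrite leeD// lebesgue_measure_itv/= lte_fin.
    move: uv; rewrite le_eqVlt => /predU1P[->|->]; last by rewrite EFinB.
    by rewrite ltxx subrr.
  apply: le_measure; rewrite ?inE//; first by apply: measurableU => //; exact: measurableI.
  - exact: measurableI.
  - move=> t /= [|[Ut]] /[!in_itv]/= /andP[t1 t2]; split => //.
    + by apply: uvU; rewrite /= in_itv/= (ltW t1).
    + by rewrite (le_lt_trans au t1).
    + by rewrite t1 (le_trans t2).
- rewrite big_cons/=.
  have -> : h v - h a = (h v - h u) + (h u - h a) by ring.
  rewrite (addrCA (e * _)) lerD2l; apply: le_trans sh _.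
  by rewrite lerD2r; apply: ler_wpM2l; [exact: ltW|lra].
Qed.

(** The comparisons of solutions ([acd_le] and its consequences) rest on this. The null set where
    the derivative is not controlled is covered by an open [U] so small that absolute continuity
    bounds the total increment over the recorded intervals by [e]. *)
Lemma ac_monotone (dh : R -> R) :
  {ae leb, forall t, a <= t <= b -> is_derive t 1 h (dh t) /\ dh t <= 0} ->
  h b <= h a.
Proof.
move=> /leb_negligible_cover[A [mA A0 hA]].
suff H (e : R) : 0 < e -> h b - h a <= e * (b - a) + e.
  rewrite -subr_le0; apply/ler_addgt0Pl => e e0.
  have e1 : 0 < e / (b - a + 1) by rewrite divr_gt0// ltr_wpDl// subr_ge0.
  apply: (le_trans (H _ e1)); rewrite addr0 -{2}(mulr1 (e / _)) -mulrDr.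
  by rewrite divfK// gt_eqF// ltr_wpDl// subr_ge0.
move=> e0; have [d d0 hd] := hAC e0.
have [|U [oU AU Ud]] := lebesgue_regularity_outer mA _ d0.
  by rewrite [X in (X < _)%E](_ : _ = 0%E) ?ltry//; exact: A0.
have mU : measurable U by exact: measurable_realfun.open_measurable.
have {Ud}muU : (mu U < d%:E)%E.
  rewrite (_ : U = A `|` (U `\` A)); last by rewrite setDUK.
  rewrite measureU//; [|exact: measurableD|by rewrite setDIK].
  by rewrite [X in (X + _)%E](_ : _ = 0%E) ?add0e//; exact: A0.
(* One endpoint is [x] itself: below, the interval either arrives at the supremum [c] from the left
   or leaves it to the right. *)
have loc x : a <= x <= b -> exists2 r : R, 0 < r & forall u v,
    a <= u -> u <= x -> x <= v -> v <= b -> x - r < u -> v < x + r ->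
    u = x \/ v = x ->
    h v - h u <= e * (v - u) \/ `[u, v] `<=` U.
  move=> xab; have [Ax|nAx] := pselect (A x).
    have : nbhs x U by apply: open_nbhs_nbhs; split => //; exact: AU.
    move=> /nbhs_ballP[r /= r0 rU]; exists r => // u v _ ux xv _ xru vxr _; right.
    move=> t /=; rewrite in_itv/= => /andP[ut tv]; apply: rU.
    by rewrite /ball/= ltr_distl; apply/andP; split; lra.
  have [dhx dh0] : is_derive x 1 h (dh x) /\ dh x <= 0.
    apply: contrapT => nh; apply: nAx; apply: hA => /= /(_ xab); exact: nh.
  have [r r0 hr] := derive_linear_approx dhx e0; exists r => //.
  move=> u v au ux xv vb xru vxr [ux'|vx']; left.
    subst u; have := hr v; rewrite ger0_norm ?subr_ge0//.
    have -> : v - x < r by lra.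
    rewrite (_ : _ *: _ = (v - x) * dh x)// => /(_ isT) /ler_normlW H.
    have : (v - x) * dh x <= 0 by rewrite mulr_ge0_le0// subr_ge0.
    by lra.
  subst v; have := hr u; rewrite (distrC u) ger0_norm ?subr_ge0//.
  have -> : x - u < r by lra.
  rewrite (_ : _ *: _ = (u - x) * dh x)// => /(_ isT).
  rewrite ler_norml => /andP[H _].
  have : 0 <= (u - x) * dh x by rewrite mulr_le0// subr_le0.
  by lra.
(* Continuous induction: the supremum of the points reached by a chain is itself reached, and a
   chain reaching [c < b] can be prolonged. *)
pose S := [set x | a <= x <= b /\ exists s, chain U e x s].
have Sa : S a.
  split; first by rewrite lexx.
  by exists [::]; split => //; rewrite ?big_nil ?subrr ?mulr0 ?addr0.
have supS : has_sup S by split; [exists a|exists b => x [/andP[]]].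
pose c := sup S.
have ac : a <= c by apply: ub_le_sup => //; case: supS.
have cb : c <= b by apply: ge_sup; [exists a|move=> x [/andP[]]].
have [|r r0 hr] := loc c; first by rewrite ac.
have [_ [s hs]] : S c.
  have [x [/andP[ax xb] [s hs]] cx] := sup_adherent r0 supS.
  have xc : x <= c by apply: ub_le_sup; [case: supS|split; [rewrite ax|exists s]].
  split; first by rewrite ac.
  apply: chain_step hs => //; apply: hr => //; last by right.
  by rewrite ltrDl.
have cE : c = b.
  apply/eqP; rewrite eq_le cb/= leNgt; apply/negP => cltb.
  pose v := Num.min b (c + r / 2).
  have cv : c < v by rewrite lt_min cltb ltrDl divr_gt0.
  have vb : v <= b by rewrite ge_min lexx.
  have vcr : v < c + r by rewrite gt_min ltrD2l ltr_pdivrMr// ltr_pMr// ltr1n orbT.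
  have : S v.
    split; first by rewrite vb (le_trans ac (ltW cv)).
    apply: chain_step hs => //; first exact: ltW.
    by apply: hr => //; [exact: ltW|rewrite ltrBlDr ltrDl|left].
  by move=> /(ub_le_sup supS.2); rewrite leNgt cv.
move: hs; rewrite cE => -[sb sp sm sh]; apply: (le_trans sh); rewrite lerD2l.
rewrite ltW//.
apply: (@le_lt_trans _ _ (\sum_(i < size s)
  `|h (nth (0, 0) s i).2 - h (nth (0, 0) s i).1|)).
  by rewrite (big_nth (0, 0)) big_mkord; apply: ler_sum => i _; exact: ler_norm.
apply: (hd _ (fun i => (nth (0, 0) s i).1) (fun i => (nth (0, 0) s i).2)).
- by move=> i; move/(all_nthP (0, 0)) : sb => /(_ i (ltn_ord i)) /and3P[].
- move=> i j ij; have /(pairwiseP (0, 0)) H := sp.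
  have := ltn_ord i; have := ltn_ord j => jn in_.
  have [ij'|ji'|/val_inj ij'] := ltngtP i j; last by rewrite ij' eqxx in ij.
  + by right; apply: (H i j).
  + by left; apply: (H j i).
- have := le_lt_trans (le_trans sm _) muU; rewrite lte_fin.
  rewrite (big_nth (0, 0)) big_mkord; apply.
  by apply: le_measure; rewrite ?inE//; exact: measurableI.
Qed.

End monotone.

Instance ae_leb_filter (R : realType) :
  Filter (almost_everywhere (@completed_lebesgue_measure R)).
Proof. exact: ae_filter_ringOfSetsType. Qed.

#[global] Hint Extern 0 (Filter (nbhs (almost_everywhere leb))) =>
  (apply: ae_leb_filter) : typeclass_instances.

Lemma integrable_support d (T : measurableType d) (R : realType)
    (mu : {measure set T -> \bar R}) (D E : set T) (f : T -> \bar R) :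
  measurable D -> measurable E -> (forall x, E x -> ~ D x -> f x = 0%E) ->
  mu.-integrable D f -> mu.-integrable E f.
Proof.
move=> mD mE f0 /(integrable_mkcond _ mD) fT.
have : mu.-integrable E (f \_ D) by apply: integrableS fT.
apply: eq_integrable => // x; rewrite inE => Ex.
by rewrite patchE; case: ifPn => //; rewrite notin_setE => /(f0 _ Ex) ->.
Qed.

Lemma ae_eq_integrable d (T : measurableType d) (R : realType)
    (mu : {measure set T -> \bar R}) (D : set T) (f g : T -> R) :
  measurable D -> mu.-integrable D (EFin \o f) -> measurable_fun D g ->
  {ae mu, forall x, D x -> f x = g x} ->
  mu.-integrable D (EFin \o g) /\
  \int[mu]_(x in D) f x = \int[mu]_(x in D) g x.
Proof.
move=> mD /integrableP[mf fi] mg fg.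
have mg' : measurable_fun D (EFin \o g) by exact/measurable_EFinP.
split; last first.
  by congr fine; apply: ae_eq_integral => //; apply: filterS fg => x /= /[apply] ->.
apply/integrableP; split => //; move: fi; congr (_ < _)%E.
apply: ge0_ae_eq_integral => //; [exact: measurableT_comp..|].
by apply: filterS fg => x /= /[apply] ->.
Qed.

Section borel_version.
Context (R : realType).
Notation mu := (@lebesgue_measure R).
Notation lebT := (caratheodory_type (wlength (@idfun R))^*%mu).
Notation borelT := (measurableTypeR R).

(** Superlevel sets at rational levels are Borel up to null Borel sets; [N] is the union of these
    countably many null sets. *)
Lemma leb_borel_version (k : R -> R) : @measurable_fun _ _ lebT R setT k ->
  exists N : set R, [/\ measurable N, lebesgue_measure N = 0%E &
    measurable_fun setT (k \_ (~` N))].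
Proof.
move=> mk.
have mE (q : rat) : @measurable _ lebT (k @^-1` `]ratr q, +oo[).
  by rewrite -[X in measurable X]setTI; apply: mk => //; exact: measurable_itv.
pose B q := sval (cid (leb_measurable_split (mE q))).
have HB q := svalP (cid (leb_measurable_split (mE q))).
pose M q := sval (cid (HB q)).
have HM q : [/\ measurable (B q : set R), measurable (M q : set R), mu (M q) = 0%E,
  B q `<=` k @^-1` `]ratr q, +oo[ & k @^-1` `]ratr q, +oo[ `<=` B q `|` M q] :=
  svalP (cid (HB q)).
have mN : measurable (\bigcup_q M q : set R).
  by apply: bigcupT_measurable_rat => q; have [] := HM q.
exists (\bigcup_q M q); split => //.
- apply/eqP; rewrite -measure_le0.
  pose f n : rat := odflt 0 (unpickle n).
  apply: (@le_trans _ _ (mu (\bigcup_n M (f n)))).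
    apply: le_outer_measure => t [q _ Mt]; exists (pickle q) => //.
    by rewrite /f pickleK.
  apply: (le_trans (outer_measure_sigma_subadditive _ _)).
  by rewrite eseries0// => n _ _; have [] := HM (f n).
- set N := \bigcup_q M q.
  apply: (measurability _ (RGenOInfty.measurableE R)) => //.
  move=> _ [_ [x ->] <-]; rewrite setTI.
  (* On [N] the modified function is 0, which exceeds [x] exactly when some rational [q] satisfies
     [x < q < 0]; wherever it is negative but above [x], a rational in between lies in some
     [B q]. *)
  rewrite (_ : _ @^-1` _ = \bigcup_q (if x < ratr q then
     ((B q `\` N) `|` (if (ratr q < 0 :> R) then N else set0)) else set0)).
    apply: bigcupT_measurable_rat => q; case: ifP => // _.
    apply: measurableU; last by case: ifP.
    by apply: measurableD => //; have [] := HM q.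
  apply/seteqP; split=> [t|t [q _]] /=.
    rewrite in_itv/= andbT => /rat_in_itvoo[q]; rewrite in_itv/= => /andP[xq qk].
    exists q => //; rewrite xq; move: qk; rewrite patchE.
    have [Nt|Nt] := pselect (N t).
      by rewrite memNset; [move=> ->; right|apply].
    rewrite mem_set// => qk; left; split => //.
    have [_ _ _ _ /(_ t)] := HM q; rewrite /= in_itv/= qk => /(_ isT)[//|Mt].
    by exfalso; apply: Nt; exists q.
  rewrite in_itv/= andbT; case: ifP => // xq [[Bt nNt]|].
    rewrite patchE mem_set//; apply: (lt_trans xq).
    by have [_ _ _ /(_ t Bt)] := HM q; rewrite /= in_itv/= andbT.
  case: ifP => // q0 Nt; rewrite patchE memNset; first exact: lt_trans q0.
  by apply.
Qed.

(** The Borel measure is the image of the completed one under the identity map, so this is a change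
    of variables. *)
Lemma leb_mu_integrable (D : set R) (f : R -> R) : measurable D ->
  measurable_fun setT f -> leb.-integrable D (EFin \o f) ->
  mu.-integrable D (EFin \o f) /\
  (\int[mu]_(x in D) (f x) = \int[leb]_(x in D) (f x))%R.
Proof.
move=> mD mf fi.
have mid : @measurable_fun _ _ lebT borelT setT id.
  exact/leb_measurable_fun/measurable_id.
have mf' : measurable_fun setT (EFin \o f) by exact/measurable_EFinP.
have H1 := @integrable_pushforward _ _ lebT borelT R id mid leb D (EFin \o f) mf' fi mD.
have H2 := @integral_pushforward _ _ lebT borelT R id mid leb D (EFin \o f) mf' fi mD.
by split; [exact: H1|congr fine; exact: H2].
Qed.

Lemma leb_measurable_fun_itv (k : R -> R) : locally_integrable_time k ->
  @measurable_fun _ _ lebT R `[0, +oo[%classic k.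
Proof.
move=> ki.
rewrite (_ : `[0, +oo[%classic = \bigcup_n `[0, n%:R]%classic :> set R).
  apply/(measurable_fun_bigcup _ _).2 => n.
    by apply: leb_measurable; exact: measurable_itv.
  have /integrableP[/measurable_EFinP mk _] := ki n%:R (ler0n _ _).
  exact: mk.
apply/seteqP; split => [t|t [n _]] /=; rewrite !in_itv/= ?andbT; last by case/andP.
by move=> t0; exists (Num.trunc t).+1 => //=; rewrite in_itv/= t0 ltW// truncnS_gt.
Qed.

Lemma locally_integrable_borel (k : R -> R) : locally_integrable_time k ->
  exists k' : R -> R, [/\ measurable_fun setT k',
    forall t : R, t < 0 -> k' t = 0,
    {ae leb, forall t, 0 <= t -> k' t = k t},
    forall T : R, 0 <= T -> mu.-integrable `[0, T] (EFin \o k') &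
    forall T : R, 0 <= T ->
      (\int[leb]_(t in `[0, T]) k t = \int[mu]_(t in `[0, T]) k' t)%R].
Proof.
move=> ki; have mk := leb_measurable_fun_itv ki.
have mI : @measurable _ lebT (`[0%R, +oo[%classic : set R).
  by apply: leb_measurable; exact: measurable_itv.
have [N [mN N0 mk']] := leb_borel_version ((measurable_restrictT _ mI).1 mk).
pose k' := (k \_ `[0, +oo[) \_ (~` N).
have kk' t : 0 <= t -> ~ N t -> k' t = k t.
  move=> t0 Nt; rewrite /k' patchE mem_set// patchE mem_set//.
  by rewrite /= in_itv/= t0.
have lN : leb.-negligible N by apply/leb_negligibleE; exists N; split.
have aek : {ae leb, forall t, 0 <= t -> k' t = k t}.
  apply: negligibleS lN => t /= /not_implyP[t0 nk]; apply: contrapT => Nt.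
  by apply: nk; exact: kk'.
have mI0 (T : R) : @measurable _ lebT (`[0%R, T]%classic : set R).
  by apply: leb_measurable; exact: measurable_itv.
have lk'T (T : R) : @measurable_fun _ _ lebT _ `[0, T]%classic k'.
  apply: leb_measurable_fun; first exact: measurable_itv.
  exact: measurable_funTS.
have aeT (T : R) : {ae leb, forall t, `[0, T]%classic t -> k t = k' t}.
  apply: filterS aek => t /= + /[!in_itv]/= /andP[t0 _].
  by move=> /(_ t0) ->.
have ki' (T : R) (T0 : 0 <= T) := @ae_eq_integrable _ lebT R leb _ k k' (mI0 T)
  (ki _ T0) (lk'T T) (aeT T).
have ki2 (T : R) (T0 : 0 <= T) := @leb_mu_integrable _ k' (measurable_itv _) mk' (ki' _ T0).1.
exists k'; split => //.
- by move=> t t0; rewrite /k' !patchE; case: ifP => // _; rewrite memNset//= in_itv/= leNgt t0.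
- by move=> T T0; have [] := ki2 T T0.
- by move=> T T0; rewrite (ki2 T T0).2; exact: (ki' _ T0).2.
Qed.

End borel_version.

(** [ode_solution] with a right-hand side that ignores the state. Trajectories and adjoint variables
    are convertible to [acd] with the right-hand side evaluated along them, so one calculus serves
    both. *)
Definition acd (R : realType) (V : normedModType R) (y dy : R -> V) :=
  ode_solution (fun t _ => dy t) y.

(** * Primitives of locally integrable functions *)

Section primitive.
Context (R : realType).
Notation mu := (@lebesgue_measure R).

Definition prim (k : R -> R) (t : R) : R := \int[leb]_(s in `[0, t]) k s.

Let primB (k : R -> R) (l r : R) :
  (forall T : R, 0 <= T -> mu.-integrable `[0, T] (EFin \o k)) ->
  0 <= l -> l <= r ->
  \int[mu]_(s in `[0, r]) k s - \int[mu]_(s in `[0, l]) k s =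
  \int[mu]_(s in `]l, r]) k s.
Proof.
move=> ki l0 lr; rewrite Rintegral_itvB ?bnd_simp//.
by apply: ki; exact: le_trans lr.
Qed.

Let prim_ac (k : R -> R) (T : R) : 0 <= T ->
  (forall T : R, 0 <= T -> mu.-integrable `[0, T] (EFin \o k)) ->
  absolutely_continuous_on 0 T (fun t => \int[mu]_(s in `[0, t]) k s).
Proof.
move=> T0 ki e e0; pose f := k \_ `[0, T].
have fi : mu.-integrable setT (EFin \o f).
  rewrite /f -restrict_EFin; apply/integrable_restrict => //=.
  by rewrite setTI; exact: ki.
have [d [d0 hd]] := integral_normr_continuous fi e0; exists d => // n l r lr dis lrd.
pose D i := (`]l i, r i])%classic : set R.
have mD i : measurable (D i) by exact: measurable_itv.
have tD : trivIset [set` index_enum 'I_n] D.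
  apply/trivIsetP => i j _ _ ij; rewrite /D.
  apply/seteqP; split => // t []/=; rewrite !in_itv/= => /andP[it ti] /andP[jt tj].
  have [rl|rl] := dis i j ij.
    by have := le_lt_trans (le_trans ti rl) jt; rewrite ltxx.
  by have := le_lt_trans (le_trans tj rl) it; rewrite ltxx.
have muD i : mu (D i) = (r i - l i)%:E.
  rewrite /D lebesgue_measure_itv/= lte_fin; have [_ [+ _]] := lr i.
  by rewrite le_eqVlt => /predU1P[->|->]; rewrite ?ltxx ?subrr// EFinB.
have mU : measurable (\big[setU/set0]_(i < n) D i).
  by apply: bigsetU_measurable => i _.
have muU : (mu (\big[setU/set0]_(i < n) D i) < d%:E)%E.
  rewrite [X in (X < _)%E](_ : _ = (\sum_i (r i - l i))%:E) ?lte_fin//.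
  transitivity (\sum_i mu (D i))%E.
    apply: (@measure_bigsetU_ord _ _ _ (@lebesgue_measure R) _ predT) => //.
    by apply: sub_trivIset tD => i _ /=; exact: mem_index_enum.
  by rewrite -sumEFin; apply: eq_bigr => i _; exact: muD.
apply: le_lt_trans (hd _ mU muU).
rewrite /Rintegral.
rewrite ge0_integral_bigsetU//=; last 2 first.
- by rewrite index_enum_uniq.
- have /integrableP[mf _] := fi; apply: measurable_funTS.
  by apply/measurable_EFinP; apply: measurableT_comp => //; exact/measurable_EFinP.
rewrite -sum_fine => [|i _]; last first.
  apply: integrable_fin_num; first exact: mD.
  have fi' := integrable_norm fi.
  by apply: (integrableS _ _ _ fi'); [exact: measurableT|exact: mD|exact: subsetT].
apply: ler_sum => i _; have [l0 [lri rT]] := lr i.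
rewrite primB//; apply: le_trans (le_normr_Rintegral _ _) _ => //.
  apply: (integrableS _ _ _ (ki T T0)); [exact: measurable_itv..|].
  by apply: subset_itvScc; rewrite bnd_simp.
rewrite le_eqVlt; apply/orP; left; apply/eqP; congr fine.
apply: eq_integral => t; rewrite inE /D/= in_itv/= => /andP[lt tr].
rewrite /f patchE mem_set//= in_itv/=.
by rewrite (le_trans l0 (ltW lt)) (le_trans tr rT).
Qed.

Lemma prim0 (k : R -> R) : locally_integrable_time k -> prim k 0 = 0.
Proof.
move=> /locally_integrable_borel[k' [_ _ _ _ kE]].
by rewrite /prim kE// set_itv1 Rintegral_set1.
Qed.

Lemma acd_prim (k : R -> R) : locally_integrable_time k -> acd (prim k) k.
Proof.
move=> /locally_integrable_borel[k' [mk k'0 kk ki kE]].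
have primE t : 0 <= t -> prim k t = \int[mu]_(s in `[0, t]) k' s by exact: kE.
split=> [T T0|].
  move=> e e0; have [d d0 hd] := prim_ac T0 ki e0; exists d => // n l r lr dis lrd.
  have := hd n l r lr dis lrd; congr (_ < _); apply: eq_bigr => i _.
  by have [l0 [lri _]] := lr i; rewrite !primE//; exact: le_trans lri.
have kNy (y : R) : mu.-integrable `]-oo, y] (EFin \o k').
  have ky : mu.-integrable `[0, Num.max 0 y] (EFin \o k').
    by apply: ki; rewrite le_max lexx.
  have := integrable_support _ _ _ ky; apply; [exact: measurable_itv..|].
  move=> t; rewrite /= !in_itv/= => ty /negP.
  by rewrite negb_and le_max ty orbT orbF -ltNge => /k'0 ->.
have lk : locally_integrable [set: R] k'.
  split => // [|K _ cK]; first exact: openT.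
  have [M [_ HM]] := compact_bounded cK.
  have KM : K `<=` `]-oo, M + 1].
    move=> t Kt; rewrite /= in_itv/=; apply: le_trans (ler_norm _) _.
    by apply: (HM (M + 1) _ t Kt); rewrite ltrDl.
  have /integrableP[mk1 +] := kNy (M + 1); apply: le_lt_trans.
  apply: ge0_subset_integral => //; first exact: compact_measurable.
  apply/measurable_EFinP; apply: measurableT_comp => //.
  exact/measurable_EFinP.
(* At [t = 0] a two-sided derivative involves negative times, about which [primE] says nothing. *)
have ae0 : {ae leb, forall t : R, t != 0}.
  apply/leb_negligibleE; exists [set 0 : R]; split => //; first exact: lebesgue_measure_set1.
  by move=> t /= /negP; rewrite negbK => /eqP.
have := FTC1Ny kNy lk.
move=> /leb_negligibleE; apply: filterS3 kk ae0 => t kt t0 [Fd Fk] /[dup] t0' /kt <-.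
have {t0 t0'}t0 : 0 < t by rewrite lt_neqAle eq_sym t0.
rewrite -Fk derive1E; move/derivableP : Fd; apply: near_eq_is_derive.
near=> s; have s0 : 0 <= s by near: s; exact: lt_le_nbhsr.
rewrite primE// Rintegral_mkcond [in RHS]Rintegral_mkcond.
apply: eq_Rintegral => u _; rewrite !patchE.
have [u0|u0] := ltP u 0.
  by rewrite k'0//; case: ifP; case: ifP.
congr (if _ then _ else _).
by apply/idP/idP; rewrite !inE/= !in_itv/= u0.
Unshelve. all: by end_near.
Qed.

End primitive.

(** * Absolutely continuous functions *)

Lemma ae_leb_forall (R : realType) (I : finType) (P : R -> I -> Prop) :
  (forall i, {ae leb, forall t : R, P t i}) -> {ae leb, forall t : R, forall i, P t i}.
Proof.
move=> H.
exact: (@filter_forall _ I (fun i t => P t i)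
  (almost_everywhere (@completed_lebesgue_measure R)) _ H).
Qed.

Section ac_closure.
Context (R : realType).
Implicit Types (V W : normedModType R) (a b : R).

(** Sums, products, exponentials and matrix entries all inherit absolute continuity through this one
    comparison of increments; unary operations use it with [y = z]. *)
Lemma ac_dominated V1 V2 W (y : R -> V1) (z : R -> V2) (h : R -> W) a b (C : R) :
  0 <= C -> absolutely_continuous_on a b y -> absolutely_continuous_on a b z ->
  (forall l r, a <= l -> l <= r -> r <= b ->
     `|h r - h l| <= C * (`|y r - y l| + `|z r - z l|)) ->
  absolutely_continuous_on a b h.
Proof.
move=> C0 yac zac hyz e e0.
have C1 : 0 < C + 1 by rewrite ltr_wpDl.
have e1 : 0 < e / (C + 1) / 2 by rewrite !divr_gt0.
have [d1 d10 H1] := yac _ e1; have [d2 d20 H2] := zac _ e1.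
exists (Num.min d1 d2); first by rewrite lt_min d10 d20.
move=> n l r lr dis; rewrite lt_min => /andP[s1 s2].
have Y := H1 n l r lr dis s1; have Z := H2 n l r lr dis s2.
apply: (@le_lt_trans _ _ (\sum_(i < n)
    (C * (`|y (r i) - y (l i)| + `|z (r i) - z (l i)|)))).
  by apply: ler_sum => i _; have [? [? ?]] := lr i; exact: hyz.
rewrite -mulr_sumr big_split/=.
have YZ : \sum_(i < n) `|y (r i) - y (l i)| + \sum_(i < n) `|z (r i) - z (l i)| < e / (C + 1).
  by rewrite [ltRHS]splitr ltrD.
apply: (@le_lt_trans _ _ (C * (e / (C + 1)))).
  by apply: ler_wpM2l => //; exact: ltW.
by rewrite mulrA ltr_pdivrMr// mulrC ltr_pM2l// ltrDl.
Qed.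

Lemma ac_uniform V (y : R -> V) a b e : absolutely_continuous_on a b y -> 0 < e ->
  exists2 d, 0 < d & forall s t, a <= s <= b -> a <= t <= b -> `|s - t| < d ->
    `|y s - y t| < e.
Proof.
move=> yac e0; have [d d0 H] := yac e e0; exists d => // s t.
wlog st : s t / t <= s.
  move=> W; have [|/ltW] := leP t s; first exact: W.
  by move=> /W H' ? ?; rewrite distrC => ?; rewrite distrC; exact: H'.
move=> /andP[as_ sb] /andP[at_ tb]; rewrite ger0_norm ?subr_ge0// => std.
have := H 1%N (fun=> t) (fun=> s); rewrite !big_ord1; apply => //.
by move=> i j; rewrite !ord1 eqxx.
Qed.

Lemma ac_within_continuous V (y : R -> V) a b :
  absolutely_continuous_on a b y -> {within `[a, b], continuous y}.
Proof.
move=> yac; apply/subspace_continuousP => t /=; rewrite in_itv/= => tab.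
apply/cvgrPdist_lt => e e0; have [d d0 H] := ac_uniform yac e0.
rewrite near_withinE; near=> s => /=; rewrite in_itv/= => sab.
apply: H => //; near: s; exact: nbhsx_ballx.
Unshelve. all: by end_near. Qed.

Lemma ac_bounded V (y : R -> V) a b : absolutely_continuous_on a b y ->
  exists2 B, 0 <= B & forall t, a <= t <= b -> `|y t| <= B.
Proof.
move=> /ac_within_continuous cy.
have := continuous_compact cy (@segment_compact _ a b).
move=> /compact_bounded[M [_ HM]]; exists (Num.max 0 (M + 1)).
  by rewrite le_max lexx.
move=> t tab; apply: (HM (Num.max 0 (M + 1))); first by rewrite lt_max ltrDl ltr01 orbT.
by exists t => //=; rewrite in_itv.
Qed.

End ac_closure.

Section acd_theory.
Context (R : realType).
Implicit Types (V W : normedModType R).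

Lemma acd_ext V (y z dy dz : R -> V) : (forall t, 0 <= t -> y t = z t) ->
  {ae leb, forall t : R, 0 <= t -> dy t = dz t} -> acd y dy -> acd z dz.
Proof.
move=> yz dyz [yac yd]; split=> [T T0|].
  apply: ac_dominated (ler01) (yac T T0) (yac T T0) _ => l r l0 lr rT.
  by rewrite mul1r !yz ?lerDl//; exact: le_trans lr.
have ae0 : {ae leb, forall t : R, t != 0}.
  apply/leb_negligibleE; exists [set 0 : R]; split => //; first exact: lebesgue_measure_set1.
  by move=> t /= /negP; rewrite negbK => /eqP.
apply: filterS3 ae0 dyz yd => t t0 dyzt ydt t00; rewrite -dyzt//.
have {t0}t0 : 0 < t by rewrite lt_neqAle eq_sym t0.
have := ydt t00; apply: near_eq_is_derive.
by near=> s; rewrite yz//; near: s; exact: lt_le_nbhsr.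
Unshelve. all: by end_near. Qed.

Lemma acd_cst V (c : V) : acd (fun=> c) (fun=> 0).
Proof.
split=> [T T0 e e0|].
  by exists 1 => // n l r _ _ _; rewrite big1// => i _; rewrite subrr normr0.
by apply: aeW => t _; exact: is_derive_cst.
Qed.

Lemma acdD V (y z dy dz : R -> V) : acd y dy -> acd z dz ->
  acd (fun t => y t + z t) (fun t => dy t + dz t).
Proof.
move=> [yac yd] [zac zd]; split=> [T T0|].
  apply: ac_dominated ler01 (yac T T0) (zac T T0) _ => l r l0 lr rT.
  by rewrite mul1r opprD addrACA ler_normD.
apply: filterS2 yd zd => t yt zt t0.
by apply: (is_deriveD (yt t0) (zt t0)).
Qed.

Lemma acdZ V (c : R) (y dy : R -> V) : acd y dy ->
  acd (fun t => c *: y t) (fun t => c *: dy t).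
Proof.
move=> [yac yd]; split=> [T T0|].
  apply: ac_dominated (normr_ge0 c) (yac T T0) (yac T T0) _ => l r l0 lr rT.
  by rewrite -scalerBr normrZ; apply: ler_wpM2l => //; rewrite lerDl.
apply: filterS yd => t yt t0.
by apply: (is_deriveZ c (yt t0)).
Qed.

Lemma acdN V (y dy : R -> V) : acd y dy -> acd (fun t => - y t) (fun t => - dy t).
Proof.
move=> /(acdZ (-1)); apply: acd_ext => [t _|]; first by rewrite scaleN1r.
by apply: aeW => t _; rewrite scaleN1r.
Qed.

Lemma acdB V (y z dy dz : R -> V) : acd y dy -> acd z dz ->
  acd (fun t => y t - z t) (fun t => dy t - dz t).
Proof. by move=> ya /acdN; exact: acdD. Qed.

Lemma acd_sum V (I : Type) (s : seq I) (y dy : I -> R -> V) :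
  (forall i, acd (y i) (dy i)) ->
  acd (fun t => \sum_(i <- s) y i t) (fun t => \sum_(i <- s) dy i t).
Proof.
move=> ya; elim: s => [|i s ih].
  under eq_fun do rewrite big_nil.
  under [X in acd _ X]eq_fun do rewrite big_nil.
  exact: acd_cst.
under eq_fun do rewrite big_cons.
under [X in acd _ X]eq_fun do rewrite big_cons.
exact: acdD.
Qed.

Lemma acd_bounded V (y dy : R -> V) (T : R) : 0 <= T -> acd y dy ->
  exists2 B, 0 <= B & forall t, 0 <= t <= T -> `|y t| <= B.
Proof. by move=> T0 [yac _]; exact: ac_bounded (yac T T0). Qed.

Lemma acdM (y z dy dz : R -> R) : acd y dy -> acd z dz ->
  acd (fun t => y t * z t) (fun t => y t * dz t + z t * dy t).
Proof.
move=> ya za; have [yac yd] := ya; have [zac zd] := za.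
split=> [T T0|].
  have [B B0 yB] := acd_bounded T0 ya; have [C C0 zC] := acd_bounded T0 za.
  apply: (@ac_dominated _ _ _ _ _ _ _ _ _ (B + C) _ (yac T T0) (zac T T0)).
    by rewrite addr_ge0.
  move=> l r l0 lr rT.
  have -> : y r * z r - y l * z l = y r * (z r - z l) + (y r - y l) * z l by ring.
  apply: le_trans (ler_normD _ _) _; rewrite !normrM.
  have yr : `|y r| <= B by apply: yB; rewrite rT (le_trans l0).
  have zl : `|z l| <= C by apply: zC; rewrite l0 (le_trans lr).
  have := ler_wpM2r (normr_ge0 (z r - z l)) yr.
  have := ler_wpM2l (normr_ge0 (y r - y l)) zl.
  have := mulr_ge0 C0 (normr_ge0 (z r - z l)).
  have := mulr_ge0 B0 (normr_ge0 (y r - y l)).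
  by lra.
apply: filterS2 yd zd => t yt zt t0.
by apply: (is_deriveM (yt t0) (zt t0)).
Qed.

Lemma acd_expR (y dy : R -> R) : acd y dy ->
  acd (fun t => expR (y t)) (fun t => expR (y t) * dy t).
Proof.
move=> ya; have [yac yd] := ya; split=> [T T0|].
  have [B B0 yB] := acd_bounded T0 ya.
  apply: (@ac_dominated _ _ _ _ _ _ _ _ _ (expR B) _ (yac T T0) (yac T T0)).
    exact: expR_ge0.
  move=> l r l0 lr rT.
  have Lip (u v : R) : u <= v -> v <= B -> `|expR v - expR u| <= expR B * `|v - u|.
    move=> uv vB; rewrite ger0_norm ?subr_ge0 ?ler_expR// ger0_norm ?subr_ge0//.
    have := expR_ge1Dx (u - v); rewrite -(ler_pM2l (expR_gt0 v)) -expRD subrKC.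
    have := ler_wpM2r (_ : 0 <= v - u) (_ : expR v <= expR B).
    rewrite subr_ge0 ler_expR => /(_ uv vB); lra.
  have yr : y r <= B by apply: le_trans (ler_norm _) (yB r _); rewrite rT (le_trans l0).
  have yl : y l <= B by apply: le_trans (ler_norm _) (yB l _); rewrite l0 (le_trans lr).
  apply: (@le_trans _ _ (expR B * `|y r - y l|)); last first.
    by apply: ler_wpM2l; [exact: expR_ge0|rewrite lerDl].
  have [yrl|/ltW yrl] := leP (y l) (y r); first exact: Lip.
  by rewrite distrC (distrC (y r)); exact: Lip.
apply: filterS yd => t yt t0; have {}yt := yt t0.
exact: is_derive1_comp.
Qed.

Lemma mx_entry_norm m n (M : 'M[R]_(m, n)) i j : `|M i j| <= `|M|.
Proof. by rewrite [leRHS]/Num.norm/= mx_normrE; exact: (le_bigmax _ _ (i, j)). Qed.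

Lemma mx_norm_le m n (M : 'M[R]_(m, n)) (c : R) : 0 <= c ->
  (forall i j, `|M i j| <= c) -> `|M| <= c.
Proof.
move=> c0 H; rewrite [leLHS]/Num.norm/= mx_normrE.
by apply: bigmax_le => // -[i j] _; exact: H.
Qed.

Lemma acd_mxP m n (y dy : R -> 'M[R]_(m, n)) :
  acd y dy <-> forall i j, acd (fun t => y t i j) (fun t => dy t i j).
Proof.
split=> [[yac yd] i j|ya].
  split=> [T T0|].
    apply: ac_dominated ler01 (yac T T0) (yac T T0) _ => l r l0 lr rT.
    rewrite mul1r; have := mx_entry_norm (y r - y l) i j; rewrite !mxE => /le_trans; apply.
    by rewrite lerDl.
  apply: filterS yd => t yt t0; have [dyt <-] := yt t0.
  rewrite derive_mx// mxE; apply: derivableP.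
  by move/derivable_mxP : dyt.
split=> [T T0|].
  suff : absolutely_continuous_on 0 T
      (fun t => \sum_i \sum_j y t i j *: delta_mx i j : 'M[R]_(m, n)).
    by under eq_fun do rewrite -matrix_sum_delta.
  suff acs V (I : Type) (s : seq I) (z : I -> R -> V) :
      (forall i, absolutely_continuous_on 0 T (z i)) ->
      absolutely_continuous_on 0 T (fun t => \sum_(i <- s) z i t).
    apply: (acs) => i; apply: (acs) => j; have [yac _] := ya i j.
    apply: ac_dominated (normr_ge0 (delta_mx i j : 'M[R]_(m, n))) (yac T T0) (yac T T0) _.
    move=> l r l0 lr rT; rewrite -scalerBl normrZ mulrC.
    by apply: ler_wpM2l => //; rewrite lerDl.
  move=> zac; elim: s => [|i s ih].
    under eq_fun do rewrite big_nil.
    by have [+ _] := @acd_cst V 0; apply.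
  have -> : (fun t => \sum_(j <- i :: s) z j t) = (fun t => z i t + \sum_(j <- s) z j t).
    by apply/funext => t; rewrite big_cons.
  apply: (@ac_dominated R V V V (z i) (fun t => \sum_(j <- s) z j t) _ 0 T 1) => //.
  by move=> l r l0 lr rT; rewrite mul1r opprD addrACA ler_normD.
have {ya}yd : {ae leb, forall t : R, forall i j, 0 <= t ->
    is_derive t 1 (fun t => y t i j) (dy t i j)}.
  apply: ae_leb_forall => i; apply: ae_leb_forall => j.
  by have [_] := ya i j.
apply: filterS yd => t yt t0.
have dyt : derivable y t 1.
  by apply/derivable_mxP => i j; have [] := yt i j t0.
apply: DeriveDef => //; rewrite derive_mx//; apply/matrixP => i j; rewrite mxE.
by have [] := yt i j t0.
Qed.

Lemma acd_le (h dh : R -> R) (a b : R) : 0 <= a -> a <= b -> acd h dh ->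
  {ae leb, forall t, a <= t <= b -> dh t <= 0} -> h b <= h a.
Proof.
move=> a0 ab [hac hd] dh0; apply: (ac_monotone ab) => [|].
  move=> e /(hac b (le_trans a0 ab))[d d0 H]; exists d => // n l r lr.
  by apply: H => i; have [al ?] := lr i; split => //; exact: le_trans al.
apply: filterS2 hd dh0 => t ht dh0 /[dup] /andP[at_ _] tab; split; last exact: dh0.
by apply: ht; exact: le_trans at_.
Qed.

Lemma acd_le2 (h dh k dk : R -> R) (a b : R) : 0 <= a -> a <= b ->
  acd h dh -> acd k dk ->
  {ae leb, forall t, a <= t <= b -> dh t <= dk t} -> h b - h a <= k b - k a.
Proof.
move=> a0 ab ha ka hk.
suff : h b - k b <= h a - k a by lra.
by apply: (acd_le a0 ab (acdB ha ka)); apply: filterS hk => t H' /H'; rewrite subr_le0.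
Qed.

(** The norm is the largest absolute value of an entry, so the bound is proved entry by entry and
    the norm of [y] is never differentiated. *)
Lemma acd_norm_le m n (y dy : R -> 'M[R]_(m, n)) (k dk : R -> R) (a b : R) :
  0 <= a -> a <= b -> acd y dy -> acd k dk ->
  {ae leb, forall t, a <= t <= b -> `|dy t| <= dk t} ->
  `|y b - y a| <= k b - k a.
Proof.
move=> a0 ab ya ka yk.
have kab : 0 <= k b - k a.
  have := acd_le2 a0 ab (@acd_cst R 0) ka; rewrite subrr; apply.
  by apply: filterS yk => t H /H; exact: le_trans.
apply: mx_norm_le => // i j; move/acd_mxP : ya => /(_ i j) ya; rewrite !mxE.
rewrite ler_norml; apply/andP; split.
  have H : - y b i j - - y a i j <= k b - k a.
    apply: acd_le2 a0 ab (acdN ya) ka _; apply: filterS yk => t H /H; apply: le_trans.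
    by apply: le_trans (ler_norm _) _; rewrite normrN; exact: mx_entry_norm.
  by lra.
apply: acd_le2 a0 ab ya ka _; apply: filterS yk => t H /H; apply: le_trans.
by apply: le_trans (ler_norm _) _; exact: mx_entry_norm.
Qed.

End acd_theory.

(** * Gronwall's inequality in a weighted norm *)

Section gronwall.
Context (R : realType).
Implicit Types (L e : R -> R).

Definition weight L := locally_integrable_time L /\ forall t, 0 <= t -> 0 <= L t.

Lemma prim_mono L (a b : R) : weight L -> 0 <= a -> a <= b -> prim L a <= prim L b.
Proof.
move=> [Li L0] a0 ab; rewrite -subr_ge0 -(subrr (0 : R)).
apply: (acd_le2 a0 ab (@acd_cst R R 0) (acd_prim Li)).
by apply: aeW => t /andP[at_ _]; apply: L0; exact: le_trans at_.
Qed.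

(** A Bielecki weight. The factor 2 makes the integral of [L * growth] from [s] equal to
    [(growth - 1) / 2], and this half is what yields a contraction in [gronwall] and in
    [picard_contract]. The absolute value covers times before [s]. *)
Definition growth L (s t : R) : R := expR (2 * `|prim L t - prim L s|).

Lemma growth_ge1 L s t : 1 <= growth L s t.
Proof. by rewrite -expR0 ler_expR mulr_ge0. Qed.

Lemma growthC L s t : growth L s t = growth L t s.
Proof. by rewrite /growth distrC. Qed.

Lemma growth_gt0 L s t : 0 < growth L s t.
Proof. exact: expR_gt0. Qed.

Lemma growth_le L (T s t : R) : weight L -> 0 <= s <= T -> 0 <= t <= T ->
  growth L s t <= expR (2 * prim L T).
Proof.
move=> wL; wlog st : s t / s <= t.
  move=> W; have [|/ltW] := leP s t; first exact: W.
  by rewrite growthC => + ? ?; move/W; apply.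
move=> /andP[s0 sT] /andP[t0 tT]; rewrite ler_expR ler_pM2l//.
have := prim_mono wL s0 st; have := prim_mono wL (lexx 0) s0.
have := prim_mono wL t0 tT; have [Li _] := wL; rewrite (prim0 Li).
by move=> *; rewrite ger0_norm; lra.
Qed.

(** Used with [c = 1] to the right of [s] and [c = -1] to its left, where the exponential equals
    [growth L s]. *)
Lemma acd_weighted_growth L (s c : R) : locally_integrable_time L ->
  acd (fun t => 2^-1 * expR (c * 2 * (prim L t - prim L s)))
      (fun t => c * L t * expR (c * 2 * (prim L t - prim L s))).
Proof.
move=> Li; have := acdZ 2^-1 (acd_expR (acdZ (c * 2) (acdB (acd_prim Li) (@acd_cst R R (prim L s))))).
apply: acd_ext => //; apply: aeW => t _; rewrite /= subr0.
rewrite (_ : _ *: _ = 2^-1 * (expR (c * 2 * (prim L t - prim L s)) * (c * 2 * L t)))//.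
by field.
Qed.

Lemma weighted_bound m n L e (D a b s t : R) (y dy : R -> 'M[R]_(m, n)) :
  weight L -> weight e -> acd y dy -> 0 <= D ->
  0 <= a -> a <= s <= b -> a <= t <= b ->
  {ae leb, forall r, a <= r <= b -> `|dy r| <= D * (L r * growth L s r) + e r} ->
  `|y t - y s| <= D / 2 * (growth L s t - 1) + (prim e b - prim e a).
Proof.
move=> wL we ya D0 a0 /andP[as_ sb] /andP[at_ tb] dyD.
have [Li L0] := wL; have [ei e0] := we.
have s0 := le_trans a0 as_; have t0 := le_trans a0 at_.
have ge c : acd
    (fun r => c * D * (2^-1 * expR (c * 2 * (prim L r - prim L s))) + prim e r)
    (fun r => c * D * (c * L r * expR (c * 2 * (prim L r - prim L s))) + e r) :=
  acdD (acdZ (c * D) (acd_weighted_growth s c Li)) (acd_prim ei).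
have [st|/ltW ts] := leP s t.
  have gE r : s <= r -> growth L s r = expR (1 * 2 * (prim L r - prim L s)).
    by move=> sr; rewrite /growth mul1r ger0_norm// subr_ge0 prim_mono.
  apply: (le_trans (acd_norm_le s0 st ya (ge 1) _)).
    apply: filterS dyD => r H /andP[sr rt].
    have := H _; rewrite gE// !mul1r; apply.
    by rewrite (le_trans as_)// (le_trans rt).
  rewrite gE// subrr mulr0 expR0.
  have := prim_mono we a0 as_; have := prim_mono we t0 tb.
  set G := expR _; lra.
have gE r : 0 <= r -> r <= s -> growth L s r = expR (-1 * 2 * (prim L r - prim L s)).
  move=> r0 rs; rewrite /growth distrC ger0_norm; last by rewrite subr_ge0 prim_mono.
  by congr expR; ring.
rewrite distrC; apply: (le_trans (acd_norm_le t0 ts ya (ge (-1)) _)).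
  apply: filterS dyD => r H /andP[tr rs].
  have := H _; rewrite gE//; last exact: le_trans tr.
  have -> : a <= r <= b by rewrite (le_trans at_)// (le_trans rs).
  move=> /(_ isT) /le_trans; apply; rewrite lerD2r le_eqVlt; apply/orP; left.
  by apply/eqP; ring.
rewrite gE// subrr mulr0 expR0.
have := prim_mono we a0 at_; have := prim_mono we s0 sb.
set G := expR _; lra.
Qed.

(** With [D] the supremum of [|y| / growth] on [a, b], integrating the differential inequality gives
    [D <= c + D / 2], hence [D <= 2 * c]. The time [s] at which [y] is known may lie on either side
    of [t]; adjoint variables are estimated backwards. *)
Lemma gronwall m n L e (a b s t : R) (y dy : R -> 'M[R]_(m, n)) :
  weight L -> weight e -> acd y dy ->
  0 <= a -> a <= s <= b -> a <= t <= b ->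
  {ae leb, forall r, a <= r <= b -> `|dy r| <= L r * `|y r| + e r} ->
  `|y t| <= 2 * (`|y s| + (prim e b - prim e a)) * growth L s t.
Proof.
move=> wL we ya a0 sab tab dyL.
have b0 : 0 <= b by case/andP: sab => as_ sb; exact: le_trans (le_trans a0 as_) sb.
pose w r := `|y r| / growth L s r.
pose S := [set w r | r in `[a, b]].
have [B B0 yB] := acd_bounded b0 ya.
have wB r : a <= r <= b -> w r <= B.
  move=> /andP[ar rb]; rewrite ler_pdivrMr ?growth_gt0//.
  have := yB r; rewrite rb (le_trans a0 ar) => /(_ isT) /le_trans; apply.
  by rewrite ler_peMr// growth_ge1.
have supS : has_sup S.
  split; first by exists (w s); exists s => //=; rewrite in_itv.
  by exists B => _ [r + <-]; rewrite /= in_itv/= => /wB.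
pose D := sup S.
have wD r : a <= r <= b -> w r <= D.
  by move=> rab; apply: ub_le_sup; [case: supS|exists r => //=; rewrite in_itv].
have w0 r : 0 <= w r by rewrite divr_ge0// ltW// growth_gt0.
have D0 : 0 <= D by apply: le_trans (wD s sab).
have yD r : a <= r <= b -> `|y r| <= D * growth L s r.
  by move=> /wD; rewrite ler_pdivrMr ?growth_gt0.
set c := `|y s| + _.
have c0 : 0 <= c.
  rewrite addr_ge0// subr_ge0; apply: prim_mono => //.
  by case/andP: sab => as_ sb; exact: le_trans sb.
have wc r : a <= r <= b -> w r <= c + D / 2.
  move=> rab; rewrite ler_pdivrMr ?growth_gt0//.
  have := @weighted_bound _ _ L e D a b s r y dy wL we ya D0 a0 sab rab.
  have -> : `|y r| = `|(y r - y s) + y s| by rewrite subrK.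
  move=> H; apply: (le_trans (ler_normD _ _)).
  have {}H : `|y r - y s| <= D / 2 * (growth L s r - 1) + (prim e b - prim e a).
    apply: H; apply: filterS dyL => u H uab; have yu := yD u uab; apply: (le_trans (H uab)).
    rewrite lerD2r mulrCA; apply: ler_wpM2l => //.
    by have [_ L0] := wL; apply: L0; case/andP: uab => au _; exact: le_trans au.
  have := growth_ge1 L s r; have : c <= c * growth L s r by rewrite ler_peMr// growth_ge1.
  rewrite mulrDl; move: H; rewrite /c.
  have := mulr_ge0 D0 (ltW (growth_gt0 L s r)).
  by move: D0; lra.
have Dc : D <= c + D / 2.
  by apply: ge_sup; [case: supS|move=> _ [r + <-]; rewrite /= in_itv/= => /wc].
apply: (le_trans (yD t tab)); apply: ler_wpM2r; first by rewrite ltW// growth_gt0.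
lra.
Qed.
End gronwall.

(** * Caratheodory functions and integrability *)

Section caratheodory_measurability.
Context (R : realType).

Definition round_mx (m n : nat) (p : nat) (M : 'M[int]_(m, n)) : 'M[R]_(m, n) :=
  map_mx (fun z : int => z%:~R / p.+1%:R) M.

Definition floor_mx (m n : nat) (p : nat) (M : 'M[R]_(m, n)) : 'M[int]_(m, n) :=
  map_mx (fun r : R => Num.floor (r * p.+1%:R)) M.

Lemma round_mx_near m n p (M : 'M[R]_(m, n)) :
  `|round_mx p (floor_mx p M) - M| <= p.+1%:R^-1.
Proof.
apply: mx_norm_le; first by rewrite invr_ge0.
move=> i j; rewrite !mxE.
have p0 : 0 < p.+1%:R :> R by [].
have /andP[fl fu] := floor_itv (M i j * p.+1%:R).
rewrite distrC ler_distl; apply/andP; split.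
  by rewrite lerBlDr ler_wpDr ?invr_ge0 ?ler_pdivrMr.
by rewrite -[X in _ + X]mul1r -mulrDl ler_pdivlMr//; move: fu; rewrite intrD => /ltW.
Qed.

Lemma measurable_floor_mx d (T : measurableType d) (D : set T) m n p
    (x : T -> 'M[R]_(m, n)) (q : 'M[int]_(m, n)) : measurable D ->
  (forall i j, measurable_fun D (fun t => x t i j)) ->
  measurable (D `&` [set t | floor_mx p (x t) = q]).
Proof.
move=> mD mx.
have -> : D `&` [set t | floor_mx p (x t) = q] =
    D `&` \bigcap_i \bigcap_j (D `&` [set t | Num.floor (x t i j * p.+1%:R) = q i j]).
  apply/seteqP; split=> [t [Dt tq]|t [Dt H]]; split => //.
    by move=> i _ j _; split => //=; rewrite -tq mxE.
  by apply/matrixP => i j; rewrite mxE; have [_ ->] := H i I j I.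
apply: measurableI => //.
apply: fin_bigcap_measurable => // i _; apply: fin_bigcap_measurable => // j _.
have mxp : measurable_fun D (fun t => x t i j * p.+1%:R).
  exact: measurable_funM.
have -> : [set t | Num.floor (x t i j * p.+1%:R) = q i j] =
    (fun t => x t i j * p.+1%:R) @^-1` `[(q i j)%:~R, (q i j + 1)%:~R[.
  apply/seteqP; split=> t /=; rewrite in_itv/=.
    by move=> <-; exact: floor_itv.
  by move=> /floor_def.
by apply: mxp => //; exact: measurable_itv.
Qed.

(** [x] and [u] are rounded to a grid of mesh 1/(p+1). The rounded arguments take countably many
    values, and where they are constant only measurability in time is used; continuity gives the
    limit in [p]. The domain [T] with its time coordinate [th] serves both time itself and pairs
    (time, control). *)
Lemma caratheodory_comp d (T : measurableType d) (D : set T) (A : set R) m n k l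
    (a : R -> 'M[R]_(m, n) -> 'M[R]_(k, l) -> R) (th : T -> R)
    (x : T -> 'M[R]_(m, n)) (u : T -> 'M[R]_(k, l)) :
  measurable D -> measurable A -> (forall w, D w -> A (th w)) ->
  measurable_fun D th ->
  (forall i j, measurable_fun D (fun t => x t i j)) ->
  (forall i j, measurable_fun D (fun t => u t i j)) ->
  (forall p q, measurable_fun A (fun t => a t p q)) ->
  (forall t, A t -> continuous (fun pq : 'M[R]_(m, n) * 'M[R]_(k, l) => a t pq.1 pq.2)) ->
  measurable_fun D (fun w => a (th w) (x w) (u w)).
Proof.
move=> mD mA DA mth mx mu ma ca.
pose h p w := a (th w) (round_mx p (floor_mx p (x w))) (round_mx p (floor_mx p (u w))).
apply: (@measurable_fun_cvg _ _ _ D h); last first.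
  move=> w Dw; have := ca _ (DA _ Dw) (x w, u w); rewrite /continuous_at/= => cw.
  have cvr (m' n' : nat) (M : 'M[R]_(m', n')) : round_mx p (floor_mx p M) @[p --> \oo] --> M.
    apply/cvgrPdist_le => e e0; near=> p.
    rewrite distrC; apply: (le_trans (round_mx_near _ _)).
    apply: ltW; near: p; exact: (near_infty_natSinv_lt (PosNum e0)).
  exact: (cvg_comp2 (cvr _ _ (x w)) (cvr _ _ (u w)) cw).
move=> p _ B mB.
rewrite (_ : D `&` _ = \bigcup_i (if unpickle i is Some (q1, q2) then
   (D `&` [set t | floor_mx p (x t) = q1]) `&` (D `&` [set t | floor_mx p (u t) = q2]) `&`
   (D `&` [set t | B (a (th t) (round_mx p q1) (round_mx p q2))]) else set0)).
  apply: bigcupT_measurable => i; case: unpickle => // -[q1 q2].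
  apply: measurableI; first by apply: measurableI; exact: measurable_floor_mx.
  have mq : measurable_fun D (fun t => a (th t) (round_mx p q1) (round_mx p q2)).
    have := @measurable_comp _ _ _ _ _ _ A (fun t => a t (round_mx p q1) (round_mx p q2)) D th.
    by apply => // _ [w Dw <-]; exact: DA.
  exact: mq.
apply/seteqP; split=> [t [Dt Bt]|t [i _]].
  exists (pickle (floor_mx p (x t), floor_mx p (u t))) => //.
  by rewrite pickleK.
by case: unpickle => // -[q1 q2] [[[Dt <-] [_ <-]] [_ ?]].
Unshelve. all: by end_near. Qed.

End caratheodory_measurability.

Section domination.

Lemma ae_dominated_integrable d (T : measurableType d) (R : realType)
    (mu : {measure set T -> \bar R}) (D : set T) (f g : T -> R) :
  measurable D -> measurable_fun D f -> mu.-integrable D (EFin \o g) ->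
  {ae mu, forall x, D x -> `|f x| <= g x} -> mu.-integrable D (EFin \o f).
Proof.
move=> mD mf /integrableP[mg gi] fg; apply/integrableP; split.
  exact/measurable_EFinP.
apply: le_lt_trans gi; apply: ae_ge0_le_integral => //.
- by apply: measurableT_comp => //; exact/measurable_EFinP.
- exact: measurableT_comp.
- apply: filterS fg => x H Dx; rewrite lee_fin.
  by apply: le_trans (H Dx) _; exact: ler_norm.
Qed.

Context (R : realType).
Notation lebT := (caratheodory_type (wlength (@idfun R))^*%mu).

Lemma acd_measurable m n (y dy : R -> 'M[R]_(m, n)) i j : acd y dy ->
  measurable_fun (`[0, +oo[%classic : set R) (fun t => y t i j).
Proof.
move=> /acd_mxP /(_ i j)[yac _].
rewrite (_ : `[0, +oo[%classic = \bigcup_n `[0, n%:R]%classic :> set R).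
  apply/(measurable_fun_bigcup _ _).2 => p; first exact: measurable_itv.
  apply: subspace_continuous_measurable_fun; first exact: measurable_itv.
  exact: ac_within_continuous (yac _ (ler0n _ _)).
apply/seteqP; split => [t|t [p _]] /=; rewrite !in_itv/= ?andbT; last by case/andP.
by move=> t0; exists (Num.trunc t).+1 => //=; rewrite in_itv/= t0 ltW// truncnS_gt.
Qed.

(** [u k - 2 * K / 2 ^ k] increases and [u k + 2 * K / 2 ^ k] decreases; the limit is squeezed
    between them, which also gives the error bound. *)
Lemma geometric_cvg (u : nat -> R) (K : R) :
  (forall k, `|u k.+1 - u k| <= K / 2 ^+ k) ->
  exists l, u @ \oo --> l /\ forall k, `|l - u k| <= 2 * K / 2 ^+ k.
Proof.
move=> uK.
have K0 : 0 <= K by have := uK 0%N; rewrite expr0 divr1; exact: le_trans.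
have p2 k : 0 < 2 ^+ k :> R by rewrite exprn_gt0.
pose v k := u k + 2 * K / 2 ^+ k; pose w k := u k - 2 * K / 2 ^+ k.
have KS k : 2 * K / 2 ^+ k.+1 = K / 2 ^+ k.
  by rewrite exprS invfM mulrACA divff// mul1r.
have wS : nondecreasing_seq w.
  apply/nondecreasing_seqP => k; rewrite /w KS; have := uK k; rewrite ler_norml => /andP[].
  by rewrite -[2 * K / _]mulrA; set A := K / _; lra.
have vS : nonincreasing_seq v.
  apply/nonincreasing_seqP => k; rewrite /v KS; have := uK k; rewrite ler_norml => /andP[].
  by rewrite -[2 * K / _]mulrA; set A := K / _; lra.
have wv k : w k <= v k.
  have : 0 <= 2 * K / 2 ^+ k by rewrite !mulr_ge0// invr_ge0 ltW.
  by rewrite /w /v; lra.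
have wvn k j : w k <= v j.
  apply: (le_trans (wS _ _ (leq_maxl k j))); apply: (le_trans (wv _)).
  exact: vS (leq_maxr k j).
have cw : cvgn w.
  apply: nondecreasing_is_cvgn => //; exists (v 0%N) => _ [k _ <-]; exact: wvn.
exists (limn w).
have bnd k : `|limn w - u k| <= 2 * K / 2 ^+ k.
  rewrite ler_distl; apply/andP; split.
    exact: nondecreasing_cvgn_le.
  by apply: limr_le => //; near=> j; exact: wvn.
split => //; apply/cvgrPdist_le => e e0.
have : geometric (2 * K) 2^-1 @ \oo --> 0.
  by apply: cvg_geometric; rewrite ger0_norm ?invr_ge0// invf_lt1// ltr1n.
move=> /cvgrPdist_le/(_ e e0); apply: filterS => k.
rewrite sub0r normrN /geometric/= exprVn => H; apply: (le_trans (bnd k)).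
exact: le_trans (ler_norm _) H.
Unshelve. all: by end_near. Qed.

Let lebT_itv (T : R) : @measurable _ lebT (`[0%R, T]%classic : set R).
Proof. by apply: leb_measurable; exact: measurable_itv. Qed.

Lemma locally_integrableZ (k : R -> R) (c : R) :
  locally_integrable_time k -> locally_integrable_time (fun t => c * k t).
Proof.
by move=> ki T T0; exact: (@integrableZl _ lebT R leb _ (lebT_itv T) c _ (ki T T0)).
Qed.

Lemma locally_integrableD (h k : R -> R) :
  locally_integrable_time h -> locally_integrable_time k ->
  locally_integrable_time (fun t => h t + k t).
Proof.
move=> hi ki T T0.
exact: (@integrableD _ lebT R leb _ (lebT_itv T) _ _ (hi T T0) (ki T T0)).
Qed.

Lemma locally_integrable_cst (c : R) : locally_integrable_time (fun=> c).
Proof.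
move=> T T0; apply: (@measurable_bounded_integrable _ lebT R leb (fun=> c)).
- exact: lebT_itv.
- rewrite [X in (X < _)%E](_ : _ = lebesgue_measure (`[0, T]%classic : set R))//.
  by rewrite lebesgue_measure_itv/=; case: ifP => // _; rewrite -EFinB ltry.
- exact: measurable_cst.
- by exists `|c|; split; [exact: num_real|move=> M /ltW cM x _].
Qed.

Lemma locally_integrable_piece (h : R -> R) :
  (forall T : R, 0 <= T -> exists k, locally_integrable_time k /\
    {ae leb, forall t, 0 <= t <= T -> `|h t| <= k t}) ->
  @measurable_fun _ _ lebT R `[0, +oo[%classic h -> locally_integrable_time h.
Proof.
move=> H mh T T0; have [k [ki hk]] := H T T0.
apply: (@ae_dominated_integrable _ lebT R leb _ h k (lebT_itv T) _ (ki T T0)).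
  apply: measurable_funS mh.
    by apply: leb_measurable; exact: measurable_itv.
  by move=> t /=; rewrite !in_itv/= => /andP[->].
by apply: filterS hk => t H' /=; rewrite in_itv/= => /H'.
Qed.

Lemma locally_integrable_dominated (h k : R -> R) :
  @measurable_fun _ _ lebT R `[0, +oo[%classic h -> locally_integrable_time k ->
  {ae leb, forall t, 0 <= t -> `|h t| <= k t} -> locally_integrable_time h.
Proof.
move=> mh ki hk; apply: locally_integrable_piece mh => T _; exists k; split => //.
by apply: filterS hk => t H /andP[/H].
Qed.

Lemma weight_cst (c : R) : 0 <= c -> weight (fun=> c).
Proof. by move=> c0; split => //; exact: locally_integrable_cst. Qed.

Lemma weightD (h k : R -> R) : weight h -> weight k -> weight (fun t => h t + k t).
Proof.
move=> [hi h0] [ki k0]; split; first exact: locally_integrableD.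
by move=> t t0; rewrite addr_ge0// ?h0 ?k0.
Qed.

Lemma weightZ (c : R) (k : R -> R) : 0 <= c -> weight k -> weight (fun t => c * k t).
Proof.
move=> c0 [ki k0]; split; first exact: locally_integrableZ.
by move=> t t0; rewrite mulr_ge0// k0.
Qed.

Lemma prim_unique (h k dk : R -> R) (t : R) : locally_integrable_time h ->
  acd k dk -> {ae leb, forall t, 0 <= t -> h t = dk t} -> k 0 = 0 -> 0 <= t ->
  prim h t = k t.
Proof.
move=> hi ka hk k0 t0; apply/eqP; rewrite eq_le; apply/andP; split.
  have := acd_le2 (lexx 0) t0 (acd_prim hi) ka.
  rewrite (prim0 hi) k0 !subr0; apply.
  by apply: filterS hk => r H /andP[/H ->].
have := acd_le2 (lexx 0) t0 ka (acd_prim hi).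
rewrite (prim0 hi) k0 !subr0; apply.
by apply: filterS hk => r H /andP[/H ->].
Qed.

Lemma prim_zero (t : R) : 0 <= t -> prim (fun=> 0) t = 0.
Proof.
move=> t0; apply: (prim_unique (locally_integrable_cst 0) (@acd_cst R R 0)) => //.
exact: aeW.
Qed.

End domination.

(** * Global existence by Picard iteration *)

Section picard.
Context (R : realType) (m n : nat).
Notation lebT := (caratheodory_type (wlength (@idfun R))^*%mu).
Notation V := 'M[R]_(m, n).

(** A class on which the Picard step is defined and which contains the limit of the iterates; the
    limit is not known to be absolutely continuous until it is shown to be a fixed point. *)
Definition good_path (y : R -> V) :=
  (forall i j, measurable_fun (`[0, +oo[%classic : set R) (fun t => y t i j)) /\
  (forall T : R, 0 <= T -> exists B, forall t, 0 <= t <= T -> `|y t| <= B).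

Variables (G : R -> V -> V) (L : R -> R).
Hypothesis wL : weight L.
Hypothesis GL : {ae leb, forall t : R, 0 <= t ->
  `|G t 0| <= L t /\ forall y z, `|G t y - G t z| <= L t * `|y - z|}.
Hypothesis mG : forall y, good_path y -> forall i j,
  @measurable_fun _ _ lebT R `[0, +oo[%classic (fun t => G t (y t) i j).

Lemma acd_good_path (y dy : R -> V) : acd y dy -> good_path y.
Proof.
move=> ya; split=> [i j|T T0]; first exact: acd_measurable ya.
by have [B _ yB] := acd_bounded T0 ya; exists B.
Qed.

Lemma good_path_integrable y i j : good_path y ->
  locally_integrable_time (fun t => G t (y t) i j).
Proof.
move=> gy; have [my By] := gy; have [Li L0] := wL.
apply: locally_integrable_piece; last exact: mG.
move=> T T0; have [B yB] := By T T0.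
exists (fun t => (1 + B) * L t); split; first exact: locally_integrableZ.
apply: filterS GL => t + tT; have [t0 _] := andP tT.
move=> /(_ t0)[G0 GB]; apply: (le_trans (mx_entry_norm _ _ _)).
rewrite -(subrK (G t 0) (G t (y t))); apply: (le_trans (ler_normD _ _)).
have := GB (y t) 0; rewrite subr0 => /le_trans H.
rewrite addrC mulrDl mul1r lerD// [leRHS]mulrC; apply: H.
by apply: ler_wpM2l (yB t tT); exact: L0.
Qed.

Variables (s : R) (c : V).
Hypothesis s0 : 0 <= s.

Definition picard_step (y : R -> V) (t : R) : V := \matrix_(i, j)
  (c i j + (prim (fun r => G r (y r) i j) t - prim (fun r => G r (y r) i j) s)).

Lemma picard_stepE y : picard_step y s = c.
Proof. by apply/matrixP => i j; rewrite mxE subrr addr0. Qed.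

Lemma acd_picard_step y : good_path y -> acd (picard_step y) (fun t => G t (y t)).
Proof.
move=> gy; apply/acd_mxP => i j.
have := acdD (@acd_cst R R (c i j)) (acdB (acd_prim (good_path_integrable i j gy))
  (@acd_cst R R (prim (fun r => G r (y r) i j) s))).
apply: acd_ext => [t _|]; first by rewrite mxE.
by apply: aeW => t _; rewrite subr0 add0r.
Qed.

(** In the norm weighted by [growth] the step contracts by 1/2 on all of [0, +oo) at once, on both
    sides of [s], so no local solutions have to be patched together. *)
Lemma picard_contract y z (D : R) : good_path y -> good_path z -> 0 <= D ->
  (forall t, 0 <= t -> `|y t - z t| <= D * growth L s t) ->
  forall t, 0 <= t -> `|picard_step y t - picard_step z t| <= D / 2 * growth L s t.
Proof.
move=> gy gz D0 yz t t0; pose b := Num.max s t.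
have w0 := weight_cst (lexx (0 : R)).
have := @weighted_bound R m n L (fun=> 0) D 0 b s t _ _ wL w0
  (acdB (acd_picard_step gy) (acd_picard_step gz)) D0 (lexx 0).
rewrite s0 t0 !le_max !lexx orbT => /(_ isT isT) H.
rewrite -[picard_step y t - _]subr0 -(subrr c) -{1}(picard_stepE y) -(picard_stepE z).
apply: (le_trans (H _)).
  apply: filterS GL => r Gr /andP[r0 _]; have [_ GB] := Gr r0; rewrite addr0.
  apply: (le_trans (GB _ _)); rewrite mulrCA.
  by apply: ler_wpM2l; [have [_] := wL; apply|exact: yz].
rewrite !prim_zero ?le_max ?s0// subr0 addr0.
by apply: ler_wpM2l; [rewrite divr_ge0|rewrite lerBlDr lerDl].
Qed.

Let Z k := iter k picard_step (fun=> c).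

Let gZ k : good_path (Z k).
Proof.
case: k => [|k]; first by apply: acd_good_path (acd_cst _).
elim: k => [|k ih] /=; apply: acd_good_path (acd_picard_step _) => //.
exact: acd_good_path (acd_cst _).
Qed.

(** On the constant path [c] the right-hand side is at most [L * (1 + |c|)], which bounds the first
    increment of the iteration. *)
Let K := 1 + `|c|.

Let Zdiff k t : 0 <= t -> `|Z k.+1 t - Z k t| <= K * growth L s t / 2 ^+ k.
Proof.
have K0 : 0 <= K by rewrite addr_ge0.
elim: k t => [|k ih] t t0; last first.
  apply: (le_trans (@picard_contract (Z k.+1) (Z k) (K / 2 ^+ k) _ _ _ _ t t0)) => //.
  - by rewrite divr_ge0// exprn_ge0.
  - by move=> r r0; rewrite mulrAC; exact: ih.
  - by rewrite exprS invfM le_eqVlt; apply/orP; left; apply/eqP; ring.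
rewrite expr0 divr1 /=.
have w0 := weight_cst (lexx (0 : R)).
have gc : good_path (fun=> c) by exact: acd_good_path (acd_cst _).
pose b := Num.max s t.
have := @weighted_bound R m n L (fun=> 0) K 0 b s t _ _ wL w0
  (acdB (acd_picard_step gc) (acd_cst c)) K0 (lexx 0).
rewrite s0 t0 !le_max !lexx orbT => /(_ isT isT) H.
move: H; rewrite picard_stepE (subrr c) subr0 => H.
apply: (le_trans (H _)).
  apply: filterS GL => r Gr /andP[r0 _]; have [G0 GB] := Gr r0; rewrite addr0 subr0.
  rewrite -(subrK (G r 0) (G r c)); apply: (le_trans (ler_normD _ _)).
  have := GB c 0; rewrite subr0 => Hc.
  have L0 : 0 <= L r by have [_] := wL; apply.
  apply: (@le_trans _ _ (K * L r)).
    by rewrite /K mulrDl mul1r [leRHS]addrC [`|c| * _]mulrC lerD.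
  by apply: ler_wpM2l => //; rewrite ler_peMr// growth_ge1.
rewrite !prim_zero ?le_max ?s0// subr0 addr0.
have := growth_ge1 L s t; set q := growth _ _ _ => q1.
have : 0 <= K * q by rewrite mulr_ge0// (le_trans _ q1).
by move: K0; lra.
Qed.

Theorem picard_existence :
  exists y, acd y (fun t => G t (y t)) /\ y s = c.
Proof.
have lim (t : R) i j : exists l, 0 <= t -> (fun k => Z k t i j) @ \oo --> l /\
    forall k, `|l - Z k t i j| <= 2 * (K * growth L s t) / 2 ^+ k.
  have [t0|t0] := ltP t 0; first by exists 0.
  have [|l Hl] := @geometric_cvg R (fun k => Z k t i j) (K * growth L s t); last by exists l.
  move=> k; apply: le_trans (Zdiff k t0).
  by have := mx_entry_norm (Z k.+1 t - Z k t) i j; rewrite !mxE.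
pose X t : V := \matrix_(i, j) sval (cid (lim t i j)).
have Xlim t i j : 0 <= t -> (fun k => Z k t i j) @ \oo --> X t i j.
  by move=> t0; rewrite mxE; case: cid => l /= /(_ t0)[].
have K0 : 0 <= K by rewrite addr_ge0.
have XZ k t : 0 <= t -> `|X t - Z k t| <= 2 * K / 2 ^+ k * growth L s t.
  move=> t0; apply: mx_norm_le.
    by rewrite !mulr_ge0// ?invr_ge0 ?exprn_ge0// ltW// growth_gt0.
  move=> i j; rewrite !mxE; case: cid => l /= /(_ t0)[_ /(_ k)].
  by rewrite (mulrA 2) [in X in _ -> X]mulrAC.
have gX : good_path X.
  split=> [i j|T T0].
    apply: (@measurable_fun_cvg _ _ _ _ (fun k t => Z k t i j)).
      by move=> k; have [+ _] := gZ k; apply.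
    by move=> t /=; rewrite in_itv/= andbT => /Xlim; apply.
  have [B ZB] := (gZ 0%N).2 T T0; exists (2 * K * expR (2 * prim L (Num.max s T)) + B).
  move=> t tT; have [t0 tT'] := andP tT.
  rewrite -(subrK (Z 0%N t) (X t)); apply: le_trans (ler_normD _ _) _.
  apply: lerD (ZB t tT); apply: le_trans (XZ 0%N t t0) _.
  rewrite expr0 divr1; apply: ler_wpM2l; first by rewrite mulr_ge0.
  by apply: growth_le => //; rewrite ?s0 ?t0 le_max ?lexx// tT' orbT.
(* Both sides are compared with the iterate [Z k.+1]: one distance is a contracted error at [k], the
   other the error at [k.+1]. *)
have XE t : 0 <= t -> picard_step X t = X t.
  move=> t0; apply/eqP; rewrite -subr_eq0 -normr_le0.
  apply/ler_addgt0Pl => e e0; rewrite addr0.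
  have : geometric (3 * K * growth L s t) 2^-1 @ \oo --> 0.
    by apply: cvg_geometric; rewrite ger0_norm ?invr_ge0// invf_lt1// ltr1n.
  move=> /cvgrPdist_le/(_ e e0)[k _ /(_ k (leqnn k))].
  rewrite sub0r normrN /geometric/= exprVn => He; apply: le_trans (le_trans (ler_norm _) He).
  rewrite -(subrK (Z k.+1 t) (picard_step X t)) -addrA; apply: le_trans (ler_normD _ _) _.
  have H1 := @picard_contract X (Z k) (2 * K / 2 ^+ k) gX (gZ k) _ (XZ k) t t0.
  have H2 := XZ k.+1 t t0; rewrite (distrC (Z k.+1 t) (X t)).
  have {}H1 := H1 _; apply: (le_trans (lerD (H1 _) H2)).
    by rewrite !mulr_ge0// invr_ge0 exprn_ge0.
  rewrite exprS invfM.
  have : 0 <= K * growth L s t / 2 ^+ k.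
    by rewrite !mulr_ge0// ?invr_ge0 ?exprn_ge0// ltW// growth_gt0.
  set A := _ / _; set p := (2 ^+ k)^-1; rewrite /A -/p.
  by set q := growth _ _ _; lra.
exists (picard_step X); split; last exact: picard_stepE.
have := acd_picard_step gX; apply: acd_ext => //.
by apply: aeW => t t0; rewrite XE.
Qed.

End picard.

Section calculus.
Context (R : realType).

Lemma is_derive_along (V W : normedModType R) (phi : V -> W) (x w : V) (s : R) :
  differentiable phi (x + s *: w) ->
  is_derive s 1 (fun s : R => phi (x + s *: w)) ('D_w phi (x + s *: w)).
Proof.
move=> /(diff_derivable (v := w)) dphi.
have E : (fun h : R => h^-1 *: (((fun s : R => phi (x + s *: w)) \o shift s) (h *: 1)
      - phi (x + s *: w))) =
    (fun h : R => h^-1 *: ((phi \o shift (x + s *: w)) (h *: w) - phi (x + s *: w))).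
  apply/funext => h; rewrite /= [_ *: 1]mulr1 scalerDl addrCA [h *: w + _]addrC.
  by congr (_ *: (phi _ - _)); rewrite addrC addrA addrAC.
apply: DeriveDef; first by rewrite /derivable E.
by rewrite /derive E.
Qed.

Lemma derive_grad m (phi : 'cV[R]_m -> R) (y w : 'cV[R]_m) :
  differentiable phi y -> 'D_w phi y = (grad phi y *m w) 0 0.
Proof.
move=> dphi; rewrite deriveE// mxE.
have {1}-> : w = \sum_j w j 0 *: delta_mx j 0.
  rewrite {1}(matrix_sum_delta w); apply: eq_bigr => j _.
  by rewrite big_ord1.
rewrite linear_sum; apply: eq_bigr => j _.
by rewrite linearZ mxE deriveE// mulrC.
Qed.

Lemma jac_entry m p (h : 'cV[R]_m -> 'cV[R]_p) (x : 'cV[R]_m) i j :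
  differentiable h x -> jac h x i j = grad (fun y => h y i 0) x 0 j.
Proof.
move=> dh; rewrite !mxE derive_mx ?mxE//.
exact: diff_derivable.
Qed.

Lemma differentiable_entry m p (h : 'cV[R]_m -> 'cV[R]_p) (x : 'cV[R]_m) i :
  differentiable h x -> differentiable (fun y => h y i 0) x.
Proof.
move=> dh; apply: (@differentiable_comp _ _ _ _ h (fun M : 'cV[R]_p => M i 0)) => //.
exact: differentiable_coord.
Qed.

Lemma mulmx_norm m n p (A : 'M[R]_(m, n)) (B : 'M[R]_(n, p)) :
  `|A *m B| <= n%:R * `|A| * `|B|.
Proof.
apply: mx_norm_le => [|i j]; first by rewrite !mulr_ge0.
rewrite mxE; apply: (le_trans (ler_norm_sum _ _ _)).
apply: (@le_trans _ _ (\sum_(l < n) `|A| * `|B|)).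
  by apply: ler_sum => l _; rewrite normrM ler_pM// mx_entry_norm.
by rewrite sumr_const card_ord -mulrA mulr_natl.
Qed.

Lemma segment_ball m (r : R) (x y : 'cV[R]_m) (s : R) : 0 <= s <= 1 ->
  `|x| <= r -> `|y| <= r -> `|x + s *: (y - x)| <= r.
Proof.
move=> /andP[s0 s1] xr yr.
have -> : x + s *: (y - x) = (1 - s) *: x + s *: y.
  by rewrite scalerBr scalerBl scale1r addrA addrAC.
apply: (le_trans (ler_normD _ _)); rewrite !normrZ ger0_norm ?subr_ge0// ger0_norm//.
have -> : r = (1 - s) * r + s * r by ring.
by apply: lerD; apply: ler_wpM2l => //; rewrite subr_ge0.
Qed.

(* Mean value theorem along the segment from [x] to [y]. *)
Lemma first_order_bound m (phi : 'cV[R]_m -> R) (x y : 'cV[R]_m) (C r : R) :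
  (forall z, differentiable phi z) -> 0 <= C -> `|x| <= r -> `|y| <= r ->
  (forall z, `|z| <= r -> `|grad phi z - grad phi x| <= C * `|z - x|) ->
  `|phi y - phi x - (grad phi x *m (y - x)) 0 0| <= m%:R * C * `|y - x| ^+ 2.
Proof.
move=> dphi C0 xr yr H; set w := y - x.
have dl (s : R) : is_derive s 1 (fun s : R => phi (x + s *: w)) ((grad phi (x + s *: w) *m w) 0 0).
  by rewrite -derive_grad//; exact: is_derive_along.
have ch : {within `[0, 1], continuous (fun s : R => phi (x + s *: w))}.
  apply: continuous_subspaceT => s.
  by apply: differentiable_continuous; apply/derivable1_diffP; have [] := dl s.
have [s] := MVT ltr01 (fun s _ => dl s) ch.
rewrite in_itv/= => /andP[s0 s1]; rewrite scale1r scale0r addr0 subr0 mulr1.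
rewrite {1 2}/w subrKC => ->; rewrite -[X in `|X|](_ : ((grad phi (x + s *: w) - grad phi x) *m w) 0 0 = _).
  apply: (le_trans (mx_entry_norm _ _ _)); apply: (le_trans (mulmx_norm _ _)).
  rewrite expr2 mulrA ler_wpM2r// -mulrA ler_wpM2l//.
  apply: (le_trans (H _ _)); first by apply: segment_ball; rewrite ?(ltW s0)// ltW.
  rewrite addrAC subrr add0r normrZ ger0_norm ?(ltW s0)//.
  by apply: ler_wpM2l => //; rewrite ler_piMl// ltW.
by rewrite mulmxBl !mxE.
Qed.

End calculus.

Section adjoint_formula.
Context (R : realType) (m k : nat).
Variables (f : R -> 'cV[R]_m -> 'rV[R]_k -> 'cV[R]_m)
          (g : R -> 'cV[R]_m -> 'rV[R]_k -> R).

(** The adjoint equation is thus affine in [p], with coefficients bounded by a weight along any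
    path; this gives global existence and linear estimates. *)
Lemma hamiltonian_xE (x : 'cV[R]_m) (t : R) (u : 'rV[R]_k) (lam : R) (p : 'rV[R]_m) :
  differentiable (fun y => f t y u) x -> differentiable (fun y => g t y u) x ->
  hamiltonian_x f g x t u lam p =
  p *m jac (fun y => f t y u) x + lam *: grad (fun y => g t y u) x.
Proof.
move=> df dg; apply/rowP => j; rewrite !mxE.
set e : 'cV[R]_m := delta_mx j 0.
have di i : is_derive x e (p 0 i \*: (fun y => f t y u i 0)) (p 0 i *: 'D_e (fun y => f t y u i 0) x).
  apply: is_deriveZ; apply: derivableP; apply: diff_derivable.
  exact: differentiable_entry.
have dge : is_derive x e (lam \*: (fun y => g t y u)) (lam *: 'D_e (fun y => g t y u) x).
  by apply: is_deriveZ; apply: derivableP; exact: diff_derivable.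
under eq_bigr do rewrite jac_entry// mxE.
have [_ E] := is_deriveD (is_derive_sum di) dge.
rewrite [RHS](_ : _ = \sum_(i < m) p 0 i *: 'D_e (fun y => f t y u i 0) x +
  lam *: 'D_e (fun y => g t y u) x)// -E.
congr ('D_e _ x); apply/funext => y; rewrite /hamiltonian mxE.
rewrite [RHS](_ : _ = (\sum_i p 0 i \*: (fun y => f t y u i 0)) y + lam * g t y u)//.
by congr (_ + _); rewrite fct_sumE; apply: eq_bigr.
Qed.

End adjoint_formula.

Section weights.
Context (R : realType).
Notation lebT := (caratheodory_type (wlength (@idfun R))^*%mu).

Lemma truncn_itvco (t : R) (j : nat) : 0 <= t ->
  (Num.truncn t == j) = (t \in `[j%:R, j.+1%:R[).
Proof. by move=> t0; rewrite in_itv/= -truncn_eq. Qed.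

Lemma measurable_piecewise d d' (X : measurableType d) (Y : measurableType d')
    (phi : X -> R) (k : nat -> X -> Y) :
  (forall i : interval R, measurable (phi @^-1` [set` i])) ->
  (forall j, measurable_fun (phi @^-1` `[0, +oo[) (k j)) ->
  measurable_fun (phi @^-1` `[0, +oo[) (fun w => k (Num.truncn (phi w)) w).
Proof.
move=> mphi mk.
rewrite (_ : phi @^-1` _ = \bigcup_j (phi @^-1` `[j%:R, j.+1%:R[)).
  apply/(measurable_fun_bigcup _ _).2 => j; first exact: mphi.
  apply: (eq_measurable_fun (k j)).
    move=> w; rewrite inE/= => wj; suff /eqP -> : Num.truncn (phi w) == j by [].
    by rewrite truncn_itvco//; move: wj; rewrite in_itv/= => /andP[+ _]; exact: le_trans.
  apply: measurable_funS (mk j); first exact: mphi.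
  move=> w /=; rewrite !in_itv/= andbT => /andP[+ _]; exact: le_trans.
apply/seteqP; split => [w|w [j _]] /=; rewrite !in_itv/= ?andbT; last first.
  by move=> /andP[+ _]; exact: le_trans.
move=> w0; exists (Num.truncn (phi w)) => //=.
by rewrite -truncn_itvco.
Qed.

Lemma weight_piecewise (k : nat -> R -> R) : (forall j, weight (k j)) ->
  weight (fun t => k (Num.truncn t) t).
Proof.
move=> wk; split; last by move=> t t0; have [_] := wk (Num.truncn t); apply.
have mI (i : interval R) : @measurable _ lebT (idfun @^-1` [set` i]).
  by apply: leb_measurable; exact: measurable_itv.
apply: locally_integrable_piece; last first.
  have := @measurable_piecewise _ _ lebT _ idfun k mI; apply => j.
  by apply: leb_measurable_fun_itv; have [] := wk j.
move=> T T0; exists (fun t => \sum_(j < (Num.truncn T).+1) k j t); split.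
  move: (Num.truncn T).+1 => p; elim: p => [|p ih].
    by under eq_fun do rewrite big_ord0; exact: locally_integrable_cst.
  under eq_fun do rewrite big_ord_recr/=.
  by apply: locally_integrableD => //; have [] := wk p.
apply: aeW => t /andP[t0 tT].
have tt : (Num.truncn t < (Num.truncn T).+1)%N by rewrite ltnS le_truncn.
rewrite (bigD1 (Ordinal tt))//= ger0_norm; last by have [_] := wk (Num.truncn t); apply.
by rewrite lerDl; apply: sumr_ge0 => j _; have [_] := wk j; apply.
Qed.

Lemma compact_bounded_pair m k (r : R) :
  compact [set p : 'cV[R]_m * 'rV[R]_k | `|p.1| <= r /\ `|p.2| <= r].
Proof.
have crow p : compact [set v : 'rV[R]_p | `|v| <= r].
  apply: bounded_closed_compact.
    by exists r; split; [exact: num_real|move=> M rM v /= /le_trans; apply; exact: ltW].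
  apply: (@closed_comp _ _ (fun v : 'rV[R]_p => `|v|) [set t | t <= r]).
    by move=> v _; exact: norm_continuous.
  exact: closed_le.
have tr (p q : nat) (M : 'M[R]_(p, q)) : `|M^T| = `|M|.
  apply/eqP; rewrite eq_le; apply/andP; split; apply: mx_norm_le => // i j.
    by rewrite mxE mx_entry_norm.
  by have := mx_entry_norm M^T j i; rewrite mxE.
have ccol : compact [set v : 'cV[R]_m | `|v| <= r].
  have -> : [set v : 'cV[R]_m | `|v| <= r] = trmx @` [set v : 'rV[R]_m | `|v| <= r].
    apply/seteqP; split=> [v /= vr|_ [v /= vr <-]]; last by rewrite /= tr.
    by exists v^T; rewrite /= ?tr// trmxK.
  have ct : continuous (fun v : 'rV[R]_m => (v^T : 'cV[R]_m)).
    move=> v s /= /(nbhs_ballP (v^T)) [e e0 es]; apply/nbhs_ballP; exists e => //= w vw.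
    by apply: es; move: vw; rewrite !mx_norm_ball /ball_/= -linearB tr.
  by apply: continuous_compact => //; exact: continuous_subspaceT.
rewrite (_ : mkset _ = [set v : 'cV[R]_m | `|v| <= r] `*` [set v : 'rV[R]_k | `|v| <= r]).
  exact: compact_setX.
by apply/seteqP; split.
Qed.

(** Regularity gives weights for one compact set, while paths and controls are bounded only locally
    in time. The radius may therefore change on each interval [j, j+1[, and the weights of these
    pieces are glued into one. *)
Lemma regular_weight m k (W : normedModType R) (a : R -> 'cV[R]_m -> 'rV[R]_k -> W)
    (r : nat -> R) : locally_lipschitz_bounded a ->
  exists L, weight L /\ forall t x y u, 0 <= t ->
    `|x| <= r (Num.truncn t) -> `|y| <= r (Num.truncn t) -> `|u| <= r (Num.truncn t) ->
    `|a t x u - a t y u| <= L t * `|x - y| /\ `|a t x u| <= L t.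
Proof.
move=> lipa.
pose P j (L : R -> R) := weight L /\ forall t x y u, 0 <= t ->
    `|x| <= r j -> `|y| <= r j -> `|u| <= r j ->
    `|a t x u - a t y u| <= L t * `|x - y| /\ `|a t x u| <= L t.
have exL j : exists L, P j L.
  have [L [M [LM0 Li Mi LL MM]]] := lipa _ (@compact_bounded_pair m k (r j)).
  exists (fun t => L t + M t); split.
    by apply: weightD; split => // t /LM0[].
  move=> t x y u t0 xr yr ur; have [L0 M0] := LM0 t t0; split.
    apply: (le_trans (LL t x y u t0 _ _)) => //.
    by apply: ler_wpM2r => //; rewrite lerDl.
  by apply: (le_trans (MM t x u t0 _)) => //; rewrite lerDr.
pose L j := sval (cid (exL j)); have PL j : P j (L j) := svalP (cid (exL j)).
exists (fun t => L (Num.truncn t) t); split.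
  by apply: weight_piecewise => j; have [] := PL j.
by move=> t x y u t0 xr yr ur; have [_] := PL (Num.truncn t); apply.
Qed.

Lemma locally_integrable_norm (h : R -> R) : locally_integrable_time h ->
  locally_integrable_time (fun t => `|h t|).
Proof.
move=> hi T T0.
exact: (@integrable_norm _ lebT R leb _ _ (hi T T0)).
Qed.

Lemma growth_weight m k (f : R -> 'cV[R]_m -> 'rV[R]_k -> 'cV[R]_m) (r : nat -> R) :
  sublinear_growth f ->
  exists l, weight l /\ forall t x u, 0 <= t -> `|u| <= r (Num.truncn t) ->
    `|f t x u| <= l t * (1 + `|x|).
Proof.
move=> gf.
pose P j (L : R -> R) := weight L /\ forall t x u, 0 <= t -> `|u| <= r j ->
    `|f t x u| <= L t * (1 + `|x|).
have exL j : exists L, P j L.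
  have cC : compact [set v : 'rV[R]_k | `|v| <= r j].
    apply: bounded_closed_compact.
      by exists (r j); split; [exact: num_real|move=> M rM v /= /le_trans; apply; exact: ltW].
    apply: (@closed_comp _ _ (fun v : 'rV[R]_k => `|v|) [set t | t <= r j]).
      by move=> v _; exact: norm_continuous.
    exact: closed_le.
  have [l [li fl]] := gf _ cC.
  exists (fun t => `|l t|); split.
    by split => //; exact: locally_integrable_norm.
  move=> t x u t0 ur; apply: (le_trans (fl t x u t0 ur)).
  by apply: ler_wpM2r; [rewrite addr_ge0|exact: ler_norm].
pose L j := sval (cid (exL j)); have PL j : P j (L j) := svalP (cid (exL j)).
exists (fun t => L (Num.truncn t) t); split.
  by apply: weight_piecewise => j; have [] := PL j.
by move=> t x u t0 ur; have [_] := PL (Num.truncn t); apply.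
Qed.

Lemma continuous_borel (W : normedModType R) (phi : W -> R) : continuous phi ->
  @measurable_fun _ _ (g_sigma_algebraType (@open W)) R setT phi.
Proof.
move=> cphi; apply: (measurability _ (RGenOpens.measurableE R)) => //.
move=> _ [_ [c [d ->]] <-]; rewrite setTI; apply: sub_sigma_algebra => /=.
by apply: open_comp; [move=> w _; exact: cphi|exact: interval_open].
Qed.

Lemma borel_on_time_comp (W : normedModType R) (h : R -> W) (phi : W -> R) :
  borel_on_time h -> continuous phi ->
  measurable_fun (`[0, +oo[%classic : set R) (fun t => phi (h t)).
Proof.
move=> mh /continuous_borel cphi _ B mB.
have := mh (measurable_itv _) _ (cphi measurableT _ mB).
by rewrite setTI.
Qed.

(** The exceptional set depends on [a] alone, so it can be removed before [phi], [x] and [u] are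
    known; [phi] extracts an entry of a vector or matrix value. *)
Lemma caratheodory_off_null m k (W : normedModType R)
    (a : R -> 'cV[R]_m -> 'rV[R]_k -> W) : caratheodory_fun a ->
  exists N : set R, [/\ measurable N, lebesgue_measure N = 0%E &
    forall phi : W -> R, continuous phi ->
    forall d (T : measurableType d) (D : set T) (th : T -> R)
      (x : T -> 'cV[R]_m) (u : T -> 'rV[R]_k), measurable D ->
    (forall w, D w -> 0 <= th w /\ ~ N (th w)) -> measurable_fun D th ->
    (forall i j, measurable_fun D (fun w => x w i j)) ->
    (forall i j, measurable_fun D (fun w => u w i j)) ->
    measurable_fun D (fun w => phi (a (th w) (x w) (u w)))].
Proof.
move=> [ma /leb_negligible_cover[N [mN N0 cN]]]; exists N; split => // phi cphi d T D th x u mD DN mth mx mu.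
have mI : measurable (`[0, +oo[%classic : set R) by exact: measurable_itv.
apply: (@caratheodory_comp R _ _ D ((`[0, +oo[%classic : set R) `\` N) m 1 1 k
  (fun t x u => phi (a t x u)) th x u) => //.
- exact: measurableD.
- by move=> w /DN[t0 Nt]; split => //=; rewrite in_itv/= andbT.
- move=> p q; apply: measurable_funS (borel_on_time_comp (ma p q) cphi) => //.
- move=> t [t0 Nt] pq.
  have ct : continuous (fun p : 'cV[R]_m * 'rV[R]_k => a t p.1 p.2).
    apply: contrapT => nc; apply: Nt; apply: cN => /= H; apply: nc; apply: H.
    by move: t0; rewrite /= in_itv/= andbT.
  by apply: (@cvg_comp _ _ _ (fun p : 'cV[R]_m * 'rV[R]_k => a t p.1 p.2) phi); [exact: ct|exact: cphi].
Qed.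

Lemma caratheodory_measurable m k (W : normedModType R)
    (a : R -> 'cV[R]_m -> 'rV[R]_k -> W) (phi : W -> R)
    (x : R -> 'cV[R]_m) (u : R -> 'rV[R]_k) :
  caratheodory_fun a -> continuous phi ->
  (forall i j, measurable_fun (`[0, +oo[%classic : set R) (fun t => x t i j)) ->
  (forall i j, measurable_fun (`[0, +oo[%classic : set R) (fun t => u t i j)) ->
  @measurable_fun _ _ lebT R `[0, +oo[%classic (fun t => phi (a t (x t) (u t))).
Proof.
move=> /caratheodory_off_null[N [mN N0 H]] cphi mx mu.
have mI : measurable (`[0, +oo[%classic : set R) by exact: measurable_itv.
have lN : leb.-negligible N by apply/leb_negligibleE; exists N; split.
have mD : measurable ((`[0, +oo[%classic : set R) `\` N) by exact: measurableD.
apply: leb_measurable_fun_ae mI lN mN _.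
apply: (H phi cphi _ _ _ idfun x u mD).
- by move=> w [+ Nw]; rewrite /= in_itv/= andbT.
- exact: measurable_id.
- by move=> i j; apply: measurable_funS (mx i j) => // t [].
- by move=> i j; apply: measurable_funS (mu i j) => // t [].
Qed.

End weights.

(** * Trajectories and adjoint variables *)

Section clamp.
Context (R : realType) (m n : nat).
Implicit Types (c : R) (M : 'M[R]_(m, n)).

(** The projection onto the ball of radius [c] of the sup norm. Composed with it, the dynamics
    become globally Lipschitz, as [picard_existence] requires. *)
Definition clamp_mx c M : 'M[R]_(m, n) :=
  map_mx (fun z => Num.max (- c) (Num.min c z)) M.

Let clamp1 c z : 0 <= c -> `|Num.max (- c) (Num.min c z)| <= Num.min c `|z|.
Proof.
move=> c0; have [z0|z0] := leP 0 z.
  have w0 : 0 <= Num.min c z by rewrite le_min c0.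
  have wc : - c <= Num.min c z by apply: le_trans w0; rewrite oppr_le0.
  by rewrite (ger0_norm z0) (max_r wc) ger0_norm.
have zc : z <= c by apply: le_trans c0; exact: ltW.
rewrite (min_r zc) le_min; apply/andP; split.
  by rewrite ler_norml le_max lexx/= ge_max zc andbT; lra.
rewrite ler_norml le_max ge_max; apply/and3P; split.
- by rewrite (ltr0_norm z0) opprK lexx orbT.
- by apply: le_trans (normr_ge0 z); rewrite oppr_le0.
- exact: ler_norm.
Qed.

Lemma clamp_mx_le c M : 0 <= c -> `|clamp_mx c M| <= c.
Proof.
move=> c0; apply: mx_norm_le => // i j; rewrite mxE.
by apply: le_trans (clamp1 _ c0) _; rewrite ge_min lexx.
Qed.

Lemma clamp_mx_le_norm c M : 0 <= c -> `|clamp_mx c M| <= `|M|.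
Proof.
move=> c0; apply: mx_norm_le => // i j; rewrite mxE.
apply: le_trans (clamp1 _ c0) _; apply: (@le_trans _ _ `|M i j|).
  by rewrite ge_min lexx orbT.
exact: mx_entry_norm.
Qed.

Lemma clamp_mx_id c M : `|M| <= c -> clamp_mx c M = M.
Proof.
move=> Mc; apply/matrixP => i j; rewrite mxE.
have := le_trans (mx_entry_norm M i j) Mc; rewrite ler_norml => /andP[h1 h2].
by rewrite min_r// max_r.
Qed.

Lemma clamp_mx_lipschitz c M M' : `|clamp_mx c M - clamp_mx c M'| <= `|M - M'|.
Proof.
apply: mx_norm_le => // i j; rewrite !mxE.
apply: (@le_trans _ _ `|M i j - M' i j|); last first.
  by have := mx_entry_norm (M - M') i j; rewrite !mxE.
move: (M i j) (M' i j) => a b.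
wlog ab : a b / a <= b.
  move=> W; have [|/ltW] := leP a b; first exact: W.
  by rewrite distrC (distrC a); exact: W.
rewrite distrC (distrC a) ger0_norm; last first.
  by rewrite subr_ge0 ge_max !le_max lexx/= le_min !ge_min lexx ab !orbT.
rewrite ger0_norm ?subr_ge0//.
by rewrite /Num.min /Num.max; do !case: ifPn; rewrite -?leNgt; lra.
Qed.

End clamp.

Section dynamics.
Context (R : realType) (m k : nat).
Variables (f : R -> 'cV[R]_m -> 'rV[R]_k -> 'cV[R]_m)
          (g : R -> 'cV[R]_m -> 'rV[R]_k -> R).
Hypothesis reg : regularity f g.
Notation lebT := (caratheodory_type (wlength (@idfun R))^*%mu).

Definition flow (u : R -> 'rV[R]_k) (x : R -> 'cV[R]_m) :=
  ode_solution (fun t y => f t y (u t)) x.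

Definition within_radius (V : normedModType R) (r : nat -> R) (y : R -> V) :=
  forall t, 0 <= t -> `|y t| <= r (Num.truncn t).

(** What the estimates use of a control, without reference to [U]. The radius is a parameter, so
    constants derived from [r] serve every control obtained later by switching. *)
Definition control (r : nat -> R) (u : R -> 'rV[R]_k) :=
  (forall i j, measurable_fun (`[0, +oo[%classic : set R) (fun t => u t i j)) /\
  within_radius r u.

Lemma control_le r r' u : (forall j, r j <= r' j) -> control r u -> control r' u.
Proof. by move=> rr [mu ur]; split=> // t t0; exact: le_trans (ur t t0) _. Qed.

Lemma borel_on_time_entry (u : R -> 'rV[R]_k) i j : borel_on_time u ->
  measurable_fun (`[0, +oo[%classic : set R) (fun t => u t i j).
Proof.
by move=> mu; apply: (borel_on_time_comp (phi := fun v : 'rV[R]_k => v i j)) => //; exact: coord_continuous.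
Qed.

Lemma admissible_control U u : admissible U u -> exists r, control r u.
Proof.
move=> [mu bu _].
have ex j : exists c, forall t, 0 <= t <= (j.+1)%:R -> `|u t| <= c.
  have [M [_ HM]] := bu j.+1%:R; exists (M + 1) => t tj.
  by apply: (HM (M + 1)); [rewrite ltrDl|exists t => //=; rewrite in_itv].
exists (fun j => sval (cid (ex j))); split=> [i j|t t0].
  exact: borel_on_time_entry.
apply: (svalP (cid (ex (Num.truncn t)))); rewrite t0/=.
by apply: ltW; exact: truncnS_gt.
Qed.

Lemma path_bounded p q (y dy : R -> 'M[R]_(p, q)) : acd y dy ->
  exists r, within_radius r y.
Proof.
move=> ya.
have ex j : exists c, forall t, 0 <= t <= (j.+1)%:R -> `|y t| <= c.
  by have [B _ yB] := acd_bounded (ler0n R j.+1) ya; exists B.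
exists (fun j => sval (cid (ex j))) => t t0.
apply: (svalP (cid (ex (Num.truncn t)))); rewrite t0/=.
by apply: ltW; exact: truncnS_gt.
Qed.

Definition dyn_bound (r : nat -> R) (L : R -> R) := weight L /\
  forall t x y u, 0 <= t -> `|x| <= r (Num.truncn t) -> `|y| <= r (Num.truncn t) ->
    `|u| <= r (Num.truncn t) ->
  [/\ `|f t x u - f t y u| <= L t * `|x - y|,
      `|g t x u - g t y u| <= L t * `|x - y|,
      `|jac (fun z => f t z u) x - jac (fun z => f t z u) y| <= L t * `|x - y|
    & `|grad (fun z => g t z u) x - grad (fun z => g t z u) y| <= L t * `|x - y|] /\
  [/\ `|f t x u| <= L t, `|g t x u| <= L t,
      `|jac (fun z => f t z u) x| <= L t & `|grad (fun z => g t z u) x| <= L t].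

Lemma dyn_weight (r : nat -> R) : exists L, dyn_bound r L.
Proof.
have [L1 [w1 H1]] := regular_weight r (regular_dyn reg).2.
have [L2 [w2 H2]] := regular_weight r (regular_cost reg).2.
have [L3 [w3 H3]] := regular_weight r (regular_jac_dyn reg).2.
have [L4 [w4 H4]] := regular_weight r (regular_grad_cost reg).2.
exists (fun t => L1 t + L2 t + (L3 t + L4 t)); split.
  by do !apply: weightD.
move=> t x y u t0 xr yr ur.
have [A1 B1] := H1 t x y u t0 xr yr ur; have [A2 B2] := H2 t x y u t0 xr yr ur.
have [A3 B3] := H3 t x y u t0 xr yr ur; have [A4 B4] := H4 t x y u t0 xr yr ur.
have p1 := w1.2 t t0; have p2 := w2.2 t t0; have p3 := w3.2 t t0; have p4 := w4.2 t t0.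
have n0 := normr_ge0 (x - y); clear H1 H2 H3 H4 w1 w2 w3 w4.
by do !split; [apply: (le_trans A1)|apply: (le_trans A2)|apply: (le_trans A3)|
  apply: (le_trans A4)|apply: (le_trans B1)|apply: (le_trans B2)|
  apply: (le_trans B3)|apply: (le_trans B4)]; rewrite ?ler_wpM2r//; lra.
Qed.

(** [rho] is fixed before the path: it depends only on the growth weight, the time [s] and the bound
    [C], and hence serves all controls of a given radius. *)
Lemma apriori_bound (l : R -> R) (s C : R) : weight l -> 0 <= s ->
  exists rho : nat -> R, forall p (x dx : R -> 'cV[R]_p), acd x dx -> `|x s| <= C ->
    {ae leb, forall t : R, 0 <= t -> `|dx t| <= l t * (1 + `|x t|)} ->
    forall t, 0 <= t -> `|x t| <= rho (Num.truncn t).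
Proof.
move=> wl s0; pose T j := Num.max s j.+1%:R.
exists (fun j => 2 * (C + prim l (T j)) * expR (2 * prim l (T j))).
move=> p x dx xa xC dxl t t0; set j := Num.truncn t.
have T0 : 0 <= T j by rewrite le_max s0.
have tT : t <= T j by rewrite le_max (ltW (truncnS_gt _)) orbT.
have sT : s <= T j by rewrite le_max lexx.
have P0 : prim l 0 = 0 by exact: prim0 wl.1.
have PT : 0 <= prim l (T j) by rewrite -P0; exact: prim_mono.
apply: (le_trans (@gronwall R p 1 l l 0 (T j) s t x dx wl wl xa (lexx 0) _ _ _)).
- by rewrite s0 sT.
- by rewrite t0 tT.
- apply: filterS dxl => q H /andP[q0 _]; apply: (le_trans (H q0)).
  by rewrite mulrDr mulr1 addrC.
rewrite P0 subr0; apply: ler_pM.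
- by rewrite mulr_ge0// addr_ge0.
- by rewrite ltW// growth_gt0.
- by rewrite ler_pM2l// lerD2r.
- by apply: growth_le => //; rewrite ?s0 ?t0.
Qed.

Lemma measurable_clamp (c : nat -> R) (x : R -> 'cV[R]_m) :
  (forall i j, measurable_fun (`[0, +oo[%classic : set R) (fun t => x t i j)) ->
  forall i j, measurable_fun (`[0, +oo[%classic : set R)
    (fun t => clamp_mx (c (Num.truncn t)) (x t) i j).
Proof.
move=> mx i j.
rewrite (_ : (fun t => _) = (fun t =>
  Num.max (- c (Num.truncn t)) (Num.min (c (Num.truncn t)) (x t i j)))); last first.
  by apply/funext => t; rewrite mxE.
have := @measurable_piecewise R _ _ R R idfun
  (fun l t => Num.max (- c l) (Num.min (c l) (x t i j))).
apply=> [i'|l]; first exact: measurable_itv.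
by apply: measurable_maxr => //; apply: measurable_minr.
Qed.

(** The dynamics are clamped at the a priori bound. Clamping does not increase norms, so the clamped
    equation satisfies the same growth estimate; its solution obeys the bound, and the clamp is
    inactive along it. The free time [s] is needed to join trajectories at a positive time. *)
Theorem trajectory_exists r u (s : R) (c : 'cV[R]_m) : control r u -> 0 <= s ->
  exists x, flow u x /\ x s = c.
Proof.
move=> [mu ur] s0.
have [l [wl fl]] := growth_weight r (growth_dyn reg).
have [rho rhoP] := apriori_bound `|c| wl s0.
pose rh j := Num.max 0 (rho j).
have rh0 j : 0 <= rh j by rewrite le_max lexx.
have [L [wL HL]] := dyn_weight (fun j => Num.max (rh j) (r j)).
pose G t (y : 'cV[R]_m) := f t (clamp_mx (rh (Num.truncn t)) y) (u t).
have GL : {ae leb, forall t : R, 0 <= t ->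
    `|G t 0| <= L t /\ forall y z, `|G t y - G t z| <= L t * `|y - z|}.
  apply: aeW => t t0.
  have cl (y : 'cV[R]_m) : `|clamp_mx (rh (Num.truncn t)) y| <= Num.max (rh (Num.truncn t)) (r (Num.truncn t)).
    by apply: le_trans (clamp_mx_le _ (rh0 _)) _; rewrite le_max lexx.
  have ur' : `|u t| <= Num.max (rh (Num.truncn t)) (r (Num.truncn t)).
    by rewrite le_max ur// orbT.
  split; first by have [_ []] := HL t _ _ _ t0 (cl 0) (cl 0) ur'.
  move=> y z; have [[H _ _ _] _] := HL t _ _ _ t0 (cl y) (cl z) ur'.
  apply: (le_trans H); apply: ler_wpM2l; first exact: wL.2.
  exact: clamp_mx_lipschitz.
have mG y : good_path y -> forall i j,
    @measurable_fun _ _ lebT R `[0, +oo[%classic (fun t => G t (y t) i j).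
  move=> [my _] i j.
  apply: (@caratheodory_measurable R m k 'cV[R]_m f (fun M => M i j)
    (fun t => clamp_mx (rh (Num.truncn t)) (y t)) u (regular_dyn reg).1) => //.
    exact: coord_continuous.
  exact: measurable_clamp.
have [x [xa xs]] := picard_existence wL GL mG c s0.
exists x; split => //.
have xrho t : 0 <= t -> `|x t| <= rho (Num.truncn t).
  apply: (rhoP _ _ _ xa); first by rewrite xs.
  apply: aeW => q q0; apply: (le_trans (fl q _ _ q0 (ur q q0))).
  by rewrite ler_wpM2l ?wl.2// lerD2l clamp_mx_le_norm.
suff : acd x (fun t => f t (x t) (u t)) by [].
apply: acd_ext xa => //; apply: aeW => t t0; rewrite /G clamp_mx_id//.
by apply: le_trans (xrho t t0) _; rewrite le_max lexx orbT.
Qed.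

End dynamics.

Section solutions.
Context (R : realType) (m k : nat).
Variables (f : R -> 'cV[R]_m -> 'rV[R]_k -> 'cV[R]_m)
          (g : R -> 'cV[R]_m -> 'rV[R]_k -> R).
Hypothesis reg : regularity f g.
Notation lebT := (caratheodory_type (wlength (@idfun R))^*%mu).

Lemma trajectory_unique r u u' (a b s : R) (x1 x2 : R -> 'cV[R]_m) :
  control r u -> 0 <= a -> a <= s <= b -> (forall t, a <= t <= b -> u' t = u t) ->
  flow f u x1 -> flow f u' x2 -> x1 s = x2 s ->
  forall t, a <= t <= b -> x1 t = x2 t.
Proof.
move=> [mu ur] a0 sab uu x1a x2a xs t tab.
have [r1 xr1] := @path_bounded R m 1 x1 (fun t => f t (x1 t) (u t)) x1a.
have [r2 xr2] := @path_bounded R m 1 x2 (fun t => f t (x2 t) (u' t)) x2a.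
have [L [wL HL]] := dyn_weight reg (fun j => Num.max (r j) (Num.max (r1 j) (r2 j))).
have w0 := weight_cst (lexx (0 : R)).
have xa : acd (fun t => x1 t - x2 t) (fun t => f t (x1 t) (u t) - f t (x2 t) (u' t)).
  exact: (acdB (x1a : acd x1 (fun t => f t (x1 t) (u t)))
               (x2a : acd x2 (fun t => f t (x2 t) (u' t)))).
have b0 : 0 <= b by case/andP: sab => as_ sb; exact: le_trans a0 (le_trans as_ sb).
have H := @gronwall R m 1 L (fun=> 0) a b s t _ _ wL w0 xa a0 sab tab.
apply/eqP; rewrite -subr_eq0 -normr_le0; apply: (le_trans (H _)); last first.
  by rewrite xs subrr normr0 !prim_zero// subrr addr0 mulr0 mul0r.
apply: aeW => q /[dup] qab /andP[aq _]; rewrite addr0 uu//.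
have q0 : 0 <= q by exact: le_trans aq.
have [|||[]] := HL q (x1 q) (x2 q) (u q) q0 => //.
- by rewrite !le_max xr1// orbT.
- by rewrite !le_max xr2// !orbT.
- by rewrite le_max ur.
Qed.

Lemma trajectoryP r u (xi : 'cV[R]_m) : control r u ->
  flow f u (trajectory f xi u) /\ trajectory f xi u 0 = xi.
Proof.
move=> ru; have [x [xa x0]] := trajectory_exists reg xi ru (lexx 0).
rewrite /trajectory; set S := (X in xget _ X).
by apply: (@xgetPex _ (fun=> 0) S); exists x; split.
Qed.

Definition adjoint (x : R -> 'cV[R]_m) (u : R -> 'rV[R]_k) (lam : R)
    (p : R -> 'rV[R]_m) :=
  ode_solution (fun t p => - hamiltonian_x f g (x t) t (u t) lam p) p.

Lemma adjoint_rhsE (x : 'cV[R]_m) t u lam p : 0 <= t ->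
  hamiltonian_x f g x t u lam p =
  p *m jac (fun y => f t y u) x + lam *: grad (fun y => g t y u) x.
Proof.
move=> t0; apply: hamiltonian_xE.
  exact: (differentiable_dyn reg).
exact: (differentiable_cost reg).
Qed.

Lemma good_path_leb p q (y : R -> 'M[R]_(p, q)) i j : good_path y ->
  @measurable_fun _ _ lebT R `[0, +oo[%classic (fun t => y t i j).
Proof.
move=> [my _]; apply: leb_measurable_fun (my i j); exact: measurable_itv.
Qed.

Lemma adjoint_unique r u u' (a b s : R) (x x' dx dx' : R -> 'cV[R]_m) (lam : R)
    (p p' : R -> 'rV[R]_m) :
  control r u -> acd x dx -> acd x' dx' -> 0 <= a -> a <= s <= b ->
  (forall t, a <= t <= b -> u' t = u t) -> (forall t, a <= t <= b -> x' t = x t) ->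
  adjoint x u lam p -> adjoint x' u' lam p' ->
  p s = p' s -> forall t, a <= t <= b -> p t = p' t.
Proof.
move=> [mu ur] xa xa' a0 sab uu xx pa pa' ps t tab.
have [r1 xr1] := path_bounded xa.
have [L [wL HL]] := dyn_weight reg (fun j => Num.max (r j) (r1 j)).
have w0 := weight_cst (lexx (0 : R)).
have qa := acdB (pa : acd p (fun t => - hamiltonian_x f g (x t) t (u t) lam (p t)))
  (pa' : acd p' (fun t => - hamiltonian_x f g (x' t) t (u' t) lam (p' t))).
have b0 : 0 <= b by case/andP: sab => as_ sb; exact: le_trans a0 (le_trans as_ sb).
have H := @gronwall R 1 m _ (fun=> 0) a b s t _ _ (weightZ (ler0n R m) wL) w0 qa a0 sab tab.
apply/eqP; rewrite -subr_eq0 -normr_le0; apply: (le_trans (H _)); last first.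
  by rewrite ps subrr normr0 !prim_zero// subrr addr0 mulr0 mul0r.
apply: aeW => q /[dup] qab /andP[aq _]; rewrite addr0 uu// xx//.
have q0 : 0 <= q by exact: le_trans aq.
rewrite !adjoint_rhsE// (_ : - _ - - _ = - ((p q - p' q) *m jac (fun y => f q y (u q)) (x q))); last first.
  by rewrite mulmxBl; apply/rowP => j; rewrite !mxE; ring.
have xr : `|x q| <= Num.max (r (Num.truncn q)) (r1 (Num.truncn q)).
  by rewrite le_max xr1// orbT.
have [|_ [_ _ FL _]] := HL q (x q) (x q) (u q) q0 xr xr; first by rewrite le_max ur.
rewrite normrN; apply: (le_trans (mulmx_norm _ _)); rewrite mulrAC.
by rewrite ler_wpM2r// ler_wpM2l.
Qed.

Theorem adjoint_exists r u (x dx : R -> 'cV[R]_m) (lam s : R) (c : 'rV[R]_m) :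
  control r u -> acd x dx -> 0 <= s ->
  exists psi, adjoint x u lam psi /\ psi s = c.
Proof.
move=> [mu ur] xa s0.
have [r1 xr1] := path_bounded xa.
have [L [wL HL]] := dyn_weight reg (fun j => Num.max (r j) (r1 j)).
pose A t := jac (fun y => f t y (u t)) (x t).
pose b t := grad (fun y => g t y (u t)) (x t).
have AL t : 0 <= t -> `|A t| <= L t /\ `|b t| <= L t.
  move=> t0.
  have xr : `|x t| <= Num.max (r (Num.truncn t)) (r1 (Num.truncn t)).
    by rewrite le_max xr1// orbT.
  by have [|_ []] := HL t (x t) (x t) (u t) t0 xr xr; rewrite ?le_max ?ur.
pose G t (p : 'rV[R]_m) := - (p *m A t + lam *: b t).
pose C := m%:R + `|lam|.
have C0 : 0 <= C by rewrite addr_ge0.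
have GL : {ae leb, forall t : R, 0 <= t -> `|G t 0| <= C * L t /\
    forall y z, `|G t y - G t z| <= C * L t * `|y - z|}.
  apply: aeW => t t0; have [At bt] := AL t t0; have L0 := wL.2 t t0.
  split=> [|y z].
    rewrite /G mul0mx add0r normrN normrZ mulrDl ler_wpDl ?mulr_ge0//.
    by rewrite ler_wpM2l.
  have -> : G t y - G t z = - ((y - z) *m A t).
    by rewrite /G mulmxBl !opprD !opprK addrACA [- _ + lam *: _]addrC subrr addr0 addrC.
  rewrite normrN; apply: (le_trans (mulmx_norm _ _)).
  rewrite /C mulrDl mulrDl ler_wpDr ?mulr_ge0//.
  by rewrite -!mulrA ler_wpM2l// mulrC ler_wpM2r.
have gx := acd_good_path xa.
have mA i j : @measurable_fun _ _ lebT R `[0, +oo[%classic (fun t => A t i j).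
  apply: (@caratheodory_measurable R m k _ (fun t x u => jac (fun y => f t y u) x)
    (fun M => M i j) x u (regular_jac_dyn reg).1) => //; first exact: coord_continuous.
  exact: gx.1.
have mb i j : @measurable_fun _ _ lebT R `[0, +oo[%classic (fun t => b t i j).
  apply: (@caratheodory_measurable R m k _ (fun t x u => grad (fun y => g t y u) x)
    (fun M => M i j) x u (regular_grad_cost reg).1) => //; first exact: coord_continuous.
  exact: gx.1.
have mG y : good_path y -> forall i j,
    @measurable_fun _ _ lebT R `[0, +oo[%classic (fun t => G t (y t) i j).
  move=> gy i j.
  rewrite (_ : (fun t => _) = (fun t => - (\sum_l y t i l * A t l j + lam * b t i j))); last first.
    by apply/funext => t; rewrite !mxE.
  apply: (@measurable_funN _ lebT R); apply: (@measurable_funD _ lebT R).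
    have my l : @measurable_fun _ _ lebT R `[0, +oo[%classic (fun t => y t i l * A t l j).
      by apply: (@measurable_funM _ lebT R); [exact: good_path_leb|exact: mA].
    exact: (@measurable_sum _ lebT R _ _ (index_enum _) (fun l t => y t i l * A t l j)).
  by apply: (@measurable_funM _ lebT R) => //; exact: measurable_cst.
have [psi [pa ps]] := picard_existence (weightZ C0 wL) GL mG c s0.
exists psi; split => //.
suff : acd psi (fun t => - hamiltonian_x f g (x t) t (u t) lam (psi t)) by [].
by apply: acd_ext pa => //; apply: aeW => t t0; rewrite adjoint_rhsE.
Qed.

Lemma payoff_integrable r u (x dx : R -> 'cV[R]_m) : control r u -> acd x dx ->
  locally_integrable_time (fun t => g t (x t) (u t)).
Proof.
move=> [mu ur] xa.
have [r1 xr1] := path_bounded xa.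
have [L [wL HL]] := dyn_weight reg (fun j => Num.max (r j) (r1 j)).
apply: (locally_integrable_dominated _ wL.1).
  apply: (@caratheodory_measurable R m k R g idfun x u (regular_cost reg).1) => //.
    by move=> z.
  exact: (acd_good_path xa).1.
apply: aeW => t t0.
have xr : `|x t| <= Num.max (r (Num.truncn t)) (r1 (Num.truncn t)).
  by rewrite le_max xr1// orbT.
by have [|_ []] := HL t (x t) (x t) (u t) t0 xr xr; rewrite ?le_max ?ur.
Qed.

End solutions.

(** * Capacitability and measurable selection *)

Section souslin.
Context (T : topologicalType).

(* The operation A, with schemes indexed by infinite sequences: [F n s] depends
   on the first [n] terms of [s] only. *)
Definition souslin (A : set T) := exists F : nat -> (nat -> nat) -> set T,
  [/\ forall n s, closed (F n s),
      forall n s s', (forall i, (i < n)%N -> s i = s' i) -> F n s = F n s'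
    & A = [set z | exists s, forall n, F n s z]].

Lemma souslin_closed (A : set T) : closed A -> souslin A.
Proof.
move=> cA; exists (fun _ _ => A); split => //.
by apply/seteqP; split=> [z Az|z [s /(_ 0%N)//]]; exists (fun=> 0%N).
Qed.

Lemma souslin_bigcup (A : nat -> set T) : (forall i, souslin (A i)) ->
  souslin (\bigcup_i A i).
Proof.
move=> /choice[F HF].
exists (fun n s => if n is n'.+1 then F (s 0%N) n' (fun i => s i.+1) else setT); split.
- move=> [|n] s; first exact: closedT.
  by have [+ _ _] := HF (s 0%N); apply.
- move=> [|n] s s' ss'//=; rewrite (ss' 0%N)//.
  by have [_ + _] := HF (s' 0%N); apply => i in_; rewrite ss'.
- apply/seteqP; split=> [z [i _]|z [s Hs]].
    have [_ _ ->] := HF i => -[s Hs].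
    by exists (fun n => if n is n'.+1 then s n' else i) => -[|n].
  exists (s 0%N) => //; have [_ _ ->] := HF (s 0%N).
  by exists (fun i => s i.+1) => n; have := Hs n.+1.
Qed.

(** One sequence codes a sequence of sequences through the pairing [pickle]; level [n] keeps the
    conditions that look only at indices below [n]. *)
Lemma souslin_bigcap (A : nat -> set T) : (forall i, souslin (A i)) ->
  souslin (\bigcap_i A i).
Proof.
move=> /choice[F HF].
exists (fun n s => \bigcap_(q in [set q : nat * nat |
    forall j, (j < q.2)%N -> (pickle (q.1, j) < n)%N])
  F q.1 q.2 (fun j => s (pickle (q.1, j)))); split.
- by move=> n s; apply: closed_bigI => -[i m] _; have [+ _ _] := HF i; apply.
- move=> n s s' ss'; apply: eq_bigcapr => -[i m] /= im.
  by have [_ + _] := HF i; apply => j /im; exact: ss'.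
- apply/seteqP; split=> [z Az|z [s Hs] i _].
    have /choice[s Hs] : forall i, exists s, forall n, F i n s z.
      by move=> i; have := Az i I; have [_ _ ->] := HF i.
    pose u p := if unpickle p is Some (i, j) then s i j else 0%N.
    exists u => n [i m] _ /=.
    rewrite (_ : (fun j => _) = s i); first exact: Hs.
    by apply/funext => j; rewrite /u pickleK.
  have [_ _ ->] := HF i; exists (fun j => s (pickle (i, j))) => m.
  apply: (Hs (\max_(j < m) pickle (i, nat_of_ord j)).+1 (i, m)) => j /= jm.
  by rewrite ltnS; exact: (leq_bigmax (Ordinal jm)).
Qed.

(** Souslin sets are closed under countable unions and intersections but not under complements, so
    the induction runs over the sets that are Souslin together with their complement. *)
Lemma souslin_borel : (forall O : set T, open O -> souslin O) ->
  <<s @open T >> `<=` souslin.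
Proof.
move=> so A; suff : <<s @open T >> `<=` [set A | souslin A /\ souslin (~` A)].
  by move=> /[apply] -[].
apply: smallest_sub; last first.
  by move=> O oO; split; [exact: so|apply: souslin_closed; exact: open_closedC].
split.
- by split; [exact/souslin_closed/closed0|rewrite setC0; exact/souslin_closed/closedT].
- by move=> B [sB sCB]; split; rewrite setTD ?setCK.
- move=> B sB; split; first by apply: souslin_bigcup => i; have [] := sB i.
  by rewrite setC_bigcup; apply: souslin_bigcap => i; have [] := sB i.
Qed.

End souslin.

(** An open set is the union over [n] of the closed sets of points at distance at least 1/(n+1) from
    its complement. *)
Lemma souslin_open (R : realType) (V : normedModType R) (O : set V) :
  open O -> souslin O.
Proof.
move=> oO.
rewrite (_ : O = \bigcup_n \bigcap_(w in ~` O) [set z | n.+1%:R^-1 <= `|z - w|]).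
  apply: souslin_bigcup => n; apply: souslin_closed; apply: closed_bigI => w _.
  apply: (@closed_comp _ _ (fun z : V => `|z - w|) [set t | n.+1%:R^-1 <= t]); last exact: closed_ge.
  by move=> z _; apply: cvg_norm; apply: cvgB; [exact: cvg_id|exact: cvg_cst].
apply/seteqP; split=> [z Oz|z [n _ H]].
  have /nbhs_ballP[e /= e0 eO] : nbhs z O by exact: open_nbhs_nbhs.
  have [n _ /(_ n (leqnn n)) ne] := near_infty_natSinv_lt (PosNum e0).
  exists n => // w Ow /=; rewrite leNgt; apply/negP => zw; apply: Ow.
  by apply: eO; rewrite -ball_normE /=; exact: lt_trans ne.
apply: contrapT => Oz; have := H z Oz; rewrite /= subrr normr0.
by rewrite leNgt invr_gt0 ltr0n.
Qed.

Lemma rcons_choice (P : seq nat -> Prop) : P [::] ->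
  (forall s, P s -> exists j, P (rcons s j)) ->
  exists b : nat -> nat, forall n, P (mkseq b n).
Proof.
move=> P0 PS; pose S := {s | P s}.
pose next (s : S) : S :=
  exist P _ (svalP (cid (PS (sval s) (svalP s)))).
pose s n := sval (iter n next (exist P [::] P0)).
have sS n : exists j, s n.+1 = rcons (s n) j.
  by rewrite /s /=; set t := iter _ _ _; exists (sval (cid (PS (sval t) (svalP t)))).
have ss n : size (s n) = n.
  by elim: n => // n ih; have [j ->] := sS n; rewrite size_rcons ih.
exists (fun i => nth 0%N (s i.+1) i) => n.
rewrite (_ : mkseq _ n = s n); first exact: svalP (iter n next _).
elim: n => // n ih; rewrite mkseqS ih.
by have [j sE] := sS n; rewrite sE nth_rcons ss ltnn eqxx.
Qed.

(** * Continuity of the outer measure, and Choquet's theorem *)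

Section capacity.
Context (R : realType).
Notation mu := (@lebesgue_measure R).
Local Open Scope ereal_scope.

Lemma outer_hull (A : set R) : exists H : set R,
  [/\ measurable H, A `<=` H & mu H <= mu A].
Proof.
have [Afin|] := boolP (mu A \is a fin_num); last first.
  rewrite ge0_fin_numE ?outer_measure_ge0// -leNgt leye_eq => /eqP ->.
  by exists setT; split => //; rewrite leey.
have cov n : exists H : set R, [/\ measurable H, A `<=` H & mu H <= mu A + n.+1%:R^-1%:E].
  have := lb_ereal_inf_adherent (_ : (0 < n.+1%:R^-1 :> R)%R) Afin.
  rewrite invr_gt0 ltr0n => /(_ isT)[_ [F [mF AF] <-] FA].
  have mF' j : measurable (F j : set R) by exact: sub_sigma_algebra.
  exists (\bigcup_j F j); split => //; first exact: bigcupT_measurable.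
  apply: le_trans (ltW FA).
  apply: (le_trans (outer_measure_sigma_subadditive _ _)).
  apply: lee_nneseries => // j _.
  by rewrite -(measurable_mu_extE (wlength (@idfun R)) (mF j)).
have /choice[H HH] := cov.
exists (\bigcap_n H n); split.
- by apply: bigcapT_measurable => n; have [] := HH n.
- by apply: sub_bigcap => n _; have [] := HH n.
- apply/lee_addgt0Pr => e e0.
  have [n _ /(_ n (leqnn n)) ne] := near_infty_natSinv_lt (PosNum e0).
  apply: (@le_trans _ _ (mu (H n))).
    by apply: le_outer_measure; exact: bigcap_inf.
  have [_ _ h] := HH n; apply: (le_trans h).
  by rewrite leeD2l// lee_fin ltW.
Qed.

(** Continuity from below without measurability, as needed for projections of Souslin sets. The
    measurable hulls [H i] need not increase, but the tail intersections [G n] do, and they still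
    contain [A n]. *)
Lemma outer_measure_bigcup_gt (A : nat -> set R) (c : \bar R) :
  (forall i j, (i <= j)%N -> A i `<=` A j) -> c < mu (\bigcup_i A i) ->
  exists i, c < mu (A i).
Proof.
move=> ndA cA; apply: contrapT => nA.
have Ac i : mu (A i) <= c.
  by rewrite leNgt; apply/negP => ci; apply: nA; exists i.
have /choice[H HH] := fun i => outer_hull (A i).
pose G n := \bigcap_(i in [set i | (n <= i)%N]) H i.
have mG n : measurable (G n) by apply: bigcap_measurable => [|i _]; [exists n => /=|have [] := HH i].
have Gc n : mu (G n) <= c.
  apply: (@le_trans _ _ (mu (H n))).
    by apply: le_outer_measure; apply: bigcap_inf => /=.
  by have [_ _ h] := HH n; exact: le_trans h (Ac n).
have ndG : nondecreasing_seq G.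
  move=> i j ij; apply/subsetPset => t Gt l /= jl; apply: Gt => /=; exact: leq_trans jl.
have mUG : measurable (\bigcup_n G n) by exact: bigcupT_measurable.
have cvgG := nondecreasing_cvg_mu (mu := mu) mG mUG ndG.
have : mu (\bigcup_n G n) <= c.
  rewrite -(cvg_lim _ cvgG)//; apply: lime_le; first by apply/cvg_ex; eexists; exact: cvgG.
  by apply: nearW => n; exact: Gc.
apply/negP; rewrite -ltNge; apply: (lt_le_trans cA).
apply: le_outer_measure => t [i _ Ait]; exists i => // l /= il.
by have [_ h _] := HH l; apply: h; exact: ndA Ait.
Qed.

End capacity.
Lemma compact_bigcap_nonempty (T : topologicalType) (B : set T)
    (K : nat -> set T) : compact B -> (forall n, closed (K n)) ->
  (forall n, K n `<=` B) -> (forall i j, (i <= j)%N -> K j `<=` K i) ->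
  (forall n, K n !=set0) -> \bigcap_n K n !=set0.
Proof.
move=> cB cK KB Kdec /choice[z Kz].
have [|w [Bw]] := cB (z n @[n --> \oo]) _.
  by exists 0%N => // n _; exact: KB (Kz n).
rewrite clusterE => cw; exists w => n _.
rewrite ((closure_id _).1 (cK n)); apply: cw.
by exists n => // m /= nm; exact: Kdec nm _ (Kz m).
Qed.

Section choquet.
Context (R : realType) (Z : topologicalType) (p : Z -> R).
Hypotheses (hZ : hausdorff_space Z) (cp : continuous p).
Notation mu := (@lebesgue_measure R).

Lemma compact_fiber_closed (t : R) : closed [set z | p z = t].
Proof. by apply: (@closed_comp _ _ p [set t]). Qed.

Lemma compact_image_R (K : set Z) : compact K -> compact (p @` K).
Proof. by apply: continuous_compact; exact: continuous_subspaceT. Qed.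

(* Capacitability of Souslin sets for the capacity A |-> mu^*(p A): a sequence
   [b] is chosen so that restricting the index sequence to s <= b does not bring
   the outer measure below [c]; the restricted sets are compact. *)
Lemma choquet (A B : set Z) (c : \bar R) : compact B -> A `<=` B -> souslin A ->
  (c < mu (p @` A))%E ->
  exists K : set Z, [/\ compact K, K `<=` A & (c <= mu (p @` K))%E].
Proof.
move=> cB AB [F [Fcl Floc AE]] cA.
(* The points having a witness whose first terms are bounded by those of [s]; for the empty sequence
   this is [A]. *)
pose W s := [set z | exists2 g : nat -> nat,
  (forall i, (i < size s)%N -> (g i <= nth 0 s i)%N) & forall n, F n g z].
have [| |b Wb] := @rcons_choice (fun s => (c < mu (p @` W s))%E).
- rewrite (_ : W [::] = A)//.
  by rewrite AE; apply/seteqP; split=> z [g]; [move=> _ ?|move=> ?]; exists g.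
- move=> s cs; apply: outer_measure_bigcup_gt => [i j ij|].
    apply: image_subset => z [g gs Fg]; exists g => // l; rewrite size_rcons => ls.
    have := gs l; rewrite size_rcons => /(_ ls); rewrite !nth_rcons.
    by case: ifP => // _; case: ifP => // _ /leq_trans; apply.
  rewrite (_ : \bigcup_i _ = p @` W s)//.
  rewrite -image_bigcup; congr (_ @` _); apply/seteqP; split=> [z [i _ [g gs Fg]]|z [g gs Fg]].
    exists g => // l ls; have := gs l; rewrite size_rcons => /(_ (ltnW ls)).
    by rewrite nth_rcons ls.
  exists (g (size s)) => //; exists g => // l; rewrite size_rcons ltnS leq_eqVlt nth_rcons.
  by move=> /predU1P[->|ls]; [rewrite ltnn eqxx|rewrite ls; exact: gs].
(* Codes the first [n] terms of a sequence bounded by [b] as a map between finite types; this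
   exhibits [K n] as a finite union of closed sets. *)
pose ext n (h : {ffun 'I_n -> 'I_(\max_(i < n) b i).+1}) i : nat :=
  if insub i is Some j then h j else 0%N.
pose K n := B `&` [set z | exists2 g : nat -> nat,
  (forall i, (i < n)%N -> (g i <= b i)%N) & forall m, (m <= n)%N -> F m g z].
have Kcl n : closed (K n).
  apply: closedI; first exact: compact_closed.
  rewrite (_ : [set z | _] = \bigcup_(h in [set h : {ffun 'I_n -> 'I_(\max_(i < n) b i).+1} |
      forall i, (h i <= b (nat_of_ord i))%N])
     \bigcap_(m in [set m | (m <= n)%N]) F m (@ext n h)).
    apply: closed_bigcup; first exact: finite_finset.
    by move=> h _; apply: closed_bigI => m _.
  apply/seteqP; split=> [z [g gb Fg]|z [h /= hb Fh]].
    have gM (i : 'I_n) : (g i < (\max_(i < n) b i).+1)%N.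
      by rewrite ltnS (leq_trans (gb _ (ltn_ord i)))//; exact: (leq_bigmax i).
    exists [ffun i => Ordinal (gM i)] => [i /=|m /= mn]; first by rewrite ffunE; exact: gb.
    rewrite (Floc m _ g); first exact: Fg.
    by move=> i im; rewrite /ext (insubT (fun i => (i < n)%N) (leq_trans im mn)) ffunE.
  exists (@ext n h) => [i im|m mn]; last exact: Fh.
  by rewrite /ext (insubT (fun i => (i < n)%N) im); exact: hb.
have Kdec i j : (i <= j)%N -> K j `<=` K i.
  move=> ij z [Bz [g gb Fg]]; split => //; exists g => [l li|m mi].
    by apply: gb; exact: leq_trans ij.
  by apply: Fg; exact: leq_trans ij.
have KB n : K n `<=` B by move=> z [].
have Kcp n : compact (K n) by apply: subclosed_compact (KB n).
exists (\bigcap_n K n); split.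
- by apply: (subclosed_compact _ cB); [exact: closed_bigI|move=> z /(_ 0%N I)[]].
- move=> z Kz.
  (* Koenig's lemma. A prefix is good if for every [N] it extends to a witness up to level [N]. Its
     next term is at most [b (size s)]; if none of these finitely many extensions were good, the
     largest of their failing levels would contradict the goodness of the prefix. *)
  have [| |t Qt] := @rcons_choice (fun s => forall N, exists g : nat -> nat,
    [/\ forall i, (i < N)%N -> (g i <= b i)%N,
        forall i, (i < size s)%N -> g i = nth 0%N s i
      & forall m, (m <= N)%N -> F m g z]).
  + by move=> N; have [_ [g gb Fg]] := Kz N I; exists g.
  + move=> s Qs; apply: contrapT => /forallNP nQ.
    have /choice[N NP] : forall j, exists N, ~ exists g : nat -> nat,
        [/\ forall i, (i < N)%N -> (g i <= b i)%N,
        forall i, (i < size (rcons s j))%N -> g i = nth 0%N (rcons s j) i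
      & forall m, (m <= N)%N -> F m g z] by move=> j; exact/existsNP/nQ.
    have [g [gb gs Fg]] := Qs (maxn (size s).+1 (\max_(j < (b (size s)).+1) N j)).
    have gbs : (g (size s) < (b (size s)).+1)%N by rewrite ltnS gb// leq_max ltnSn.
    have Nle : (N (g (size s)) <= maxn (size s).+1 (\max_(j < (b (size s)).+1) N j))%N.
      by rewrite leq_max (leq_bigmax (Ordinal gbs)) orbT.
    apply: (NP (g (size s))); exists g; split.
    * by move=> i iN; apply: gb; exact: leq_trans Nle.
    * move=> i; rewrite size_rcons ltnS leq_eqVlt nth_rcons => /predU1P[->|ls].
        by rewrite ltnn eqxx.
      by rewrite ls; exact: gs.
    * by move=> m mN; apply: Fg; exact: leq_trans Nle.
  rewrite AE; exists t => n; have [g [_ gt Fg]] := Qt n n.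
  rewrite (Floc n _ g); first exact: Fg.
  by move=> i ni; rewrite gt ?size_mkseq// nth_mkseq.
(* Projection commutes with this decreasing intersection by compactness: the fiber over [t] meets
   every [K n], hence their intersection. *)
- have pKE : p @` (\bigcap_n K n) = \bigcap_n (p @` K n).
    apply/seteqP; split=> [t [z Kz <-] n _|t Ht]; first by exists z => //; exact: Kz.
    have [||||z Hz] := @compact_bigcap_nonempty _ B (fun n => K n `&` [set z | p z = t]) cB.
    + by move=> n; apply: closedI => //; exact: compact_fiber_closed.
    + by move=> n z [/KB].
    + by move=> i j ij z [/(Kdec i j ij)].
    + by move=> n; have [z Kz zt] := Ht n I; exists z.
    exists z => [n _|]; first by have [] := Hz n I.
    by have [] := Hz 0%N I.
  have mK n : measurable (p @` K n : set R).
    by apply: compact_measurable; exact: compact_image_R.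
  have := @nonincreasing_cvg_mu _ _ R mu (fun n => p @` K n).
  move=> /(_ (compact_finite_measure (compact_image_R (Kcp 0%N))) mK).
  have mKn : measurable (\bigcap_n (p @` K n) : set R) by exact: bigcapT_measurable.
  have ndK : {homo (fun n => p @` K n) : i j / (i <= j)%N >-> (j <= i)%O}.
    by move=> i j ij; apply/subsetPset; apply: image_subset; exact: Kdec.
  move=> /(_ mKn ndK) cvgK; rewrite pKE -(cvg_lim _ cvgK)//.
  apply: lime_ge; first by apply/cvg_ex; eexists; exact: cvgK.
  apply: nearW => n; apply: (le_trans (ltW (Wb n))).
  apply: le_outer_measure; apply: image_subset => z [g gb Fg].
  split; first by apply: AB; rewrite AE; exists g.
  exists g => // i ni; have := gb i; rewrite size_mkseq => /(_ ni).
  by rewrite nth_mkseq.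
Qed.

Lemma choquet_pos (A B : set Z) : compact B -> A `<=` B -> souslin A ->
  (0 < mu (p @` A))%E ->
  exists K : set Z, [/\ compact K, K `<=` A & (0 < mu (p @` K))%E].
Proof.
move=> cB AB sA A0.
have [c c0 cA] : exists2 c : R, 0 < c & (c%:E < mu (p @` A))%E.
  move: A0; case: (mu _) => [r|_|//]; last by exists 1 => //; rewrite ltry.
  by rewrite lte_fin => r0; exists (r / 2); [lra|rewrite lte_fin; lra].
have [K [cK KA cmu]] := choquet cB AB sA cA.
by exists K; split => //; apply: lt_le_trans cmu; rewrite lte_fin.
Qed.

End choquet.

(** * Uniformization and measurable selection *)

Section selection.
Context (R : realType) (k : nat).
Notation Z := (R * 'rV[R]_k)%type.
Notation mu := (@lebesgue_measure R).

Lemma coord_continuous_snd (j : 'I_k) : continuous (fun z : Z => z.2 0 j).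
Proof. by move=> z; apply: (@cvg_comp _ _ _ snd (fun v : 'rV[R]_k => v 0 j)); [exact: cvg_snd|exact: coord_continuous]. Qed.

Lemma fst_continuous : continuous (fst : Z -> R).
Proof. by move=> z; exact: cvg_fst. Qed.

Lemma Zhausdorff : hausdorff_space Z.
Proof. exact: norm_hausdorff. Qed.

(* Minimizing one coordinate over the fibers of a compact set leaves a Souslin
   set with the same projection. *)
Lemma compact_uniformize_coord (j : 'I_k) (K : set Z) : compact K ->
  (0 < mu (fst @` K))%E -> exists K' : set Z, [/\ compact K', K' `<=` K,
    (0 < mu (fst @` K'))%E
    & forall z w, K' z -> K' w -> z.1 = w.1 -> z.2 0 j = w.2 0 j].
Proof.
move=> cK K0.
have ccl : closed K by apply: compact_closed => //; exact: Zhausdorff.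
have cj := @coord_continuous_snd j.
have lecl (q : R) : closed [set z : Z | z.2 0 j <= q].
  by apply: (@closed_comp _ _ (fun z : Z => z.2 0 j) [set s | s <= q]) => //; exact: closed_le.
pose low (q : rat) := K `&` [set z : Z | z.2 0 j <= ratr q].
have lowc q : compact (low q).
  by apply: (subclosed_compact _ cK); [exact: closedI|move=> z []].
(* A point of [K] minimizes coordinate [j] over its fiber exactly when, for every rational [q], its
   coordinate is at most [q] or no point of the fiber has coordinate at most [q]. The first
   condition is closed, the second open. *)
pose S q := K `&` ([set z : Z | z.2 0 j <= ratr q] `|` [set z | ~ (fst @` low q) z.1]).
have SS q : souslin (S q).
  rewrite (_ : S q = \bigcap_n (if n is 0%N then K else
      \bigcup_i (if i is 0%N then [set z : Z | z.2 0 j <= ratr q]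
                 else [set z | ~ (fst @` low q) z.1]))).
    apply: souslin_bigcap => -[|_]; first exact: souslin_closed.
    apply: souslin_bigcup => -[|_]; first exact: souslin_closed.
    apply: souslin_open.
    apply: (@open_comp _ _ fst (~` (fst @` low q))) => [z _|]; first exact: fst_continuous.
    apply: closed_openC; apply: compact_closed; first exact: Rhausdorff.
    exact: compact_image_R fst_continuous _ (lowc q).
  apply/seteqP; split=> [z [Kz h] [|_] _ //|z h].
    by case: h => h; [exists 0%N|exists 1%N].
  split; first exact: (h 0%N I).
  by have [[|i] _ hi] := h 1%N I; [left|right].
pose A := \bigcap_n (if unpickle n is Some q then S q else K).
have AK : A `<=` K by move=> z /(_ (pickle (0 : rat)) I); rewrite pickleK => -[].
have sA : souslin A.
  by apply: souslin_bigcap => n; case: unpickle => [q|]; [exact: SS|exact: souslin_closed].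
have Amin z w : A z -> K w -> z.1 = w.1 -> z.2 0 j <= w.2 0 j.
  move=> Az Kw zw; rewrite leNgt; apply/negP => wz.
  have [q] := rat_in_itvoo wz; rewrite in_itv/= => /andP[wq qz].
  have := Az (pickle q) I; rewrite pickleK => -[_ [/=|]]; first by rewrite leNgt qz.
  by apply; exists w => //; split => //=; exact: ltW.
have fstA : fst @` A = fst @` K.
  apply/seteqP; split=> [|_ [z Kz <-]]; first exact: image_subset.
  have [||| w] := @compact_EVT_min _ R (fun w : Z => w.2 0 j) (K `&` [set w | w.1 = z.1]).
  - by exists z.
  - apply: (subclosed_compact _ cK); last by move=> w [].
    by apply: closedI => //; exact: (compact_fiber_closed fst_continuous).
  - exact: continuous_subspaceT.
  rewrite inE => -[Kw wz] wmin; exists w => // n _.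
  case: unpickle => [q|] //; split => //.
  have [wq|qw] := leP (w.2 0 j) (ratr q); [by left|right => -[v [Kv vq] vw]].
  have := wmin v; rewrite inE => /(_ (conj Kv (etrans vw wz))).
  by rewrite leNgt (le_lt_trans vq qw).
have A0 : (0 < mu (fst @` A))%E by rewrite fstA.
have [K' [cK' K'A K'0]] := choquet_pos Zhausdorff fst_continuous cK AK sA A0.
exists K'; split => //; first exact: subset_trans AK.
move=> z w /K'A Az /K'A Aw zw; apply/eqP; rewrite eq_le.
by rewrite !Amin//; exact: AK.
Qed.

Lemma compact_uniformize (K : set Z) : compact K ->
  (0 < mu (fst @` K))%E -> exists K' : set Z, [/\ compact K', K' `<=` K,
    (0 < mu (fst @` K'))%E
    & forall z w, K' z -> K' w -> z.1 = w.1 -> z.2 = w.2].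
Proof.
move=> cK K0.
suff [K' [? ? ? K'u]] : exists K' : set Z, [/\ compact K', K' `<=` K,
    (0 < mu (fst @` K'))%E
    & forall j, j \in enum 'I_k ->
        forall z w, K' z -> K' w -> z.1 = w.1 -> z.2 0 j = w.2 0 j].
  exists K'; split => // z w Kz Kw zw; apply/rowP => j.
  by apply: K'u => //; rewrite mem_enum.
elim: (enum 'I_k) => [|j s [K1 [cK1 K1K K10 K1u]]].
  by exists K; split => // j; rewrite in_nil.
have [K2 [cK2 K21 K20 K2u]] := compact_uniformize_coord j cK1 K10.
exists K2; split => //; first exact: subset_trans K1K.
move=> i; rewrite inE => /predU1P[->//|/K1u{}K1u] z w /K21 Kz /K21 Kw.
exact: K1u.
Qed.

Lemma compact_norm_le_pair (r : R) : compact [set z : Z | `|z| <= r].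
Proof.
pose h (q : 'cV[R]_1 * 'rV[R]_k) : Z := (q.1 0 0, q.2).
have hc : continuous h.
  move=> q; have c1 : (fun q : 'cV[R]_1 * 'rV[R]_k => q.1 0 0) @ q --> q.1 0 0.
    by apply: (@cvg_comp _ _ _ fst (fun v : 'cV[R]_1 => v 0 0)); [exact: cvg_fst|exact: coord_continuous].
  have c2 : (fun q : 'cV[R]_1 * 'rV[R]_k => q.2) @ q --> q.2 by exact: cvg_snd.
  exact: cvg_pair c1 c2.
apply: (subclosed_compact _ (continuous_compact (continuous_subspaceT hc)
  (@compact_bounded_pair R 1 k r))).
  apply: (@closed_comp _ _ (fun z : Z => `|z|) [set t | t <= r]); last exact: closed_le.
  by move=> z _; exact: norm_continuous.
move=> [t v]; rewrite /= prod_normE ge_max /= => /andP[tr vr].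
exists (const_mx t, v); last by rewrite /h mxE.
split => //=; apply: mx_norm_le => [|i j]; last by rewrite mxE.
exact: le_trans (normr_ge0 t) tr.
Qed.

Lemma measurable_selection (E : set Z) (r : R) :
  <<s @open Z >> E -> (forall z, E z -> `|z| <= r) -> (0 < mu (fst @` E))%E ->
  exists (P : set R) (v : R -> 'rV[R]_k),
    [/\ measurable P, (0 < mu P)%E, forall t, P t -> E (t, v t) &
      @measurable_fun _ _ (measurableTypeR R)
        (g_sigma_algebraType (@open 'rV[R]_k)) P v].
Proof.
move=> sE Er E0.
have [K [cK KE K0]] := choquet_pos Zhausdorff fst_continuous (@compact_norm_le_pair r) Er
  (souslin_borel (@souslin_open R Z) sE) E0.
have [K' [cK' K'K K'0 K'u]] := compact_uniformize cK K0.
have mfst (C : set Z) : compact C -> measurable (fst @` C : set R).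
  by move=> cC; apply: compact_measurable; exact: compact_image_R fst_continuous _ cC.
pose v t := xget 0 [set p | K' (t, p)].
have K'v t : (fst @` K') t -> K' (t, v t).
  by move=> [[t' p] Kp /= <-]; rewrite /v; case: xgetP => [q -> //|/(_ p)].
exists (fst @` K'), v; split=> //; first exact: mfst.
  by move=> t /K'v /K'K /KE.
apply: (@measurability _ _ _ (g_sigma_algebraType (@open 'rV[R]_k)) (fst @` K') v (@open 'rV[R]_k)) => //.
move=> A' -[G oG <-].
(* The fibers of [K'] are single points, so the times at which [v] avoids [G] form the projection of
   a compact set. *)
have cC : compact (K' `&` [set z | (~` G) z.2]).
  apply: (subclosed_compact _ cK'); last by move=> z [].
  apply: closedI; first by apply: compact_closed => //; exact: Zhausdorff.
  apply: (@closed_comp _ _ snd (~` G)); last exact: open_closedC.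
  by move=> z _; exact: cvg_snd.
rewrite (_ : _ `&` _ = fst @` K' `\` fst @` (K' `&` [set z | (~` G) z.2])).
  by apply: measurableD; exact: mfst.
apply/seteqP; split=> [t [Kt Gt]|t [Kt nt]]; split => //.
  move=> [z [Kz Gz] zt]; apply: Gz.
  by rewrite (_ : z.2 = v t)//; apply: (K'u z (t, v t)) => //; exact: K'v.
by apply: contrapT => nG; apply: nt; exists (t, v t) => //; split => //; exact: K'v.
Qed.

End selection.

(** * Perturbed controls *)

Section indicator.
Context (R : realType).
Notation mu := (@lebesgue_measure R).
Notation lebT := (caratheodory_type (wlength (@idfun R))^*%mu).

Lemma weight_indic (A : set R) : measurable A -> weight (\1_A : R -> R).
Proof.
move=> mA; split; last by move=> t _; rewrite indicE.
apply: (locally_integrable_dominated _ (@locally_integrable_cst R 1)).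
  apply: leb_measurable_fun; first exact: measurable_itv.
  exact: measurable_indic.
by apply: aeW => t _; rewrite indicE; case: (_ \in _); rewrite ?normr1 ?normr0.
Qed.

Lemma prim_indicI (A : set R) (T : R) : measurable A ->
  0 <= T -> prim (\1_A : R -> R) T = fine (mu (A `&` `[0, T])).
Proof.
move=> mA T0.
have mI : measurable_fun (setT : set R) (\1_A : R -> R) by exact: measurable_indic.
rewrite /prim; have [_ <-] := leb_mu_integrable (measurable_itv `[0, T]) mI ((weight_indic mA).1 T T0).
by rewrite /Rintegral (@integral_indic _ _ R mu `[0, T]%classic (measurable_itv _) A mA).
Qed.

Lemma prim_indic (A : set R) (T : R) : measurable A -> A `<=` `[0, T] ->
  0 <= T -> prim (\1_A : R -> R) T = fine (mu A).
Proof. by move=> mA AT T0; rewrite prim_indicI// setIidl. Qed.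

(** [P] is cut at a time [s]: the measure of [P] up to [s] is a primitive, hence continuous in [s],
    and takes the value [d]. *)
Lemma measure_slice (P : set R) (T d : R) : measurable P -> P `<=` `[0, T] ->
  0 <= T -> 0 <= d <= fine (mu P) ->
  exists Z : set R, [/\ measurable Z, Z `<=` P & fine (mu Z) = d].
Proof.
move=> mP PT T0 dP; have wI := weight_indic mP.
have [yac _] := acd_prim wI.1.
have [|s + sd] := @IVT R (prim (\1_P : R -> R)) 0 T d T0 (ac_within_continuous (yac T T0)).
  by rewrite (prim0 wI.1) prim_indic// min_l ?max_r// fine_ge0.
rewrite in_itv/= => /andP[s0 _].
exists (P `&` `[0, s]); split; first by apply: measurableI => //; exact: measurable_itv.
  by move=> t [].
by rewrite -prim_indicI.
Qed.

Lemma primZ (h : R -> R) (c t : R) : locally_integrable_time h -> 0 <= t ->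
  prim (fun s => c * h s) t = c * prim h t.
Proof.
move=> hi t0; apply: (prim_unique (locally_integrableZ c hi) (acdZ c (acd_prim hi))) => //.
  exact: aeW.
by rewrite /= (prim0 hi) scaler0.
Qed.

Lemma primD (h h' : R -> R) (t : R) : locally_integrable_time h ->
  locally_integrable_time h' -> 0 <= t ->
  prim (fun s => h s + h' s) t = prim h t + prim h' t.
Proof.
move=> hi hi' t0.
apply: (prim_unique (locally_integrableD hi hi') (acdD (acd_prim hi) (acd_prim hi'))) => //.
  exact: aeW.
by rewrite (prim0 hi) (prim0 hi') addr0.
Qed.

End indicator.

Section perturbation.
Context (R : realType) (m k : nat).
Variables (f : R -> 'cV[R]_m -> 'rV[R]_k -> 'cV[R]_m)
          (g : R -> 'cV[R]_m -> 'rV[R]_k -> R).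
Hypothesis reg : regularity f g.
Notation mu := (@lebesgue_measure R).

Implicit Types (u v : R -> 'rV[R]_k) (x : R -> 'cV[R]_m) (p : R -> 'rV[R]_m).

Lemma adjoint_acd x u lam p : adjoint f g x u lam p ->
  acd p (fun t => - (p t *m jac (fun y => f t y (u t)) (x t) +
                     lam *: grad (fun y => g t y (u t)) (x t))).
Proof.
move=> pa; apply: (@acd_ext _ _ p p (fun t => - hamiltonian_x f g (x t) t (u t) lam (p t))) => //.
by apply: aeW => t t0; rewrite (adjoint_rhsE reg).
Qed.

Lemma acd_adjoint x u lam p :
  acd p (fun t => - (p t *m jac (fun y => f t y (u t)) (x t) +
                     lam *: grad (fun y => g t y (u t)) (x t))) ->
  adjoint f g x u lam p.
Proof.
move=> pa; suff : acd p (fun t => - hamiltonian_x f g (x t) t (u t) lam (p t)) by [].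
apply: acd_ext pa => //.
by apply: aeW => t t0; rewrite (adjoint_rhsE reg).
Qed.

Lemma adjointZ c x u lam p : adjoint f g x u lam p ->
  adjoint f g x u (c * lam) (fun t => c *: p t).
Proof.
move=> /adjoint_acd /(acdZ c) H; apply: acd_adjoint; apply: acd_ext H => //.
by apply: aeW => t _; rewrite scalerN scalerDr scalemxAl scalerA.
Qed.

Section bounds.
Variables (r : nat -> R) (L : R -> R) (N : R).
Hypotheses (bL : dyn_bound f g r L) (N0 : 0 <= N).

Section switched.
Variables (A : set R) (B : R) (u u' : R -> 'rV[R]_k) (x x' : R -> 'cV[R]_m).
Hypotheses (mA : measurable A) (AN : A `<=` `[0, N]) (LB : forall t, A t -> L t <= B).
Hypotheses (ur : within_radius r u) (ur' : within_radius r u').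
Hypothesis uu' : forall t : R, 0 <= t -> ~ A t -> u' t = u t.
Hypotheses (xr : within_radius r x) (xr' : within_radius r x').

Let a (t : R) : 0 <= t -> A t -> \1_A t = 1 :> R.
Proof. by move=> _ At; rewrite indicE mem_set. Qed.

Let na t : ~ A t -> \1_A t = 0 :> R.
Proof. by move=> At; rewrite indicE memNset. Qed.

(** Off [A] the controls agree and only the states differ; on [A] both terms are simply bounded by
    [B]. Applied to the dynamics and to both derivatives. *)
Lemma switched_bound (W : normedModType R) (h : R -> 'cV[R]_m -> 'rV[R]_k -> W) t :
  (forall (y z : 'cV[R]_m) (v : 'rV[R]_k), `|y| <= r (Num.truncn t) -> `|z| <= r (Num.truncn t) ->
     `|v| <= r (Num.truncn t) ->
     `|h t y v - h t z v| <= L t * `|y - z| /\ `|h t y v| <= L t) ->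
  0 <= t ->
  `|h t (x' t) (u' t) - h t (x t) (u t)| <= L t * `|x' t - x t| + 2 * B * \1_A t.
Proof.
move=> hL t0; have [At|At] := pselect (A t); last first.
  rewrite na// mulr0 addr0 uu'//; apply: (hL _ _ _ _ _ _).1; [exact: xr'|exact: xr|exact: ur].
rewrite a// mulr1; apply: (le_trans (ler_normB _ _)).
have h1 := (hL _ _ _ (xr' t0) (xr' t0) (ur' t0)).2.
have h2 := (hL _ _ _ (xr t0) (xr t0) (ur t0)).2.
have := LB At; have : 0 <= L t * `|x' t - x t| by rewrite mulr_ge0// bL.1.2.
lra.
Qed.

(** [s] is 0 when two controls are compared from a common initial state, and [N] when their
    trajectories are joined at [N] and compared backwards. *)
Lemma state_close (s t : R) : flow f u x -> flow f u' x' -> 0 <= B ->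
  0 <= s <= N -> 0 <= t <= N ->
  `|x' t - x t| <= 2 * (`|x' s - x s| + 2 * B * fine (mu A)) * expR (2 * prim L N).
Proof.
move=> fx fx' B0 sN tN.
have wI := weightZ (mulr_ge0 (ler0n R 2) B0) (weight_indic mA).
have xa := acdB (fx' : acd x' (fun t => f t (x' t) (u' t))) (fx : acd x (fun t => f t (x t) (u t))).
apply: (le_trans (@gronwall R m 1 L _ 0 N s t _ _ bL.1 wI xa (lexx 0) sN tN _)).
  apply: aeW => q /andP[q0 _]; apply: (@switched_bound _ f) => // y z v yr zr vr.
  by have [[? _ _ _] [? _ _ _]] := bL.2 _ _ _ _ q0 yr zr vr.
rewrite (prim0 wI.1) subr0 (primZ _ (weight_indic mA).1 N0) prim_indic//.
apply: ler_pM => //; last exact: growth_le bL.1 sN tN.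
  by rewrite mulr_ge0// addr_ge0// mulr_ge0 ?fine_ge0// mulr_ge0.
exact/ltW/growth_gt0.
Qed.

Lemma adjoint_close (eta Q lam lam' : R) p p' (s t : R) :
  adjoint f g x u lam p -> adjoint f g x' u' lam' p' -> 0 <= B -> 0 <= eta -> 0 <= Q ->
  (forall t, 0 <= t <= N -> `|x' t - x t| <= eta) ->
  (forall t, 0 <= t <= N -> `|p' t| <= Q) -> `|lam'| <= Q ->
  0 <= s <= N -> 0 <= t <= N ->
  `|p t - p' t| <= 2 * (`|p s - p' s| +
     (m.+1%:R * Q * (eta * prim L N + 2 * B * fine (mu A)) + `|lam - lam'| * prim L N))
    * expR (2 * prim (fun t => m%:R * L t) N).
Proof.
move=> pa pa' B0 eta0 Q0 xeta pQ lQ sN tN.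
have wI := weight_indic mA; have wL := bL.1.
pose c1 := m.+1%:R * Q * eta + `|lam - lam'|; pose c2 := m.+1%:R * Q * (2 * B).
have mQ : 0 <= m.+1%:R * Q by rewrite mulr_ge0.
have c10 : 0 <= c1 by rewrite addr_ge0// mulr_ge0.
have c20 : 0 <= c2 by rewrite mulr_ge0// mulr_ge0.
have we := weightD (weightZ c10 wL) (weightZ c20 wI).
have wm := weightZ (ler0n R m) wL.
have qa := acdB (adjoint_acd pa) (adjoint_acd pa').
apply: (le_trans (@gronwall R 1 m _ _ 0 N s t _ _ wm we qa (lexx 0) sN tN _)); last first.
  rewrite (prim0 we.1) subr0 (primD (weightZ c10 wL).1 (weightZ c20 wI).1 N0).
  rewrite (primZ _ wL.1 N0) (primZ _ wI.1 N0) prim_indic//.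
  rewrite (_ : c1 * _ + _ = m.+1%:R * Q * (eta * prim L N + 2 * B * fine (mu A)) +
    `|lam - lam'| * prim L N); last by rewrite /c1 /c2; ring.
  have P0 : 0 <= prim L N by rewrite -(prim0 wL.1); exact: prim_mono.
  apply: ler_pM => //; last exact: growth_le wm sN tN.
    have S0 : 0 <= eta * prim L N + 2 * B * fine (mu A).
      by apply: addr_ge0; [exact: mulr_ge0|apply: mulr_ge0; [exact: mulr_ge0|exact: fine_ge0]].
    apply: mulr_ge0 => //; apply: addr_ge0 => //; apply: addr_ge0; exact: mulr_ge0.
  exact/ltW/growth_gt0.
apply: aeW; move=> q qN; have q0 : 0 <= q by case/andP: qN.
set F := jac _ _; set b := grad _ _; set F' := jac _ _; set b' := grad _ _.
have xq := xeta q qN; have L0 := wL.2 q q0.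
have FF : `|F' - F| <= L q * eta + 2 * B * \1_A q.
  apply: (@le_trans _ _ (L q * `|x' q - x q| + 2 * B * \1_A q)); last by rewrite lerD2r ler_wpM2l.
  apply: (@switched_bound _ (fun t y w => jac (fun z => f t z w) y)) => // y z v yr zr vr.
  by have [[_ _ H1 _] [_ _ H2 _]] := bL.2 q y z v q0 yr zr vr; split.
have bb : `|b' - b| <= L q * eta + 2 * B * \1_A q.
  apply: (@le_trans _ _ (L q * `|x' q - x q| + 2 * B * \1_A q)); last by rewrite lerD2r ler_wpM2l.
  apply: (@switched_bound _ (fun t y w => grad (fun z => g t z w) y)) => // y z v yr zr vr.
  by have [[_ _ _ H1] [_ _ _ H2]] := bL.2 q y z v q0 yr zr vr; split.
have [_ [_ _ FL bL']] := bL.2 _ _ _ _ q0 (xr q0) (xr q0) (ur q0).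
(* Coefficient differences are paired with [p'] and [lam'], the remaining terms with the difference
   of the multipliers. Thus [Q] has to bound only one of the two pairs. *)
rewrite (_ : - _ - - _ = p' q *m (F' - F) + lam' *: (b' - b) -
    ((p q - p' q) *m F + (lam - lam') *: b)); last first.
  rewrite mulmxBr mulmxBl scalerBr scalerBl.
  move: (p q *m F) (p' q *m F) (p' q *m F') (lam *: b) (lam' *: b) (lam' *: b').
  by move=> *; apply/rowP => j; rewrite !mxE; ring.
apply: (le_trans (ler_normB _ _)).
apply: (le_trans (lerD (ler_normD _ _) (ler_normD _ _))).
rewrite !normrZ.
have E0 : 0 <= L q * eta + 2 * B * \1_A q by apply: le_trans FF; exact: normr_ge0.
have t1 : `|p' q *m (F' - F)| <= m%:R * Q * (L q * eta + 2 * B * \1_A q).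
  apply: (le_trans (mulmx_norm _ _)); apply: ler_pM => //.
  by rewrite ler_wpM2l// pQ.
have t2 : `|lam'| * `|b' - b| <= Q * (L q * eta + 2 * B * \1_A q) by exact: ler_pM.
have t3 : `|(p q - p' q) *m F| <= m%:R * L q * `|p q - p' q|.
  apply: (le_trans (mulmx_norm _ _)); rewrite mulrAC.
  by rewrite ler_wpM2r// ler_wpM2l.
have t4 : `|lam - lam'| * `|b| <= `|lam - lam'| * L q by rewrite ler_wpM2l.
apply: (le_trans (lerD (lerD t1 t2) (lerD t3 t4))).
rewrite /c1 /c2 -natr1; move: (L q) (\1_A q) => l i; lra.
Qed.

End switched.

Lemma adjoint_bound u x lam p (s t : R) :
  within_radius r u -> within_radius r x -> adjoint f g x u lam p ->
  0 <= s <= N -> 0 <= t <= N ->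
  `|p t| <= 2 * (`|p s| + `|lam| * prim L N) *
    expR (2 * prim (fun t => m%:R * L t) N).
Proof.
move=> ur xr pa sN tN; have wL := bL.1.
have we := weightZ (normr_ge0 lam) wL.
have wm := weightZ (ler0n R m) wL.
apply: (le_trans (@gronwall R 1 m _ _ 0 N s t _ _ wm we (adjoint_acd pa) (lexx 0) sN tN _)).
  apply: aeW => q /andP[q0 _].
  have [_ [_ _ FL bL']] := bL.2 _ _ _ _ q0 (xr q q0) (xr q q0) (ur q q0).
  rewrite normrN; apply: (le_trans (ler_normD _ _)).
  rewrite normrZ; apply: lerD; last by rewrite ler_wpM2l.
  apply: (le_trans (mulmx_norm _ _)); rewrite mulrAC.
  by rewrite ler_wpM2r// ler_wpM2l.
rewrite (prim0 we.1) subr0 (primZ _ wL.1 N0).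
have P0 : 0 <= prim L N by rewrite -(prim0 wL.1); exact: prim_mono.
apply: ler_pM => //; last exact: growth_le wm sN tN.
  by rewrite mulr_ge0// addr_ge0// mulr_ge0.
exact/ltW/growth_gt0.
Qed.

Lemma hamiltonian_close (t B Q lam lam' : R) (x x' : 'cV[R]_m) (v : 'rV[R]_k)
    (p p' : 'rV[R]_m) :
  0 <= t -> `|x| <= r (Num.truncn t) -> `|x'| <= r (Num.truncn t) ->
  `|v| <= r (Num.truncn t) -> L t <= B -> `|p'| <= Q -> `|lam'| <= Q ->
  `|hamiltonian f g x t v lam p - hamiltonian f g x' t v lam' p'| <=
    B * (m%:R * `|p - p'| + `|lam - lam'| + m.+1%:R * Q * `|x - x'|).
Proof.
move=> t0 xr xr' vr LB pQ lQ.
have [[f1 g1 _ _] [f2 g2 _ _]] := bL.2 _ _ _ _ t0 xr xr' vr.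
have L0 := bL.1.2 t t0; have B0 : 0 <= B by exact: le_trans LB.
have Q0 : 0 <= Q by exact: le_trans pQ.
rewrite /hamiltonian.
rewrite (_ : _ - _ = ((p - p') *m f t x v + p' *m (f t x v - f t x' v)) 0 0 +
   ((lam - lam') * g t x v + lam' * (g t x v - g t x' v))); last first.
  by rewrite mulmxBl mulmxBr !mxE; ring.
have t1 : `|((p - p') *m f t x v) 0 0| <= m%:R * `|p - p'| * B.
  apply: (le_trans (mx_entry_norm _ _ _)); apply: (le_trans (mulmx_norm _ _)).
  by apply: ler_wpM2l; [rewrite mulr_ge0|exact: le_trans LB].
have t2 : `|(p' *m (f t x v - f t x' v)) 0 0| <= m%:R * Q * (B * `|x - x'|).
  apply: (le_trans (mx_entry_norm _ _ _)); apply: (le_trans (mulmx_norm _ _)).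
  apply: ler_pM => //; first by rewrite ler_wpM2l.
  by apply: (le_trans f1); rewrite ler_wpM2r.
have t3 : `|(lam - lam') * g t x v| <= `|lam - lam'| * B.
  by rewrite normrM ler_wpM2l//; exact: le_trans LB.
have t4 : `|lam' * (g t x v - g t x' v)| <= Q * (B * `|x - x'|).
  rewrite normrM; apply: ler_pM => //.
  by apply: (le_trans g1); rewrite ler_wpM2r.
apply: (le_trans (ler_normD _ _)).
rewrite mxE; apply: (le_trans (lerD (ler_normD _ _) (ler_normD _ _))).
apply: (le_trans (lerD (lerD t1 t2) (lerD t3 t4))).
by rewrite -natr1; lra.
Qed.
End bounds.

(** [rho] precedes the control, so the trajectories of all switched controls share one radius and
    one weight [L]. *)
Lemma flow_radius (r : nat -> R) (s C : R) : 0 <= s -> exists rho : nat -> R,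
  (forall j, r j <= rho j) /\ forall u y, within_radius r u -> flow f u y ->
    `|y s| <= C -> within_radius rho y.
Proof.
move=> s0; have [l [wl fl]] := growth_weight r (growth_dyn reg).
have [rho rhoP] := apriori_bound C wl s0.
exists (fun j => Num.max (r j) (rho j)); split=> [j|u y ur fy ys t t0].
  by rewrite le_max lexx.
rewrite le_max; apply/orP; right.
apply: (rhoP m y (fun t => f t (y t) (u t))) => //.
by apply: aeW => q q0; exact: fl (ur q q0).
Qed.

Lemma flow_continuous r u x (s N e : R) : control r u -> flow f u x ->
  0 <= s <= N -> 0 < e ->
  exists2 d, 0 < d & forall y, flow f u y -> `|y s - x s| < d ->
    forall t, 0 <= t <= N -> `|y t - x t| < e.
Proof.
move=> [_ ur] fx /[dup] sN /andP[s0 sN'] e0.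
have N0 : 0 <= N by exact: le_trans sN'.
have [rho [rrho rhoP]] := @flow_radius r s (`|x s| + 1) s0.
have [L bL] := dyn_weight reg rho.
have urho : within_radius rho u by move=> t t0; exact: le_trans (ur t t0) _.
pose G := expR (2 * prim L N); have G0 : 0 < G by exact: expR_gt0.
exists (Num.min 1 (e / (4 * G))); first by rewrite lt_min ltr01 divr_gt0// mulr_gt0.
move=> y fy; rewrite lt_min => /andP[y1 ye] t tN.
have ys : `|y s| <= `|x s| + 1.
  by rewrite -lerBlDl; apply: (le_trans (lerB_dist _ _)); exact: ltW.
have := @state_close rho L N bL N0 set0 0 u u x y measurable0 _ _ urho urho _
  (rhoP u x ur fx _) (rhoP u y ur fy ys) s t fx fy (lexx 0) sN tN.
rewrite measure0 /= !mulr0 addr0 => H.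
apply: (le_lt_trans (H _ _ _ _)) => //; first by rewrite lerDl.
rewrite -/G; have := ye; rewrite ltr_pdivlMr ?mulr_gt0//; lra.
Qed.

Lemma adjoint_continuous r u x lam psi (N e : R) : control r u -> flow f u x ->
  adjoint f g x u lam psi -> 0 <= N -> 0 < e ->
  exists2 d, 0 < d & forall y lam' p, flow f u y -> adjoint f g y u lam' p ->
    `|y 0 - x 0| < d -> `|lam' - lam| < d -> `|p 0 - psi 0| < d ->
    forall t, 0 <= t <= N -> `|p t - psi t| < e.
Proof.
move=> ru fx pa N0 e0; have [_ ur] := ru.
have [rho [rrho rhoP]] := @flow_radius r 0 (`|x 0| + 1) (lexx 0).
have [L bL] := dyn_weight reg rho.
have urho : within_radius rho u by move=> t t0; exact: le_trans (ur t t0) _.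
have P0 : 0 <= prim L N by rewrite -(prim0 bL.1.1); exact: (prim_mono bL.1).
set P := prim L N in P0.
set G := expR (2 * prim (fun t => m%:R * L t) N).
have G0 : 0 < G by exact: expR_gt0.
have [Q0 Q00 Q0P] := acd_bounded N0 (adjoint_acd pa).
pose Q := Num.max Q0 `|lam|.
have Qge : 0 <= Q by rewrite le_max Q00.
pose M := m.+1%:R * Q; have M0 : 0 <= M by rewrite mulr_ge0.
(* [eta] limits the effect of the state deviation, and [d1] that of the deviations of [lam] and
   [psi 0], to [e / 4] each; the added 1 keeps the denominator positive. *)
pose eta := e / (8 * G * (M * P + 1)).
have MP0 : 0 <= M * P by exact: mulr_ge0.
have eta0 : 0 < eta by rewrite divr_gt0// !mulr_gt0// ltr_wpDl.
pose d1 := e / (8 * G * (1 + P)).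
have d10 : 0 < d1 by rewrite divr_gt0// !mulr_gt0// ltr_pwDl.
have [|d2 d20 d2P] := @flow_continuous r u x 0 N eta ru fx _ eta0; first by rewrite lexx N0.
exists (Num.min 1 (Num.min d1 d2)); first by rewrite !lt_min ltr01 d10 d20.
move=> y lam' p fy pa'; rewrite !lt_min => /and3P[y1 _ y2] /and3P[_ l1 _] /and3P[_ p1 _] t tN.
have y0 : `|y 0| <= `|x 0| + 1.
  by rewrite -lerBlDl; apply: (le_trans (lerB_dist _ _)); exact: ltW.
have xr : within_radius rho x by apply: (rhoP u x ur fx); rewrite lerDl.
have yr := rhoP u y ur fy y0.
have xy t' : 0 <= t' <= N -> `|x t' - y t'| <= eta.
  by move=> tN'; rewrite distrC ltW// (d2P y fy).
have psiQ t' : 0 <= t' <= N -> `|psi t'| <= Q by move=> /Q0P h; rewrite le_max h.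
have lQ : `|lam| <= Q by rewrite le_max lexx orbT.
have N00 : 0 <= (0 : R) <= N by rewrite lexx.
have := @adjoint_close rho L N bL N0 set0 0 u u y x measurable0 _ _ urho urho _
  yr xr eta Q lam' lam p psi 0 t pa' pa (lexx 0) (ltW eta0) Qge xy psiQ lQ N00 tN.
rewrite measure0 /= !mulr0 addr0 => H.
apply: (le_lt_trans (H _ _ _)) => //; rewrite -/G -/P -/M.
have key a b c : 0 < a -> 0 < b -> 2 * a * b * (c / (8 * a * b)) = c / 4 :> R.
  by move=> a0 b0; field; rewrite !gt_eqF.
have e1 : 2 * G * (M * P + 1) * eta = e / 4.
  by apply: key => //; rewrite ltr_wpDl.
have e2 : 2 * G * (1 + P) * d1 = e / 4.
  by apply: key => //; rewrite ltr_pwDl.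
have b1 : M * (eta * P) <= (M * P + 1) * eta by have := ltW eta0; lra.
have b2 : `|p 0 - psi 0| + `|lam' - lam| * P <= (1 + P) * d1.
  by rewrite mulrDl mul1r; apply: lerD; [exact: ltW|rewrite mulrC ler_wpM2l// ltW].
apply: (@le_lt_trans _ _ (2 * G * ((M * P + 1) * eta + (1 + P) * d1))).
  rewrite [leLHS]mulrAC ler_wpM2l ?mulr_ge0 ?(ltW G0)//; lra.
lra.
Qed.

Lemma acd_pairing (p dp : R -> 'rV[R]_m) (w dw : R -> 'cV[R]_m) :
  acd p dp -> acd w dw ->
  acd (fun t => (p t *m w t) 0 0) (fun t => (dp t *m w t + p t *m dw t) 0 0).
Proof.
move=> /acd_mxP pa /acd_mxP wa.
have := @acd_sum R R _ (index_enum 'I_m) _ _ (fun j => acdM (pa 0 j) (wa j 0)).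
apply: acd_ext => [t _|]; first by rewrite mxE.
apply: aeW => t _; rewrite !mxE -big_split/=; apply: eq_bigr => j _; ring.
Qed.

Lemma jac_first_order r L t (x y : 'cV[R]_m) (v : 'rV[R]_k) : dyn_bound f g r L ->
  0 <= t -> `|x| <= r (Num.truncn t) -> `|y| <= r (Num.truncn t) ->
  `|v| <= r (Num.truncn t) ->
  `|f t y v - f t x v - jac (fun z => f t z v) x *m (y - x)| <= m%:R * L t * `|y - x| ^+ 2 /\
  `|g t y v - g t x v - (grad (fun z => g t z v) x *m (y - x)) 0 0| <= m%:R * L t * `|y - x| ^+ 2.
Proof.
move=> bL t0 xr yr vr; have L0 := bL.1.2 t t0; split; last first.
  apply: (first_order_bound (r := r (Num.truncn t))) => // [z|z zr].
    exact: (differentiable_cost reg).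
  by have [[]] := bL.2 t z x v t0 zr xr vr.
apply: mx_norm_le => [|i j]; first by rewrite mulr_ge0// mulr_ge0.
have df z : differentiable (fun z => f t z v) z by exact: (differentiable_dyn reg).
rewrite ord1 !mxE (_ : \sum_(j < m) _ = (grad (fun z => f t z v i 0) x *m (y - x)) 0 0); last first.
  by rewrite mxE; apply: eq_bigr => l _; rewrite jac_entry.
apply: (first_order_bound (r := r (Num.truncn t))) => // [z|z zr].
  exact: differentiable_entry.
have [[_ _ H _] _] := bL.2 t z x v t0 zr xr vr.
apply: le_trans H; apply: mx_norm_le => // a b; rewrite ord1.
have := mx_entry_norm (jac (fun z => f t z v) z - jac (fun z => f t z v) x) i b.
have := jac_entry i b (df z); have := jac_entry i b (df x).
move: (jac _ z) (jac _ x) (grad _ z) (grad _ x) => J J' G G' E' E.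
by rewrite !mxE E E'.
Qed.

End perturbation.

(** * The gain of a single needle *)

Section needle.
Context (R : realType) (m k : nat).
Variables (f : R -> 'cV[R]_m -> 'rV[R]_k -> 'cV[R]_m)
          (g : R -> 'cV[R]_m -> 'rV[R]_k -> R).
Hypothesis reg : regularity f g.
Notation mu := (@lebesgue_measure R).
Variables (r : nat -> R) (L : R -> R) (T B : R).
Hypotheses (bL : dyn_bound f g r L) (T0 : 0 <= T) (B0 : 0 <= B).

(* The derivative of J^{u'} - J^u + p (x' - x), with the terms of first order
   in x' - x cancelled by the adjoint equation. *)
Lemma needle_rate (t c W Q : R) (x x' : 'cV[R]_m) (v v' : 'rV[R]_k) (p : 'rV[R]_m) :
  0 <= t -> `|x| <= r (Num.truncn t) -> `|x'| <= r (Num.truncn t) ->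
  `|v| <= r (Num.truncn t) -> `|v'| <= r (Num.truncn t) ->
  `|x' - x| <= W -> `|p| <= Q ->
  let rate := g t x' v' - g t x v +
    (- (p *m jac (fun z => f t z v) x + 1 *: grad (fun z => g t z v) x) *m (x' - x)
     + p *m (f t x' v' - f t x v)) 0 0 in
  (v = v' -> - ((m%:R + m%:R * Q * m%:R) * W ^+ 2 * L t) <= rate) /\
  (L t <= B ->
   c <= hamiltonian f g x t v' 1 p - hamiltonian f g x t v 1 p ->
   c - (1 + m%:R * Q + m%:R + m%:R * Q * m%:R) * B * W <= rate).
Proof.
move=> t0 xr xr' vr vr' xW pQ rate; have L0 := bL.1.2 t t0.
have W0 : 0 <= W by exact: le_trans xW.
have Q0 : 0 <= Q by exact: le_trans pQ.
rewrite {}/rate; set A := jac _ _; set b := grad _ _.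
have pM n (h : 'cV[R]_m) : `|h| <= n -> `|(p *m h) 0 0| <= m%:R * Q * n.
  move=> hn; apply: (le_trans (mx_entry_norm _ _ _)); apply: (le_trans (mulmx_norm _ _)).
  by apply: ler_pM => //; rewrite ler_wpM2l.
(* Where the control is unchanged, the adjoint terms leave only second-order remainders. On the
   needle an error linear in [W] is affordable: it is integrated over a set of measure [d], and [W]
   is of order [d]. *)
split=> [vv'|LB Hc].
  have [fo go] := jac_first_order reg bL t0 xr xr' vr.
  rewrite -/A -/b in fo go.
  have W2 : `|x' - x| ^+ 2 <= W ^+ 2 by rewrite ler_pXn2r// nnegrE.
  have fo' : `|f t x' v - f t x v - A *m (x' - x)| <= m%:R * L t * W ^+ 2.
    by apply: (le_trans fo); rewrite ler_wpM2l// mulr_ge0.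
  have go' : `|g t x' v - g t x v - (b *m (x' - x)) 0 0| <= m%:R * L t * W ^+ 2.
    by apply: (le_trans go); rewrite ler_wpM2l// mulr_ge0.
  rewrite -vv' [leRHS](_ : _ = (g t x' v - g t x v - (b *m (x' - x)) 0 0) +
     (p *m (f t x' v - f t x v - A *m (x' - x))) 0 0); last first.
    move: (x' - x) (f t x' v - f t x v) => w h.
    by rewrite scale1r mulNmx mulmxDl mulmxBr mulmxA !mxE; ring.
  have := lerNnormlW go'; have := lerNnormlW (pM _ _ fo'); lra.
have [[f1 g1 _ _] _] := bL.2 t x' x v' t0 xr' xr vr'.
have [_ [_ _ Ab bb]] := bL.2 t x x v t0 xr xr vr.
rewrite -/A -/b in Ab bb.
have LW : L t * `|x' - x| <= B * W by exact: ler_pM.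
have f1' := le_trans f1 LW; have g1' := le_trans g1 LW.
have b1 : `|(b *m (x' - x)) 0 0| <= m%:R * B * W.
  apply: (le_trans (mx_entry_norm _ _ _)); apply: (le_trans (mulmx_norm _ _)).
  by apply: ler_pM => //; rewrite ?mulr_ge0// ler_wpM2l//; exact: le_trans LB.
have A1 : `|A *m (x' - x)| <= m%:R * B * W.
  apply: (le_trans (mulmx_norm _ _)).
  by apply: ler_pM => //; rewrite ?mulr_ge0// ler_wpM2l//; exact: le_trans LB.
rewrite [leRHS](_ : _ = (hamiltonian f g x t v' 1 p - hamiltonian f g x t v 1 p) +
   (g t x' v' - g t x v') + (p *m (f t x' v' - f t x v')) 0 0
   - (b *m (x' - x)) 0 0 - (p *m (A *m (x' - x))) 0 0); last first.
  move: (x' - x) => w.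
  by rewrite /hamiltonian scale1r mulNmx mulmxDl !mulmxBr mulmxA !mxE; ring.
have := lerNnormlW g1'; have := lerNnormlW (pM _ _ f1').
have := le_trans (ler_norm _) b1; have := le_trans (ler_norm _) (pM _ _ A1).
lra.
Qed.

(** The boundary terms of p (x' - x) vanish, at 0 by the common initial state and at [T] by
    [p T = 0]. [C] depends on [T] but precedes the controls and the needle, so the needle's measure
    can be chosen after it. *)
Lemma needle : exists2 C, 0 <= C & forall u u' x x' p (Z : set R) c,
  control r u -> control r u' -> flow f u x -> flow f u' x' -> x 0 = x' 0 ->
  within_radius r x -> within_radius r x' -> adjoint f g x u 1 p -> p T = 0 ->
  measurable Z -> Z `<=` `[0, T] -> (forall t, Z t -> L t <= B) ->
  (forall t : R, 0 <= t -> ~ Z t -> u' t = u t) ->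
  (forall t, Z t -> c <= hamiltonian f g (x t) t (u' t) 1 (p t) -
                         hamiltonian f g (x t) t (u t) 1 (p t)) ->
  c * fine (mu Z) - C * fine (mu Z) ^+ 2 <=
  prim (fun t => g t (x' t) (u' t)) T - prim (fun t => g t (x t) (u t)) T.
Proof.
have wL := bL.1.
have P0 : 0 <= prim L T by rewrite -(prim0 wL.1); exact: (prim_mono wL).
(* [C1 * d] bounds the state deviation and [Q] the adjoint variable, estimated back from [p T = 0];
   [C2] collects the second-order remainders in front of [L], and [C3] the errors on the needle
   itself. *)
pose C1 := 4 * B * expR (2 * prim L T).
pose Q := 2 * prim L T * expR (2 * prim (fun t => m%:R * L t) T).
have C10 : 0 <= C1 by rewrite !mulr_ge0// expR_ge0.
have Q0 : 0 <= Q by rewrite !mulr_ge0// expR_ge0.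
pose C2 := (m%:R + m%:R * Q * m%:R) * C1 ^+ 2.
pose C3 := (1 + m%:R * Q + m%:R + m%:R * Q * m%:R) * B * C1.
have C20 : 0 <= C2 by rewrite mulr_ge0 ?sqr_ge0// addr_ge0// !mulr_ge0.
have C30 : 0 <= C3 by rewrite !mulr_ge0// !addr_ge0// !mulr_ge0.
exists (C3 + C2 * prim L T); first by rewrite addr_ge0// mulr_ge0.
move=> u u' x x' p Z c ru ru' fx fx' xx0 xr xr' pa pT mZ ZT ZB uu' Hc.
set d := fine (mu Z); have d0 : 0 <= d by exact: fine_ge0.
have z0 : 0 <= (0 : R) <= T by rewrite lexx.
have zT : 0 <= T <= T by rewrite lexx T0.
have W t : 0 <= t <= T -> `|x' t - x t| <= C1 * d.
  move=> tT.
  have := @state_close R m k f g r L T bL T0 Z B u u' x x' mZ ZT ZB ru.2 ru'.2 uu' xr xr' 0 t fx fx' B0 z0 tT.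
  by rewrite xx0 subrr normr0 add0r -/d => /le_trans; apply; rewrite /C1; lra.
have pQ t : 0 <= t <= T -> `|p t| <= Q.
  move=> tT; have := @adjoint_bound R m k f g reg r L T bL T0 u x 1 p T t ru.2 xr pa zT tT.
  by rewrite pT normr0 normr1 mul1r add0r.
have gi := payoff_integrable reg ru fx; have gi' := payoff_integrable reg ru' fx'.
have dJ := acdB (acd_prim gi') (acd_prim gi).
have dx := acdB (fx' : acd x' (fun t => f t (x' t) (u' t))) (fx : acd x (fun t => f t (x t) (u t))).
have dth := acdD dJ (acd_pairing (adjoint_acd reg pa) dx).
have wI := weight_indic mZ.
have dlow := acdB (acdZ (c - C3 * d) (acd_prim wI.1)) (acdZ (C2 * d ^+ 2) (acd_prim wL.1)).
apply: (le_trans _ (le_trans (acd_le2 (lexx 0) T0 dlow dth _) _)).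
- rewrite /= !(prim0 wI.1) !(prim0 wL.1) prim_indic// -/d !scaler0 !subr0.
  rewrite le_eqVlt; apply/orP; left; apply/eqP.
  by rewrite !(_ : forall a b : R, a *: b = a * b)//; ring.
- apply: aeW => t /[dup] tT /andP[t0 tT'].
  have [R1 R2] := needle_rate c t0 (xr t t0) (xr' t t0) (ru.2 t t0) (ru'.2 t t0) (W t tT) (pQ t tT).
  rewrite !(_ : forall a b : R, a *: b = a * b)//.
  have L0 := wL.2 t t0; have CL : 0 <= C2 * d ^+ 2 * L t by exact: (mulr_ge0 (mulr_ge0 C20 (sqr_ge0 d)) L0).
  have [Zt|Zt] := pselect (Z t).
    rewrite (_ : \1_Z t = 1 :> R); last by rewrite indicE mem_set.
    rewrite mulr1; apply: le_trans (R2 (ZB t Zt) (Hc t Zt)).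
    by rewrite /C3; lra.
  rewrite (_ : \1_Z t = 0 :> R); last by rewrite indicE memNset.
  rewrite mulr0 sub0r; apply: le_trans (R1 (esym (uu' t t0 Zt))).
  by rewrite /C2; lra.
- by rewrite pT !mul0mx xx0 subrr mulmx0 !mxE !addr0 (prim0 gi) (prim0 gi') subrr subr0.
Qed.
End needle.

(** * Violation of the maximum condition *)

Section violation.
Context (R : realType) (m k : nat).
Variables (f : R -> 'cV[R]_m -> 'rV[R]_k -> 'cV[R]_m)
          (g : R -> 'cV[R]_m -> 'rV[R]_k -> R) (U : R -> set 'rV[R]_k).
Hypotheses (reg : regularity f g) (borelU : borel_graph U).
Notation mu := (@lebesgue_measure R).
Notation lebT := (caratheodory_type (wlength (@idfun R))^*%mu).
Notation Z := (R * 'rV[R]_k)%type.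
Notation borelZ := (g_sigma_algebraType (@open Z)).

Lemma measurable_hamiltonian (x : R -> 'cV[R]_m) (p : R -> 'rV[R]_m) lam :
  (forall i j, measurable_fun (`[0, +oo[%classic : set R) (fun t => x t i j)) ->
  (forall i j, measurable_fun (`[0, +oo[%classic : set R) (fun t => p t i j)) ->
  exists N : set R, [/\ measurable N, mu N = 0%E &
    forall d (T : measurableType d) (D : set T) (th : T -> R)
      (u : T -> 'rV[R]_k), measurable D ->
    (forall w, D w -> 0 <= th w /\ ~ N (th w)) -> measurable_fun D th ->
    (forall i j, measurable_fun D (fun w => u w i j)) ->
    measurable_fun D (fun w => hamiltonian f g (x (th w)) (th w) (u w) lam (p (th w)))].
Proof.
move=> mx mp.
have [Nf [mNf Nf0 Hf]] := caratheodory_off_null (regular_dyn reg).1.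
have [Ng [mNg Ng0 Hg]] := caratheodory_off_null (regular_cost reg).1.
exists (Nf `|` Ng); split; first exact: measurableU.
  by rewrite measureU0.
move=> d T D th u mD DN mth mu'.
have mxt i j : measurable_fun D (fun w => x (th w) i j).
  apply: (@measurable_comp _ _ _ _ _ _ (`[0, +oo[%classic : set R) (fun t => x t i j)) => //.
  by move=> _ [w /DN[t0 _] <-]; rewrite /= in_itv/= t0.
have mpt i j : measurable_fun D (fun w => p (th w) i j).
  apply: (@measurable_comp _ _ _ _ _ _ (`[0, +oo[%classic : set R) (fun t => p t i j)) => //.
  by move=> _ [w /DN[t0 _] <-]; rewrite /= in_itv/= t0.
rewrite /hamiltonian; apply: measurable_funD.
  rewrite (_ : (fun w => _) = (fun w => \sum_(j < m) p (th w) 0 j * f (th w) (x (th w)) (u w) j 0)); last first.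
    by apply/funext => w; rewrite mxE.
  apply: measurable_sum => j; apply: measurable_funM => //.
  apply: (Hf (fun v : 'cV[R]_m => v j 0)) => //; first exact: coord_continuous.
  by move=> w /DN[t0 Nt]; split => // ?; apply: Nt; left.
apply: measurable_funM; first exact: measurable_cst.
apply: (Hg idfun) => //.
  by move=> ?.
by move=> w /DN[t0 Nt]; split => // ?; apply: Nt; right.
Qed.

(** One index [N] bounds the time and the control and gives the gap 1/(N+1). If every set [E N] of
    such pairs had a null projection, countable additivity would give the maximum condition off a
    null set; otherwise a measurable selection exists in some [E N]. *)
Lemma max_violation u0 (x dx : R -> 'cV[R]_m) (psi dpsi : R -> 'rV[R]_m) lam :
  admissible U u0 -> acd x dx -> acd psi dpsi ->
  ~ {ae leb, forall t : R, 0 <= t ->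
    ereal_sup [set (hamiltonian f g (x t) t p lam (psi t))%:E | p in U t] =
    (hamiltonian f g (x t) t (u0 t) lam (psi t))%:E} ->
  exists (N : nat) (P : set R) (v : R -> 'rV[R]_k),
    [/\ measurable P, (0 < mu P)%E, P `<=` `[0, N%:R],
      @measurable_fun _ _ (measurableTypeR R) (g_sigma_algebraType (@open 'rV[R]_k)) P v &
      forall t, P t -> [/\ U t (v t), `|v t| <= N%:R &
        N.+1%:R^-1 <= hamiltonian f g (x t) t (v t) lam (psi t) -
                      hamiltonian f g (x t) t (u0 t) lam (psi t)]].
Proof.
move=> adm xa pa nmax.
have [bu0 _ Uu0] := adm.
have mx i j := acd_measurable i j xa.
have mp i j := acd_measurable i j pa.
have [N0 [mN0 N00 mH]] := @measurable_hamiltonian x psi lam mx mp.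
pose gap (z : Z) := hamiltonian f g (x z.1) z.1 z.2 lam (psi z.1) -
  hamiltonian f g (x z.1) z.1 (u0 z.1) lam (psi z.1).
have mfst : @measurable_fun _ _ borelZ R setT fst by apply: continuous_borel; exact: fst_continuous.
pose D N : set borelZ := fst @^-1` (`[0, N%:R] `\` N0).
have mD N : measurable (D N).
  rewrite -[D N]setTI; apply: mfst => //; apply: measurableD => //; exact: measurable_itv.
have mgap N : measurable_fun (D N) gap.
  have DN (w : borelZ) : D N w -> 0 <= w.1 /\ ~ N0 w.1.
    by move=> [/= + Nw]; rewrite in_itv/= => /andP[].
  have mf1 : measurable_fun (D N) (fst : borelZ -> R) by exact: measurable_funS mfst.
  apply: measurable_funB; apply: (mH _ _ (D N)) => // i j.
    apply: (@measurable_funS _ _ _ _ setT) => //.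
    rewrite (_ : i = 0); last by rewrite ord1.
    by apply: continuous_borel; exact: coord_continuous_snd.
  apply: (@measurable_comp _ _ _ _ _ _ (`[0, +oo[%classic : set R) (fun t => u0 t i j)) => //.
    by move=> _ [w /DN[t0 _] <-]; rewrite /= in_itv/= t0.
  exact: borel_on_time_entry.
pose E (N : nat) : set borelZ := ([set z : Z | 0 <= z.1 /\ U z.1 z.2] `&` [set z | `|z.2| <= N%:R])
  `&` (D N `&` gap @^-1` `[N.+1%:R^-1, +oo[).
have mE N : measurable (E N).
  apply: measurableI; last by apply: mgap => //; exact: measurable_itv.
  apply: measurableI => //.
  have mn : @measurable_fun _ _ borelZ R setT (fun z : Z => `|z.2|).
    apply: continuous_borel => z; apply: cvg_norm; exact: cvg_snd.
  rewrite (_ : [set z : Z | _] = setT `&` (fun z : Z => `|z.2|) @^-1` `]-oo, N%:R]).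
    by apply: mn => //; exact: measurable_itv.
  by rewrite setTI; apply/seteqP; split=> z /=; rewrite in_itv.
have [N EN] : exists N, (0 < mu (fst @` E N))%E.
  apply: contrapT => nE; apply: nmax.
  have E0 N : leb.-negligible (fst @` E N).
    apply: leb_null; apply/eqP; rewrite eq_le outer_measure_ge0 andbT leNgt.
    by apply/negP => ?; apply: nE; exists N.
  have nN0 : leb.-negligible N0 by apply/leb_negligibleE; exists N0; split.
  apply: (negligibleS _ (negligibleU nN0 (negligible_bigcup E0))) => t /= nt.
  apply: contrapT => nNE; apply: nt => t0.
  apply/eqP; rewrite eq_le; apply/andP; split; last first.
    by apply: ereal_sup_ubound; exists (u0 t) => //; exact: Uu0.
  apply: ge_ereal_sup => _ [p Up <-]; rewrite lee_fin leNgt; apply/negP => Hp.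
  have nN0t : ~ N0 t by move=> ?; apply: nNE; left.
  apply: nNE; right.
  pose e := hamiltonian f g (x t) t p lam (psi t) - hamiltonian f g (x t) t (u0 t) lam (psi t).
  have e0 : 0 < e by rewrite subr_gt0.
  have [n1 _ H1] := near_infty_natSinv_lt (PosNum e0).
  pose N := maxn n1 (maxn (Num.truncn t).+1 (Num.truncn `|p|).+1).
  exists N => //; exists (t, p) => //; split.
    split => //=; apply: ltW; apply: (lt_le_trans (truncnS_gt _)).
    by rewrite ler_nat !leq_max leqnn !orbT.
  split; last first.
    rewrite /= in_itv/= andbT; apply: ltW; exact: (H1 N (leq_maxl _ _)).
  split; last exact: nN0t.
  rewrite /= in_itv/= t0/=; apply: ltW; apply: (lt_le_trans (truncnS_gt _)).
  by rewrite ler_nat !leq_max leqnn !orbT.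
have [|P [v [mP P0 vE mv]]] := @measurable_selection R k (E N) N%:R (mE N) _ EN.
  move=> z [[_ zN] [[/= + _] _]]; rewrite in_itv/= => /andP[z0 z1N].
  by rewrite prod_normE ge_max ger0_norm// z1N.
exists N, P, v; split => //.
- by move=> t /vE [_ [[]]].
- move=> t /vE[[[_ Uv] vN] [_ /=]]; rewrite in_itv/= andbT => gapv.
  by split; [exact: Uv|exact: vN|exact: gapv].
Qed.

End violation.
Section neighborhood.
Context (R : realType) (m k : nat).
Variables (f : R -> 'cV[R]_m -> 'rV[R]_k -> 'cV[R]_m)
          (g : R -> 'cV[R]_m -> 'rV[R]_k -> R) (U : R -> set 'rV[R]_k).
Hypotheses (reg : regularity f g) (borelU : borel_graph U).
Notation mu := (@lebesgue_measure R).

(** [L] is only integrable, while the estimates on a needle need a pointwise bound; a Borel version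
    of [L] is bounded on a part of [P] that still has positive measure. *)
Lemma bounded_restriction (L : R -> R) (P : set R) : locally_integrable_time L ->
  measurable P -> P `<=` `[0, +oo[ -> (0 < mu P)%E ->
  exists (B : R) (P' : set R), [/\ 0 <= B, measurable P', P' `<=` P, (0 < mu P')%E
    & forall t, P' t -> L t <= B].
Proof.
move=> /locally_integrable_borel[h [mh _ hL _ _]] mP PT P0.
have [N [mN N0 hN]] := leb_negligible_cover hL.
pose A (j : nat) := (P `\` N) `&` h @^-1` `]-oo, j%:R].
have mA j : measurable (A j).
  apply: measurableI; first exact: measurableD.
  by rewrite -[_ @^-1` _]setTI; apply: mh => //; exact: measurable_itv.
have [| |j Aj] := @outer_measure_bigcup_gt R A 0%E.
- move=> i j ij t [PNt]; rewrite /= !in_itv/= => hi; split => //=.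
  by rewrite in_itv/= (le_trans hi)// ler_nat.
- rewrite (_ : \bigcup_j A j = P `\` N); last first.
    apply/seteqP; split=> [t [j _ []]//|t Pt].
    exists (Num.truncn `|h t|).+1 => //; split => //=; rewrite in_itv/=.
    by apply: (le_trans (ler_norm _)); apply: ltW; exact: truncnS_gt.
  have PN0 : mu (P `&` N) = 0%E.
    exact: (subset_measure0 (mu := mu) (measurableI _ _ mP mN) mN (@subIsetr _ _ _) N0).
  by move: P0; rewrite (measureDI mu mP mN) [X in (_ + X)%E](_ : _ = 0%E) ?adde0//; exact: PN0.
exists j%:R, (A j); split => //; first by move=> t [[]].
move=> t [[Pt Nt]]; rewrite /= in_itv/= => hj.
rewrite (_ : L t = h t)//; apply: contrapT => Lh; apply: Nt; apply: hN => /= H.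
by apply: Lh; rewrite H//; have := PT t Pt; rewrite /= in_itv/= andbT.
Qed.

(** The needle set and the selection serve a whole neighborhood of the data (x(0), lambda, psi(0)),
    as compactness requires: on [0, N] solutions depend continuously on these data, and where
    [L <= B] the Hamiltonian varies uniformly with them. *)
Lemma violation_neighborhood u0 (x0 : R -> 'cV[R]_m) (psi : R -> 'rV[R]_m) lam :
  admissible U u0 -> flow f u0 x0 -> adjoint f g x0 u0 lam psi ->
  ~ {ae leb, forall t : R, 0 <= t ->
    ereal_sup [set (hamiltonian f g (x0 t) t p lam (psi t))%:E | p in U t] =
    (hamiltonian f g (x0 t) t (u0 t) lam (psi t))%:E} ->
  exists (N : nat) (P : set R) (v : R -> 'rV[R]_k) (c d : R),
    [/\ measurable P /\ (0 < mu P)%E, P `<=` `[0, N%:R],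
      @measurable_fun _ _ (measurableTypeR R) (g_sigma_algebraType (@open 'rV[R]_k)) P v /\
      (forall t, P t -> U t (v t) /\ `|v t| <= N%:R),
      0 < c /\ 0 < d &
      forall y lam' p, flow f u0 y -> adjoint f g y u0 lam' p ->
      `|y 0 - x0 0| < d -> `|lam' - lam| < d -> `|p 0 - psi 0| < d ->
      forall t, P t ->
        c <= hamiltonian f g (y t) t (v t) lam' (p t) -
             hamiltonian f g (y t) t (u0 t) lam' (p t)].
Proof.
move=> adm fx pa /(max_violation reg borelU adm fx pa)[N [P [v [mP P0 PN mv vP]]]].
have [r0 ru0] := admissible_control adm; have [mu0 ur0] := ru0.
have PT : P `<=` `[0, +oo[.
  by move=> t /PN; rewrite /= !in_itv/= => /andP[->].
have [rho [rrho rhoP]] := flow_radius reg (fun j => r0 j + N%:R) (`|x0 0| + 1) (lexx 0).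
have [L bL] := dyn_weight reg rho.
have [B [P' [B0 mP' P'P P'0 LB]]] := bounded_restriction bL.1.1 mP PT P0.
have N0 : 0 <= N%:R :> R by [].
have [Q0 Q00 Q0P] := acd_bounded N0 (adjoint_acd reg pa).
pose Q := Num.max Q0 `|lam|.
have Qge : 0 <= Q by rewrite le_max Q00.
(* Chosen so that each of the two Hamiltonians moves by at most a quarter of the gap 1/(N+1); half
   of it remains. *)
pose M := 4 * (B + 1) * m.+1%:R * (1 + Q).
have B1 : 0 < B + 1 by rewrite ltr_wpDl.
have Q1 : 0 < 1 + Q by rewrite ltr_pwDl.
have M0 : 0 < M by rewrite !mulr_gt0.
pose e := N.+1%:R^-1 / M; have e0 : 0 < e by rewrite divr_gt0.
have z0 : 0 <= (0 : R) <= N%:R by rewrite lexx.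
have [d1 d10 H1] := flow_continuous reg ru0 fx z0 e0.
have [d2 d20 H2] := adjoint_continuous reg ru0 fx pa N0 e0.
have ur t : 0 <= t -> `|u0 t| <= rho (Num.truncn t).
  by move=> t0; apply: le_trans (rrho _); apply: le_trans (ur0 t t0) _; rewrite lerDl.
have ur' : within_radius (fun j => r0 j + N%:R) u0.
  by move=> t t0; apply: le_trans (ur0 t t0) _; rewrite lerDl.
exists N, P', v, (N.+1%:R^-1 / 2), (Num.min (Num.min 1 e) (Num.min d1 d2)); split => //.
- exact: subset_trans PN.
- by split=> [|t /P'P/vP[]//]; exact: measurable_funS mv.
- by rewrite !lt_min ltr01 e0 d10 d20.
move=> y lam' p fy pa'; rewrite !lt_min => /andP[/andP[y1 _] /andP[yd1 yd2]].
move=> /andP[/andP[_ le] /andP[_ ld2]] /andP[_ /andP[_ pd2]] t P't.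
have Pt := P'P t P't; have := PN t Pt; rewrite /= in_itv/= => tN.
have t0 : 0 <= t by case/andP: tN.
have [_ vN vgap] := vP t Pt.
have y0 : `|y 0| <= `|x0 0| + 1.
  by rewrite -lerBlDl; apply: (le_trans (lerB_dist _ _)); exact: ltW.
have yr := rhoP u0 y ur' fy y0 t t0.
have xr : `|x0 t| <= rho (Num.truncn t) by apply: (rhoP u0 x0) => //; rewrite lerDl.
have vr : `|v t| <= rho (Num.truncn t).
  apply: le_trans (rrho _); apply: (le_trans vN); rewrite lerDr.
  exact: le_trans (ur0 t t0).
have yx := ltW (H1 y fy yd1 t tN).
have pp := ltW (H2 y lam' p fy pa' yd2 ld2 pd2 t tN).
have pQ : `|psi t| <= Q by rewrite le_max Q0P.
have lQ : `|lam| <= Q by rewrite le_max lexx orbT.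
have h1 := hamiltonian_close (bL : dyn_bound f g rho L) lam' (p t) t0 yr xr vr (LB t P't) pQ lQ.
have h2 := hamiltonian_close (bL : dyn_bound f g rho L) lam' (p t) t0 yr xr (ur t t0) (LB t P't) pQ lQ.
have key : B * (m%:R * `|p t - psi t| + `|lam' - lam| + m.+1%:R * Q * `|y t - x0 t|) <= N.+1%:R^-1 / 4.
  apply: (@le_trans _ _ (B * (m.+1%:R * (1 + Q) * e))).
    rewrite ler_wpM2l//.
    have k1 : m%:R * `|p t - psi t| <= m%:R * e by rewrite ler_wpM2l.
    have k2 : m.+1%:R * Q * `|y t - x0 t| <= m.+1%:R * Q * e by rewrite ler_wpM2l// mulr_ge0.
    apply: (le_trans (lerD (lerD k1 (ltW le)) k2)).
    by rewrite -natr1 le_eqVlt; apply/orP; left; apply/eqP; ring.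
  rewrite (_ : N.+1%:R^-1 / 4 = (B + 1) * (m.+1%:R * (1 + Q) * e)); last first.
    rewrite /e /M; apply: (_ : forall a b c n : R, a != 0 -> b != 0 -> c != 0 -> n != 0 ->
      n^-1 / 4 = a * (b * c * (n^-1 / (4 * a * b * c)))); rewrite ?pnatr_eq0 ?gt_eqF//.
    by move=> a b c n a0 b0 c0 n0; field; rewrite a0 b0 c0 n0.
  by rewrite ler_wpM2r ?lerDl// mulr_ge0 ?(ltW e0)// mulr_ge0// addr_ge0.
have k1 := lerNnormlW (le_trans h1 key); have k2 := le_trans (ler_norm _) (le_trans h2 key).
have arith : forall n a b a' b' : R, n <= a - b -> - (n / 4) <= a' - a ->
  b' - b <= n / 4 -> n / 2 <= a' - b' by clear; move=> *; lra.
exact: arith vgap k1 k2.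
Qed.

End neighborhood.

(** * Accumulation of needles *)

Section improvement.
Context (R : realType) (m k : nat).
Variables (f : R -> 'cV[R]_m -> 'rV[R]_k -> 'cV[R]_m)
          (g : R -> 'cV[R]_m -> 'rV[R]_k -> R).
Hypothesis reg : regularity f g.
Notation mu := (@lebesgue_measure R).

(* The constant does not depend on the horizon T nor on the size of the adjoint
   variable, which is normalized by [ka]. *)
Lemma gap_transfer (rho : nat -> R) L (N B : R) : dyn_bound f g rho L ->
  0 <= N -> 0 <= B -> exists2 K, 0 <= K &
  forall (A : set R) u0 u x y p q (T ka : R), measurable A ->
    A `<=` `[0, N[ -> (forall t, A t -> L t <= B) ->
    control rho u0 -> control rho u ->
    (forall t : R, 0 <= t -> ~ A t -> u t = u0 t) ->
    flow f u x -> flow f u0 y -> within_radius rho x -> within_radius rho y ->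
    x N = y N -> adjoint f g x u 1 p -> adjoint f g y u0 1 q ->
    N <= T -> p T = 0 -> q T = 0 -> 1 <= ka -> `|q 0| <= ka ->
    forall t v, 0 <= t <= N -> L t <= B -> `|v| <= rho (Num.truncn t) ->
    `|hamiltonian f g (x t) t v ka^-1 (ka^-1 *: p t) -
      hamiltonian f g (y t) t v ka^-1 (ka^-1 *: q t)| <= K * fine (mu A).
Proof.
move=> bL N0 B0; have wL := bL.1.
remember (prim L N) as P eqn:PE; remember (expR (2 * P)) as E eqn:EE.
remember (expR (2 * prim (fun t => m%:R * L t) N)) as G eqn:GE.
have P0 : 0 <= P by rewrite PE -(prim0 wL.1); exact: (prim_mono wL).
have E0 : 0 <= E by rewrite EE; exact: expR_ge0.
have G0 : 0 <= G by rewrite GE; exact: expR_ge0.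
have P10 : 0 <= 2 * (1 + P) * G by apply: mulr_ge0 => //; apply: mulr_ge0 => //; lra.
(* Bounds the normalized adjoint variable of [y] on [0, N] going forward from time 0, where its norm
   is at most 1; an estimate going back from [T] would depend on [T]. The leading 1 makes [Q] bound
   [ka^-1] as well. *)
remember (1 + 2 * (1 + P) * G) as Q eqn:QE.
have Q1 : 1 <= Q by rewrite QE lerDl.
have Q0 : 0 <= Q by exact: le_trans Q1.
remember (4 * B * E) as C1 eqn:C1E.
have C10 : 0 <= C1 by rewrite C1E; apply: mulr_ge0 => //; exact: mulr_ge0.
have mQ0 : 0 <= m.+1%:R * Q by exact: mulr_ge0.
have CP0 : 0 <= C1 * P by exact: mulr_ge0.
remember (2 * (m.+1%:R * Q * (C1 * P + 2 * B)) * G) as C2 eqn:C2E.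
have C20 : 0 <= C2.
  rewrite C2E; apply: mulr_ge0 => //; apply: mulr_ge0 => //; apply: mulr_ge0 => //.
  by apply: addr_ge0 => //; exact: mulr_ge0.
exists (B * (m%:R * C2 + m.+1%:R * Q * C1)); first by apply: mulr_ge0 => //; apply: addr_ge0; apply: mulr_ge0 => //; exact: mulr_ge0.
move=> A u0 u x y p q T ka mA AN AB ru0 ru uu0 fx fy xr yr xyN pa qa NT pT qT ka1 qka t v tN LB vr.
have AN' : A `<=` `[0, N].
  by move=> s /AN; rewrite /= !in_itv/= => /andP[-> /ltW].
have [mu0 ur0] := ru0; have [mu1 ur] := ru.
set d := fine (mu A); have d0 : 0 <= d by exact: fine_ge0.
have ka0 : 0 < ka by exact: lt_le_trans ka1.
have kai : `|ka^-1| <= 1 by rewrite ger0_norm ?invr_ge0 ?(ltW ka0)// invf_le1.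
have NN : 0 <= N <= N by rewrite N0 lexx.
have NNT : N <= N <= T by rewrite lexx.
have TNT : N <= T <= T by rewrite lexx NT.
(* From [N] on the controls agree: first the trajectories coincide, then the adjoint variables, both
   zero at [T]. The horizon leaves the estimate here, since all that follows takes place on
   [0, N]. *)
have uN s : N <= s <= T -> u0 s = u s.
  move=> /andP[Ns _]; rewrite uu0//; first exact: le_trans Ns.
  by move=> /AN; rewrite /= in_itv/= ltNge Ns andbF.
have xyT s : N <= s <= T -> y s = x s.
  by move=> sNT; rewrite (trajectory_unique reg ru N0 NNT uN fx fy xyN).
have pqN : p N = q N.
  by apply: (adjoint_unique reg ru fx fy N0 TNT uN xyT pa qa _ NNT); rewrite pT qT.
have xy s : 0 <= s <= N -> `|x s - y s| <= C1 * d.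
  move=> sN.
  have := state_close bL N0 mA AN' AB ur0 ur uu0 yr xr fy fx B0 NN sN.
  rewrite xyN subrr normr0 add0r -/d -PE -EE => /le_trans; apply.
  by rewrite C1E le_eqVlt; apply/orP; left; apply/eqP; ring.
have yx s : 0 <= s <= N -> `|y s - x s| <= C1 * d by move=> /xy; rewrite distrC.
have z0 : 0 <= (0 : R) <= N by rewrite lexx.
have := adjointZ reg ka^-1 pa; have := adjointZ reg ka^-1 qa; rewrite mulr1 => qa' pa'.
have qQ s : 0 <= s <= N -> `|ka^-1 *: q s| <= Q.
  move=> sN; have := adjoint_bound reg bL N0 ur0 yr qa' z0 sN.
  rewrite -PE -GE => /le_trans; apply; rewrite QE; apply: ler_wpDl => //.
  apply: ler_wpM2r => //; apply: ler_wpM2l => //; apply: lerD; last by rewrite ler_piMl.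
  by rewrite normrZ ger0_norm ?invr_ge0 ?(ltW ka0)// ler_pdivrMl// mulr1.
have kQ : `|ka^-1| <= Q by exact: le_trans kai Q1.
have uu0' s : 0 <= s -> ~ A s -> u0 s = u s by move=> s0 As; rewrite uu0.
have pq : `|ka^-1 *: p t - ka^-1 *: q t| <= C2 * d.
  have := adjoint_close reg bL N0 mA AN' AB ur ur0 uu0' xr yr pa' qa' B0
    (mulr_ge0 C10 d0) Q0 yx qQ kQ NN tN.
  rewrite -PE -GE -/d pqN !subrr !normr0 add0r mul0r addr0 => /le_trans; apply.
  by rewrite C2E le_eqVlt; apply/orP; left; apply/eqP; ring.
have t0 : 0 <= t by case/andP: tN.
have := hamiltonian_close bL ka^-1 (ka^-1 *: p t) t0 (xr t t0) (yr t t0) vr LB (qQ t tN) kQ.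
rewrite subrr normr0 addr0 => /le_trans; apply.
rewrite -[leRHS]mulrA; apply: ler_wpM2l => //; rewrite mulrDl; apply: lerD.
  by rewrite -[leRHS]mulrA; apply: ler_wpM2l.
by rewrite -[leRHS]mulrA; apply: ler_wpM2l => //; exact: xy.
Qed.

(** The property is assumed for all smaller [e'] too, so that it passes to a minimum over the
    list. *)
Lemma seq_uniform (I : eqType) (s : seq I) (Q : I -> R -> Prop) :
  (forall z, z \in s -> exists2 e, 0 < e & forall e', 0 < e' <= e -> Q z e') ->
  exists2 e, 0 < e & forall z, z \in s -> Q z e.
Proof.
move=> H; suff [e e0 He] : exists2 e, 0 < e &
    forall z, z \in s -> forall e', 0 < e' <= e -> Q z e'.
  by exists e => // z zs; apply: He => //; rewrite e0 lexx.
elim: s H => [|a s ih] H; first by exists 1.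
have [|e e0 He] := ih; first by move=> z zs; apply: H; rewrite inE zs orbT.
have [e1 e10 He1] := H a (mem_head a s).
exists (Num.min e e1); first by rewrite lt_min e0.
move=> z; rewrite inE => /predU1P[->|zs] e' /andP[e'0]; rewrite le_min => /andP[ee ee1].
  by apply: He1; rewrite e'0.
by apply: He => //; rewrite e'0.
Qed.

Lemma hamiltonianZ (x : 'cV[R]_m) (t : R) (v : 'rV[R]_k) (c lam : R) (p : 'rV[R]_m) :
  hamiltonian f g x t v (c * lam) (c *: p) = c * hamiltonian f g x t v lam p.
Proof. by rewrite /hamiltonian -scalemxAl mxE mulrDr mulrA. Qed.

Lemma admissible_switch (U : R -> set 'rV[R]_k) u v (Z : set R) (N : R) :
  admissible U u -> measurable Z ->
  @measurable_fun _ _ (measurableTypeR R) (g_sigma_algebraType (@open 'rV[R]_k)) Z v ->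
  (forall t, Z t -> U t (v t) /\ `|v t| <= N) ->
  admissible U (fun t => if t \in Z then v t else u t).
Proof.
move=> [bu cu Uu] mZ mv vP; split.
- move=> mD D mB.
  rewrite (_ : _ `&` _ = `[0, +oo[ `&` (Z `&` v @^-1` D) `|` (`[0, +oo[ `&` u @^-1` D `\` Z)).
    apply: measurableU; first by apply: measurableI => //; exact: mv.
    by apply: measurableD => //; exact: bu.
  apply/seteqP; split=> t; rewrite /preimage /=.
    move=> [t0]; case: ifPn; rewrite ?inE ?notin_setE => Zt Dt; first by left.
    by right.
  move=> [[t0 [Zt Dt]]|[[t0 Dt] Zt]]; split => //; first by rewrite mem_set.
  by rewrite memNset.
- move=> T; have [M [Mr uM]] := cu T.
  exists (Num.max M N); split; first exact: num_real.
  move=> b; rewrite gt_max => /andP[Mb Nb] _ [t tT <-] /=.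
  case: ifPn => [|_]; last by apply: (uM b Mb); exists t.
  by rewrite inE => /vP[_ vN]; exact: le_trans vN (ltW Nb).
- move=> t t0; case: ifPn => [|_]; last exact: Uu.
  by rewrite inE => /vP[].
Qed.

Lemma gap_arith (a a1 a2 b1 b2 c : R) : `|a * a1 - b1| <= c / 4 ->
  `|a * a2 - b2| <= c / 4 -> c <= b1 - b2 -> c / 2 <= a * (a1 - a2).
Proof. by rewrite !ler_norml mulrBr => /andP[h1 _] /andP[_ h2] h3; lra. Qed.

Lemma gain_arith (n d c C J J0 J1 : R) : n * d * c / 4 <= J - J0 ->
  c / 2 * d - C * d ^+ 2 <= J1 - J -> C * d <= c / 4 -> 0 <= d ->
  (n + 1) * d * c / 4 <= J1 - J0.
Proof. by move=> h1 h2 h3 d0; have := ler_wpM2r d0 h3; rewrite expr2 in h2; lra. Qed.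

(** [TT] is the set of allowed horizons. The covering hypothesis concerns trajectories of [u0] only,
    so at each step the current trajectory is compared with one of these; the finite family [s] is
    what makes [gam] uniform over [TT]. *)
Lemma improvement (U : R -> set 'rV[R]_k) u0 (xi : 'cV[R]_m) (I : eqType) (s : seq I)
    (N : nat) (P : I -> set R) (v : I -> R -> 'rV[R]_k) (c eta : R) (TT : set R) :
  admissible U u0 -> 0 < c -> 0 < eta ->
  (forall z, z \in s -> [/\ measurable (P z), (0 < mu (P z))%E, P z `<=` `[0, N%:R],
    @measurable_fun _ _ (measurableTypeR R) (g_sigma_algebraType (@open 'rV[R]_k)) (P z) (v z) &
    forall t, P z t -> U t (v z t) /\ `|v z t| <= N%:R]) ->
  (forall T y lam q, TT T -> flow f u0 y -> adjoint f g y u0 lam q ->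
    `|y 0 - xi| < eta -> 0 <= lam -> `|(lam, q 0)| = 1 -> q T = 0 ->
    exists2 z, z \in s & forall t, P z t ->
      c <= hamiltonian f g (y t) t (v z t) lam (q t) -
           hamiltonian f g (y t) t (u0 t) lam (q t)) ->
  exists2 gam, 0 < gam & forall T, TT T -> N.+1%:R <= T ->
    exists2 u, admissible U u & gam <= payoff f g xi u T - payoff f g xi u0 T.
Proof.
move=> adm c0 eta0 HP Hcov.
have [r0 [mu0 ur0]] := admissible_control adm.
have r00 (t : R) : 0 <= t -> 0 <= r0 (Num.truncn t) by move=> t0; exact: le_trans (ur0 t t0).
pose r j := r0 j + N%:R.
have ru0 : control r u0 by apply: (control_le _ (conj mu0 ur0)) => j; rewrite lerDl.
have [rho [rrho rhoP]] := flow_radius reg r (`|xi| + 1) (lexx 0).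
have [L bL] := dyn_weight reg rho; have wL := bL.1.
(* One number gives all needle sets a lower bound [2 * a] on their measure and an upper bound [a^-1]
   on [L]. *)
have [a a0 Ha] : exists2 a : R, 0 < a & forall z, z \in s -> exists P' : set R,
    [/\ measurable P', P' `<=` P z, 2 * a <= fine (mu P') & forall t, P' t -> L t <= a^-1].
  apply: seq_uniform => z /HP[mP P0 PN _ _].
  have PT : P z `<=` `[0, +oo[ by move=> t /PN; rewrite /= !in_itv/= => /andP[->].
  have [B [P' [B0 mP' P'P P'0 LB]]] := bounded_restriction wL.1 mP PT P0.
  have P'fin : (mu P' < +oo)%E.
    apply: (@le_lt_trans _ _ (mu `[0, N%:R])).
      by apply: le_measure; rewrite ?inE//; exact: subset_trans PN.
    by rewrite lebesgue_measure_itv; case: ifP => _; rewrite ?ltry.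
  have fP' : 0 < fine (mu P') by rewrite fine_gt0// P'0.
  have B1 : 0 < B + 1 by rewrite ltr_wpDl.
  exists (Num.min (fine (mu P') / 2) (B + 1)^-1).
    by rewrite lt_min divr_gt0// invr_gt0.
  move=> e /andP[e0]; rewrite le_min => /andP[eP eB]; exists P'; split => //.
    by rewrite mulrC -ler_pdivlMr.
  move=> t /LB Lt; apply: (le_trans Lt); apply: (@le_trans _ _ (B + 1)); first by rewrite lerDl.
  by rewrite -[leLHS]invrK lef_pV2// posrE// invr_gt0.
pose B := a^-1; have B0 : 0 <= B by rewrite invr_ge0 ltW.
(* One more than [N]: the needles fill subsets of the closed [0, N], while the joining time has to
   lie outside them. *)
pose N1 : R := N.+1%:R; have N10 : 0 <= N1 by [].
have [K K0 HK] := gap_transfer bL N10 B0.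
pose x0 := trajectory f xi u0.
have [fx0 x00] := trajectoryP reg xi ru0; rewrite -/x0 in fx0 x00.
have NN : 0 <= N1 <= N1 by rewrite N10 lexx.
(* Being within [eta] of [xi] at time 0 is what the covering hypothesis asks of the comparison
   trajectory; being within 1 keeps it in the radius [rho]. *)
have e10 : 0 < Num.min eta 1 by rewrite lt_min eta0/=.
have [d3 d30 Hd3] := flow_continuous reg ru0 fx0 NN e10.
pose W := 4 * B * expR (2 * prim L N1).
have W0 : 0 <= W by rewrite !mulr_ge0// expR_ge0.
have W1 : 0 < W + 1 by rewrite ltr_wpDl.
have K1 : 0 < K + 1 by rewrite ltr_wpDl.
(* [al] is the total measure of the needles. The three bounds leave room in every needle set, keep
   the state at [N1] within [d3] of [x0], and limit the loss of the gap to [c / 4] for each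
   Hamiltonian. The horizon has not entered yet. *)
have [al [al0 ala ald alc]] : exists al, [/\ 0 < al, al <= a, W * al < d3 & K * al <= c / 4].
  exists (Num.min a (Num.min (d3 / (W + 1) / 2) (c / 4 / (K + 1)))).
  set al := Num.min _ _.
  have al0 : 0 < al by rewrite !lt_min a0 !divr_gt0.
  have [al2 al3] : al <= d3 / (W + 1) / 2 /\ al <= c / 4 / (K + 1).
    by split; rewrite !ge_min lexx !orbT.
  split => //; first by rewrite ge_min lexx.
  - move: al2; rewrite -mulrA -invfM ler_pdivlMr ?mulr_gt0//; nra.
  - move: al3; rewrite ler_pdivlMr//; nra.
exists (al * c / 4); first by rewrite !mulr_gt0.
move=> T TTT N1T.
have T0 : 0 <= T by exact: le_trans N1T.
have [C C0 HC] := needle reg bL T0 B0.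
(* The number of needles, large enough that the quadratic error of each costs at most half of its
   first-order gain [c / 2 * de]. *)
pose M := (Num.truncn (4 * C * al / c)).+1.
pose de := al / M%:R; have de0 : 0 < de by rewrite divr_gt0.
have Mde : M%:R * de = al by rewrite /de mulrC divfK// pnatr_eq0.
have CM : C * de <= c / 4.
  rewrite /de mulrA ler_pdivrMr// -ler_pdivrMl ?divr_gt0//.
  apply: le_trans (ltW (truncnS_gt _)); rewrite le_eqVlt; apply/orP; left; apply/eqP.
  by field; rewrite gt_eqF.
suff step i : (i <= M)%N -> exists (u : R -> 'rV[R]_k) (A : set R),
    [/\ admissible U u, control r u, measurable A /\ A `<=` `[0, N%:R],
      forall t, A t -> L t <= B &
      [/\ fine (mu A) = i%:R * de, forall t : R, 0 <= t -> ~ A t -> u t = u0 t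
        & i%:R * de * c / 4 <= payoff f g xi u T - payoff f g xi u0 T]].
  have [u [A [ua _ _ _ [_ _ H]]]] := step M (leqnn _).
  by exists u => //; apply: le_trans H; rewrite Mde.
elim: i => [_|i ih iM].
  exists u0, set0; split => //; first by split => // t.
  by rewrite measure0 mul0r !mul0r subrr.
have [u [A [ua ru [mA AN] AB [muA uA gu]]]] := ih (ltnW iM).
pose x := trajectory f xi u; have [fx x_0] := trajectoryP reg xi ru; rewrite -/x in fx x_0.
have ide : i%:R * de <= al.
  by rewrite /de mulrC mulrAC ler_pdivrMr// ler_pM2l// ler_nat ltnW.
have ler (t : R) : 0 <= t -> N%:R <= r (Num.truncn t) by move=> t0; rewrite lerDr r00.
have rad u' y : control r u' -> flow f u' y -> `|y 0| <= `|xi| + 1 -> within_radius rho y.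
  by move=> [_ ur']; exact: rhoP.
have xi1 : `|xi| <= `|xi| + 1 by rewrite lerDl.
have x0r : within_radius rho x0 by apply: (rad u0) => //; rewrite x00.
have xr : within_radius rho x by apply: (rad u) => //; rewrite x_0.
have rhoc (u' : R -> 'rV[R]_k) : control r u' -> control rho u' by exact: control_le.
have NN1 : N%:R <= N1 by rewrite ler_nat.
have AN1 : A `<=` `[0, N1].
  by move=> t /AN; rewrite /= !in_itv/= => /andP[-> /le_trans]; apply.
have AN1' : A `<=` `[0, N1[.
  by move=> t /AN; rewrite /= !in_itv/= => /andP[-> /le_lt_trans]; apply; rewrite ltr_nat.
have z0 : 0 <= (0 : R) <= N1 by rewrite lexx.
have xx0 : `|x N1 - x0 N1| < d3.
  have := state_close bL N10 mA AN1 AB (rhoc _ ru0).2 (rhoc _ ru).2 uA x0r xr fx0 fx B0 z0 NN.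
  rewrite x_0 x00 subrr normr0 add0r muA => /le_lt_trans; apply.
  apply: le_lt_trans ald; rewrite (_ : _ * expR _ = W * (i%:R * de)); last by rewrite /W; ring.
  exact: ler_wpM2l.
(* The comparison trajectory meets [x] at [N1], after the needles, rather than at 0, and therefore
   coincides with it up to [T]. Its initial state is only close to [xi]. *)
have [y [fy yN]] := trajectory_exists reg (x N1) ru0 N10.
have ynear : forall t, 0 <= t <= N1 -> `|y t - x0 t| < Num.min eta 1.
  by apply: Hd3 => //; rewrite yN.
have := ynear 0 z0; rewrite x00 lt_min => /andP[yeta y1].
have yr : within_radius rho y.
  apply: (rad u0) => //; rewrite -lerBlDl; apply: (le_trans (lerB_dist _ _)); exact: ltW.
have [p [pa pT]] := adjoint_exists reg 1 0 ru (fx : acd x (fun t => f t (x t) (u t))) T0.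
have [q [qa qT]] := adjoint_exists reg 1 0 ru0 (fy : acd y (fun t => f t (y t) (u0 t))) T0.
(* Dividing by [ka] puts the pair (1, q 0) on the unit sphere, where the covering hypothesis
   applies. *)
pose ka := Num.max 1 `|q 0|.
have ka1 : 1 <= ka by rewrite le_max lexx.
have qka : `|q 0| <= ka by rewrite le_max lexx orbT.
have ka0 : 0 < ka by exact: lt_le_trans ka1.
have := adjointZ reg ka^-1 qa; rewrite mulr1 => qa'.
have k1 : 0 <= ka^-1 by rewrite invr_ge0 ltW.
have k2 : `|(ka^-1, ka^-1 *: q 0)| = 1.
  rewrite prod_normE /= normrZ (ger0_norm k1).
  by rewrite -[X in Num.max X _]mulr1 -maxr_pMr// -/ka mulVf// gt_eqF.
have k3 : ka^-1 *: q T = 0 by rewrite qT scaler0.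
have [z zs Hz] := Hcov T y ka^-1 _ TTT fy qa' yeta k1 k2 k3.
have [mP _ PN mv vP] := HP z zs.
have [P' [mP' P'P aP' P'B]] := Ha z zs.
have fin (D : set R) : D `<=` `[0, N%:R] -> measurable D -> mu D \is a fin_num.
  move=> DN mD; rewrite ge0_fin_numE//.
  apply: (@le_lt_trans _ _ (mu `[0, N%:R])); first by apply: le_measure; rewrite ?inE.
  by rewrite lebesgue_measure_itv; case: ifP => _; rewrite ?ltry.
have P'N : P' `<=` `[0, N%:R] by exact: subset_trans PN.
have mPA : measurable (P' `\` A) by exact: measurableD.
have PAN : P' `\` A `<=` `[0, N%:R] by move=> t [/P'N].
(* [P'] has measure at least [2 * a], and the needles used so far together with the next one at most
   [al <= a]. *)
have dePA : 0 <= de <= fine (mu (P' `\` A)).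
  rewrite (ltW de0)/=.
  have PAA : P' `&` A `<=` `[0, N%:R] by move=> t [/P'N].
  have mPIA : measurable (P' `&` A) by exact: measurableI.
  have muP' : fine (mu P') = fine (mu (P' `\` A)) + fine (mu (P' `&` A)).
    by rewrite -fineD ?fin//; congr fine; exact: measureDI.
  have : fine (mu (P' `&` A)) <= fine (mu A).
    apply: fine_le; [exact: fin|exact: fin|apply: le_measure; rewrite ?inE//].
  have : i.+1%:R * de <= al by rewrite -Mde ler_pM2r// ler_nat.
  rewrite muA -natr1 mulrDl mul1r; have : 0 <= i%:R * de by rewrite mulr_ge0// ltW.
  move: aP' ala al0; rewrite muP'; clear.
  by move: (i%:R * de) (fine _) (fine _) => *; lra.
have [Z [mZ ZP muZ]] := measure_slice mPA PAN (ler0n R N) dePA.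
have ZA t : Z t -> ~ A t by move=> /ZP[].
have ZP' : Z `<=` P' by move=> t /ZP[].
have ZPz : Z `<=` P z by exact: subset_trans P'P.
have ZN : Z `<=` `[0, N%:R] by exact: subset_trans P'N.
pose u' t := if t \in Z then v z t else u t.
have ua' : admissible U u'.
  apply: (@admissible_switch _ _ _ _ N%:R ua mZ); first exact: measurable_funS mv.
  by move=> t /ZPz /vP.
have ru' : control r u'.
  split=> [l j|t t0]; first by apply: borel_on_time_entry; have [] := ua'.
  rewrite /u'; case: ifPn => [|_]; last exact: ru.2.
  by rewrite inE => /ZPz /vP[_ /le_trans]; apply; exact: ler.
have uu' t : 0 <= t -> ~ Z t -> u' t = u t by move=> t0 Zt; rewrite /u' memNset.
pose x' := trajectory f xi u'; have [fx' x'_0] := trajectoryP reg xi ru'; rewrite -/x' in fx' x'_0.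
have xr' : within_radius rho x' by apply: (rad u') => //; rewrite x'_0.
have KA : K * fine (mu A) <= c / 4 by apply: le_trans alc; rewrite muA ler_wpM2l.
have gapH t : Z t -> c / 2 <= hamiltonian f g (x t) t (u' t) 1 (p t) -
                              hamiltonian f g (x t) t (u t) 1 (p t).
  move=> Zt; have := ZN t Zt; rewrite /= in_itv/= => /andP[t0 tN].
  rewrite /u' mem_set// (uA t t0 (ZA t Zt)).
  have tN1 : 0 <= t <= N1 by rewrite t0 (le_trans tN).
  have HK' := HK A u0 u x y p q T ka mA AN1' AB (rhoc _ ru0) (rhoc _ ru) uA fx fy xr yr (esym yN)
    pa qa N1T pT qT ka1 qka t _ tN1 (P'B t (ZP' t Zt)).
  have vr : `|v z t| <= rho (Num.truncn t).
    apply: le_trans (rrho _); have [_ /le_trans] := vP t (ZPz t Zt); apply; exact: ler.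
  have u0r : `|u0 t| <= rho (Num.truncn t) by apply: le_trans (rrho _); exact: ru0.2.
  have hZ w : hamiltonian f g (x t) t w ka^-1 (ka^-1 *: p t) =
      ka^-1 * hamiltonian f g (x t) t w 1 (p t) by rewrite -hamiltonianZ mulr1.
  have := HK' _ vr; have := HK' _ u0r; rewrite !hZ => h2 h1.
  have ka2 := gap_arith (le_trans h1 KA) (le_trans h2 KA) (Hz t (ZPz t Zt)).
  (* The gap for lambda = 1 is [ka] times the normalized one, and [ka] is at least 1. *)
  move: ka2; rewrite [leRHS]mulrC ler_pdivlMr// => /(le_trans _); apply.
  by rewrite ler_peMr// divr_ge0// ltW.
have ZT : Z `<=` `[0, T].
  by move=> t /ZN; rewrite /= !in_itv/= => /andP[-> /le_trans]; apply; exact: le_trans N1T.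
have nd := HC u u' x x' p Z (c / 2) (rhoc _ ru) (rhoc _ ru') fx fx' (etrans x_0 (esym x'_0)) xr xr'
  pa pT mZ ZT (fun t Zt => P'B t (ZP' t Zt)) uu' gapH.
rewrite muZ in nd.
exists u', (A `|` Z); split => //.
- split; first exact: measurableU.
  by move=> t [/AN|/ZN].
- by move=> t [/AB|/ZP' /P'B].
- split.
  + rewrite measureU//; last by rewrite -subset0 => t [At /ZA].
    rewrite fineD ?fin// muA muZ -natr1 mulrDl mul1r.
    by [].
  + move=> t t0 tAZ; rewrite uu'//; last by move=> ?; apply: tAZ; right.
    by apply: uA => // ?; apply: tAZ; left.
  + by rewrite -[i.+1%:R]natr1; exact: gain_arith gu nd CM (ltW de0).
Qed.

End improvement.

(** * Limits of vanishing multipliers *)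

HB.instance Definition _ (S T : ptopologicalType) := Topological.on (S * T)%type.

Section maximum_principle.
Context (R : realType) (m k : nat).
Variables (f : R -> 'cV[R]_m -> 'rV[R]_k -> 'cV[R]_m)
          (g : R -> 'cV[R]_m -> 'rV[R]_k -> R) (U : R -> set 'rV[R]_k).
Hypotheses (reg : regularity f g) (borelU : borel_graph U).
Variables (xi : 'cV[R]_m) (u0 : R -> 'rV[R]_k).
Hypothesis u0_adm : admissible U u0.
Notation x0 := (trajectory f xi u0).
Notation Y := (R * 'rV[R]_m)%type.

Lemma overtaking_bound (e : R) : uniformly_overtaking_optimal f g U xi u0 -> 0 < e ->
  exists T0, forall T, T0 < T -> forall u, admissible U u ->
    payoff f g xi u T - payoff f g xi u0 T < e.
Proof.
move=> opt e0; have : (limf_esup (fun T : R => ereal_sup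
   [set (payoff f g xi u T - payoff f g xi u0 T)%:E | u in admissible U])
   (pinfty_nbhs R) < e%:E)%E by rewrite opt lte_fin.
rewrite limf_esupE => /ereal_inf_lt[_ [V [T0 [_ VT0]] <-] Ve].
exists T0 => T TT0 u ua; rewrite -lte_fin; apply: le_lt_trans Ve.
apply: (@le_trans _ _ (ereal_sup [set (payoff f g xi u T - payoff f g xi u0 T)%:E
  | u in admissible U])); apply: ereal_sup_ubound; first by exists u.
by exists T => //; exact: VT0.
Qed.

Lemma acd_within_continuous (V : normedModType R) (y dy : R -> V) : acd y dy ->
  {within `[0, +oo[, continuous y}.
Proof.
move=> [yac _]; apply/subspace_continuousP => t /=; rewrite in_itv/= andbT => t0.
have T0 : 0 <= t + 1 by rewrite addr_ge0.
apply/cvgrPdist_lt => e e0; have [d d0 H] := ac_uniform (yac _ T0) e0.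
rewrite near_withinE; near=> s => /=; rewrite in_itv/= andbT => s0.
have std : `|t - s| < Num.min d 1.
  by near: s; apply: (@nbhsx_ballx _ R _ _); rewrite lt_min d0/=.
move: std; rewrite lt_min => /andP[std st1].
apply: (H t s _ _ std); first by rewrite t0/= lerDl ler01.
by rewrite s0/=; have := ltW st1; rewrite ler_norml => /andP[]; lra.
Unshelve. all: by end_near.
Qed.

Lemma max_conditionP (x : R -> 'cV[R]_m) lam (p : R -> 'rV[R]_m) (t : R) : 0 <= t ->
  ereal_sup [set (hamiltonian f g (x t) t v lam (p t))%:E | v in U t] =
    (hamiltonian f g (x t) t (u0 t) lam (p t))%:E <->
  forall v, U t v -> hamiltonian f g (x t) t v lam (p t) <=
                     hamiltonian f g (x t) t (u0 t) lam (p t).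
Proof.
move=> t0; split=> [H v Uv|H].
  by rewrite -lee_fin -H; apply: ereal_sup_ubound; exists v.
apply/eqP; rewrite eq_le; apply/andP; split.
  by apply: ge_ereal_sup => _ [v Uv <-]; rewrite lee_fin; exact: H.
by apply: ereal_sup_ubound; exists (u0 t) => //; have [_ _] := u0_adm; exact.
Qed.

Section horizons.
Variable tau : nat -> R.
Hypothesis tau_unbounded : forall B : R, exists n, B < tau n.

Lemma tau_large (n0 : nat) (B : R) : exists n, (n0 <= n)%N /\ B < tau n.
Proof.
(* A time above the sum of the first [n0] absolute values cannot be one of them. *)
have [n Hn] := tau_unbounded (Num.max B (\sum_(i < n0) `|tau i|)).
move: Hn; rewrite gt_max => /andP[Bn sn]; exists n; split => //.
rewrite leqNgt; apply/negP => nn0; move: sn; apply/negP; rewrite -leNgt.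
rewrite (bigD1 (Ordinal nn0))//= (le_trans (ler_norm _))// lerDl.
by apply: sumr_ge0.
Qed.

(** [z] is the pair (lambda, psi(0)), which determines the adjoint variable once the trajectory is
    given. Both [j <= n] and [j <= tau n] are recorded because [tau] need not be monotone, and the
    final subsequence has to increase in index and in time. *)
Record vanishing_approx (j n : nat) (z : Y) (x : R -> 'cV[R]_m) (p : R -> 'rV[R]_m) :
    Prop := VanishingApprox {
  approx_index : (j <= n)%N;
  approx_horizon : j%:R <= tau n;
  approx_flow : flow f u0 x;
  approx_init : `|x 0 - xi| < j.+1%:R^-1;
  approx_adjoint : adjoint f g x u0 z.1 p;
  approx_start : p 0 = z.2;
  approx_end : p (tau n) = 0;
  approx_pos : 0 <= z.1;
  approx_norm : `|z| = 1 }.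

Definition vanishing_data (j : nat) : set Y :=
  [set z | exists n x p, vanishing_approx j n z x p].

(** The sets [vanishing_data j] decrease, so these are the limit points of the data as [j] grows. *)
Definition limit_data : set Y := \bigcap_j closure (vanishing_data j).

Lemma vanishing_data_decr i j : (i <= j)%N -> vanishing_data j `<=` vanishing_data i.
Proof.
move=> ij z [n [x [p [jn jt fx xj pa ps pe z0 z1]]]].
exists n, x, p; split => //.
- exact: leq_trans jn.
- by apply: le_trans jt; rewrite ler_nat.
- by apply: lt_le_trans xj _; rewrite lef_pV2// ?posrE// ler_nat ltnS.
Qed.

Lemma closure_vanishing_compact j : compact (closure (vanishing_data j)).
Proof.
apply: (subclosed_compact _ (@compact_norm_le_pair R m 1)); first exact: closed_closure.
have cl : closed [set z : Y | `|z| <= 1].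
  apply: (@closed_comp _ _ (fun z : Y => `|z|) [set t | t <= 1]); last exact: closed_le.
  by move=> z _; exact: norm_continuous.
rewrite [X in _ `<=` X](closure_id _).1//; apply: closureS.
by move=> z [n [x [p []]]] *; rewrite /= -[leRHS](_ : `|z| = 1).
Qed.

Lemma limit_data_norm z : limit_data z -> 0 <= z.1 /\ `|z| = 1.
Proof.
have cl : closed ([set z : Y | 0 <= z.1] `&` [set z | `|z| = 1]).
  apply: closedI.
    apply: (@closed_comp _ _ fst [set t : R | 0 <= t]); last exact: closed_ge.
    by move=> ? _; exact: cvg_fst.
  apply: (@closed_comp _ _ (fun z : Y => `|z|) [set 1]) => //.
  by move=> ? _; exact: norm_continuous.
move=> /(_ 0%N I) Vz; suff : ([set z : Y | 0 <= z.1] `&` [set z | `|z| = 1]) z by [].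
rewrite [X in X z]((closure_id _).1 cl).
by move: Vz; apply: closureS => z' [n [x [p []]]].
Qed.

Lemma limit_data_near z (e : R) (j : nat) : limit_data z -> 0 < e ->
  exists2 z', vanishing_data j z' & `|z' - z| < e.
Proof.
move=> Vz e0; have [z' [Vz' zz']] := Vz j I _ (nbhsx_ballx z (PosNum e0)%:num (gt0 (PosNum e0))).
exists z' => //; move: zz'; rewrite -ball_normE /= => h.
by rewrite distrC.
Qed.

(** That [limit_data] is nonempty comes out of the same contradiction: if it were empty, the finite
    cover would be empty and the covering hypothesis of [improvement] would hold vacuously. *)
Lemma limit_multiplier : uniformly_overtaking_optimal f g U xi u0 ->
  exists z psi, [/\ limit_data z, adjoint f g x0 u0 z.1 psi, psi 0 = z.2 &
    {ae leb, forall t : R, 0 <= t ->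
      ereal_sup [set (hamiltonian f g (x0 t) t v z.1 (psi t))%:E | v in U t] =
      (hamiltonian f g (x0 t) t (u0 t) z.1 (psi t))%:E}].
Proof.
move=> opt; apply: contrapT => nV.
have [r ru0] := admissible_control u0_adm.
have [fx0 x00] := trajectoryP reg xi ru0.
pose good (z : Y) (N : nat) P (v : R -> 'rV[R]_k) (c d : R) :=
  [/\ measurable P /\ (0 < @lebesgue_measure R P)%E, P `<=` `[0, N%:R],
    @measurable_fun _ _ (measurableTypeR R) (g_sigma_algebraType (@open 'rV[R]_k)) P v /\
    (forall t, P t -> U t (v t) /\ `|v t| <= N%:R),
    0 < c /\ 0 < d &
    forall y lam q, flow f u0 y -> adjoint f g y u0 lam q ->
    `|y 0 - xi| < d -> `|(lam, q 0) - z| < d ->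
    forall t, P t ->
      c <= hamiltonian f g (y t) t (v t) lam (q t) -
           hamiltonian f g (y t) t (u0 t) lam (q t)].
pose D := (nat * set R * (R -> 'rV[R]_k) * R * R)%type.
have bad (z : Y) : exists w : D, limit_data z ->
    good z w.1.1.1.1 w.1.1.1.2 w.1.1.2 w.1.2 w.2.
  have [Vz|] := pselect (limit_data z); last by exists (0%N, set0, fun=> 0, 0, 0).
  have [psi [pa ps]] := adjoint_exists reg z.1 z.2 ru0
    (fx0 : acd x0 (fun t => f t (x0 t) (u0 t))) (lexx 0).
  have [|N [P [v [c [d [H1 H2 H3 H4 H5]]]]]] :=
    violation_neighborhood reg borelU u0_adm fx0 (pa : adjoint f g x0 u0 z.1 psi).
    by move=> mx; apply: nV; exists z, psi.
  exists (N, P, v, c, d) => _; split=> // y lam q fy qa yd zd.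
  move: zd; rewrite prod_normE /= gt_max => /andP[ld qd].
  by apply: H5 => //; rewrite ?x00 ?ps.
have [w wP] := choice bad.
pose N z := (w z).1.1.1.1; pose P z := (w z).1.1.1.2.
pose v z := (w z).1.1.2; pose c z := (w z).1.2; pose d z := (w z).2.
have {}wP z : limit_data z -> good z (N z) (P z) (v z) (c z) (d z) := wP z.
have cV : compact limit_data.
  apply: (subclosed_compact _ (@closure_vanishing_compact 0%N)).
    by apply: closed_bigI => j _; exact: closed_closure.
  by move=> z /(_ 0%N I).
rewrite (@compact_cover Y) in cV.
have [||D' D'V VD'] := cV _ limit_data (fun z => ball z (d z)).
- by move=> z _; exact: ball_open.
- by move=> z Vz; exists z => //; apply: ballxx; have [_ _ _ []] := wP z Vz.
pose s : seq Y := finmap.enum_fset D'.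
pose O := \bigcup_(z in [set z | z \in s]) ball z (d z).
have oO : open O by apply: bigcup_open => z _; exact: ball_open.
(* The closures are compact and decrease to [limit_data], which lies in the open set [O]; hence one
   of them already does. *)
have [j0 Vj0] : exists j, closure (vanishing_data j) `<=` O.
  apply: contrapT => nO.
  have [|||||z Hz] := @compact_bigcap_nonempty _ (closure (vanishing_data 0))
    (fun j => closure (vanishing_data j) `&` ~` O).
  - exact: closure_vanishing_compact.
  - by move=> j; apply: closedI; [exact: closed_closure|exact: open_closedC].
  - by move=> j z [+ _]; apply: closureS; exact: vanishing_data_decr.
  - move=> i j ij z [Vz Oz]; split => //; move: z Vz {Oz}.
    by apply: closureS; exact: vanishing_data_decr.
  - move=> j; apply: contrapT => nz; apply: nO; exists j => z Vz.
    by apply: contrapT => Oz; apply: nz; exists z.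
  have [_ Oz] := Hz 0%N I; apply: Oz; apply: VD' => j _.
  by have [] := Hz j I.
have sV z : z \in s -> limit_data z by move=> /D'V /set_mem.
have [e e0 He] : exists2 e : R, 0 < e & forall z, z \in s -> e <= c z /\ e <= d z.
  apply: seq_uniform => z /sV /wP[_ _ _ [cz dz] _].
  exists (Num.min (c z) (d z)); first by rewrite lt_min cz.
  by move=> e' /andP[_]; rewrite le_min => /andP[].
pose M := \max_(z <- s) N z.
have NM z : z \in s -> (N z)%:R <= M%:R :> R by move=> zs; rewrite ler_nat; exact: leq_bigmax_seq.
(* The second bound makes the initial state admissible for [vanishing_data j0], and the first one
   for the neighborhoods given by [good]. *)
pose eta := Num.min e j0.+1%:R^-1.
have eta0 : 0 < eta by rewrite lt_min e0 invr_gt0 ltr0n.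
pose TT : set R := [set T | exists n, [/\ (j0 <= n)%N, j0%:R <= tau n & T = tau n]].
have [||gam gam0 Hgam] := @improvement R m k f g reg U u0 xi Y s M P v e eta TT u0_adm e0 eta0.
- move=> z /[dup] zs /sV /wP[[mP P0] PN [mv vP] _ _]; split => //.
    by move=> t /PN; rewrite /= !in_itv/= => /andP[-> /le_trans]; apply; exact: NM.
  by move=> t /vP[Uv vN]; split => //; apply: (le_trans vN); exact: NM.
- move=> T y lam q [n [jn jt ->]] fy qa; rewrite lt_min => /andP[ye yj] lam0 q1 qT.
  have [z zs zq] : O (lam, q 0).
    by apply: Vj0; apply: subset_closure; exists n, y, q; split.
  exists z => // t Pt; have [ec ed] := He z zs.
  have [_ _ _ _ H] := wP z (sV z zs); apply: (le_trans ec).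
  apply: H => //; first exact: lt_le_trans ed.
  by move: zq; rewrite -ball_normE /= distrC.
have [T0 HT0] := overtaking_bound opt gam0.
have [n [jn]] := tau_large j0 (Num.max T0 (Num.max M.+1%:R j0%:R)).
rewrite !gt_max => /and3P[Tn Mn jt].
have [|u ua] := Hgam (tau n) _ (ltW Mn); first by exists n; split => //; exact: ltW.
by rewrite leNgt HT0.
Qed.

(** The unit sphere of the max norm on pairs is compact and contains abnormal data with lambda = 0;
    a positive factor leads from it to the normalization of Lambda. *)
Lemma normalize_data (z : Y) : 0 <= z.1 -> `|z| = 1 ->
  exists2 a : R, 0 < a & a * z.1 = 1 \/ (a * z.1 = 0 /\ enorm (a *: z.2) = 1).
Proof.
move=> z0 z1; have [zl|zl] := ltP 0 z.1.
  by exists z.1^-1; [rewrite invr_gt0|left; rewrite mulVf// gt_eqF].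
have zE : z.1 = 0 by apply/eqP; rewrite eq_le z0 zl.
have e0 : 0 < enorm z.2.
  rewrite sqrtr_gt0 lt_neqAle eq_sym sumr_ge0 ?andbT; last by move=> i _; exact: sqr_ge0.
  rewrite psumr_eq0; last by move=> i _; exact: sqr_ge0.
  apply/negP => /allP H; move: z1; rewrite prod_normE zE normr0 (_ : z.2 = 0).
    by rewrite normr0 maxxx => /eqP; rewrite eq_sym oner_eq0.
  apply/rowP => i; rewrite mxE; apply/eqP.
  by have := H i (mem_index_enum i); rewrite /= sqrf_eq0.
exists (enorm z.2)^-1; first by rewrite invr_gt0.
right; split; first by rewrite zE mulr0.
rewrite {1}/enorm (_ : \sum_i _ = (enorm z.2)^-1 ^+ 2 * \sum_i z.2 0 i ^+ 2); last first.
  by rewrite mulr_sumr; apply: eq_bigr => i _; rewrite mxE exprMn.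
rewrite sqrtrM ?sqr_ge0// sqrtr_sqr ger0_norm ?invr_ge0 ?(ltW e0)//.
by rewrite -/(enorm z.2) mulVf// gt_eqF.
Qed.

End horizons.
End maximum_principle.

Theorem corollary3 (R : realType) (m k : nat)
    (U : R -> set 'rV[R]_k)
    (f : R -> 'cV[R]_m -> 'rV[R]_k -> 'cV[R]_m)
    (g : R -> 'cV[R]_m -> 'rV[R]_k -> R)
    (xi : 'cV[R]_m)
    (closedU : closed_valued U)
    (borelU : borel_graph U)
    (regfg : regularity f g)
    (u0 : R -> 'rV[R]_k) (x0 : R -> 'cV[R]_m)
    (u0_adm : admissible U u0)
    (x0E : x0 = trajectory f xi u0)
    (u0_opt : uniformly_overtaking_optimal f g U xi u0)
    (tau : nat -> R)
    (tau_ge0 : forall n, 0 <= tau n)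
    (tau_unbounded : forall B : R, exists n, B < tau n) :
  exists (lam0 : R) (psi0 : R -> 'rV[R]_m),
    normalized_multiplier f g U x0 u0 lam0 psi0 /\
    vanishing f g tau x0 u0 lam0 psi0.
Proof.
have [r ru0] := admissible_control u0_adm.
have [fx0 x00] := trajectoryP regfg xi ru0; rewrite -x0E in fx0 x00.
have [z [psi]] := limit_multiplier regfg borelU u0_adm tau_unbounded u0_opt.
rewrite -x0E => -[Vz pa ps mx].
have [z0 z1] := limit_data_norm Vz.
have [a a0 aP] := normalize_data z0 z1.
exists (a * z.1), (fun t => a *: psi t); split.
  have apa := adjointZ regfg a pa.
  split; last by rewrite ps; exact: aP.
  split.
  - by case: aP => [->|[-> _]]; rewrite ?ler01 lexx.
  - exact: acd_within_continuous (adjoint_acd regfg apa).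
  - move=> [az pz]; case: aP => [|[_ e1]]; first by rewrite az => /esym/eqP; rewrite oner_eq0.
    move: e1; rewrite -ps pz// /enorm big1 ?sqrtr0 => [/esym/eqP|i _]; first by rewrite oner_eq0.
    by rewrite mxE expr0n.
  - exact: apa.
  - apply: filterS mx => t H t0.
    apply: (max_conditionP f g u0_adm x0 (a * z.1) (fun t => a *: psi t) t0).2 => v Uv.
    rewrite !hamiltonianZ ler_pM2l//.
    exact: (max_conditionP f g u0_adm x0 z.1 psi t0).1 (H t0) v Uv.
have near_data j : exists w : nat * (R * 'rV[R]_m) * (R -> 'cV[R]_m) * (R -> 'rV[R]_m),
    vanishing_approx f g xi u0 tau j w.1.1.1 w.1.1.2 w.1.2 w.2 /\
    `|w.1.1.2 - z| < j.+1%:R^-1.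
  have [|z' [n [x [p H]]] z'z] := @limit_data_near _ _ _ f g xi u0 tau z j.+1%:R^-1 j Vz.
    by rewrite invr_gt0 ltr0n.
  by exists (n, z', x, p).
have [w wP] := choice near_data.
pose n j := (w j).1.1.1; pose zz j := (w j).1.1.2.
pose xx j := (w j).1.2; pose pp j := (w j).2.
(* The successor exceeds the current index [n j] and horizon [tau (n j)]; since [approx_index] and
   [approx_horizon] bound the next ones from below by this number, both sequences increase
   strictly. *)
pose next j := (maxn (maxn (n j) (Num.truncn (tau (n j)))) j).+1.
pose sg i := iter i next 0%N.
have sgS i : [/\ (sg i < sg i.+1)%N, (n (sg i) < sg i.+1)%N & tau (n (sg i)) < (sg i.+1)%:R].
  split; rewrite [sg i.+1]/= ?ltnS ?leq_max ?leqnn ?orbT//.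
  apply: (lt_le_trans (truncnS_gt _)); rewrite ler_nat ltnS.
  by rewrite !leq_max leqnn orbT.
have sgi i : (i <= sg i)%N.
  by elim: i => // i ih; have [h _ _] := sgS i; exact: leq_ltn_trans ih h.
have cvg_sg (V : normedModType R) (y : nat -> V) (l : V) :
    (forall e : R, 0 < e -> exists j0, forall j, (j0 <= j)%N -> `|y j - l| < e) ->
    y (sg i) @[i --> \oo] --> l.
  move=> H; apply/cvgrPdist_lt => e e0; have [j0 Hj0] := H e e0.
  exists j0 => // i /= ji; rewrite distrC; apply: Hj0; exact: leq_trans ji (sgi i).
have inv_small (e : R) : 0 < e -> exists j0, forall j, (j0 <= j)%N -> j.+1%:R^-1 < e.
  move=> e0; have [j0 _ H] := near_infty_natSinv_lt (PosNum e0).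
  by exists j0 => j jj; exact: H.
exists (fun i => n (sg i)), (fun i t => a *: pp (sg i) t), (fun i => xx (sg i)),
  (fun i _ => a * (zz (sg i)).1); split.
- split; apply/increasing_seqP => i; have [h1 h2 h3] := sgS i;
    have [[h4 h5 _ _ _ _ _ _ _] _] := wP (sg i.+1).
    exact: leq_trans h2 h4.
  exact: lt_le_trans h3 h5.
- apply/cvgryPge => A; exists (Num.truncn `|A|).+1 => // i /= Ai.
  have [[_ h5 _ _ _ _ _ _ _] _] := wP (sg i); apply: le_trans h5.
  apply: (le_trans (ler_norm A)); apply: (le_trans (ltW (truncnS_gt _))).
  by rewrite ler_nat; exact: leq_trans Ai (sgi i).
- move=> i; have [[_ _ fx _ xa _ _ zz0 _] _] := wP (sg i); split.
  + by move=> t _; rewrite mulr_ge0// ltW.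
  + exact: adjointZ.
  + exact: fx.
  + exact: acd_cst.
- move=> t t0; split.
  + apply: (@cvgZl_tmp _ 'rV[R]_m _ _ _ a (fun i => pp (sg i) t)).
    (* Pointwise convergence is continuous dependence on [0, t]: the initial states, [lambda] and
       [psi 0] all converge at rate 1/(j+1). *)
    apply: (@cvg_sg 'rV[R]_m (fun j => pp j t)) => e e0.
    have [d d0 Hd] := adjoint_continuous regfg ru0 fx0 pa t0 e0.
    have [j0 Hj0] := inv_small d d0; exists j0 => j /Hj0 jd.
    have [[_ _ fx xx0 xa p0 _ _ _]] := wP j.
    rewrite prod_normE gt_max /= => /andP[l1 l2].
    apply: (Hd _ _ _ fx xa) => //; last by rewrite t0 lexx.
    * by rewrite x00; exact: lt_trans jd.
    * exact: lt_trans jd.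
    * by rewrite p0 ps; exact: lt_trans jd.
  + apply: (@cvg_sg 'cV[R]_m (fun j => xx j t)) => e e0.
    have z00 : 0 <= (0 : R) <= t by rewrite lexx.
    have [d d0 Hd] := flow_continuous regfg ru0 fx0 z00 e0.
    have [j0 Hj0] := inv_small d d0; exists j0 => j /Hj0 jd.
    have [[_ _ fx xx0 _ _ _ _ _] _] := wP j.
    apply: Hd => //; last by rewrite t0 lexx.
    by rewrite x00; exact: lt_trans jd.
  + apply: (@cvgZl_tmp _ R^o _ _ _ a (fun i => (zz (sg i)).1)).
    apply: (@cvg_sg R^o (fun j => (zz j).1)) => e e0.
    have [j0 Hj0] := inv_small e e0; exists j0 => j /Hj0 jd.
    have [_] := wP j; rewrite prod_normE gt_max /= => /andP[l1 _].
    exact: lt_trans jd.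
- by move=> i; have [[_ _ _ _ _ _ pe _ _] _] := wP (sg i); rewrite /pp /n pe scaler0.
Qed.
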